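(* Let $X$ be a Banach space, let $A$ be the infinitesimal generator of a $C^0$-semigroup $(e^{tA})_{t\ge 0}$ of bounded linear operators on $X$, and let $p>1$ ($p=\infty$ allowed). Let $f_i:\mathbb{R}_0^+\times X\to X$, $i=1,\dots,m$, be continuous vector fields which satisfy Assumptions (A1) and (A2) stated in the context. Then for all $T\ge 0$, all $\xi_0\in X$ and all $u=(u_1,\dots,u_m)\in L^p([0,T],\mathbb{R}^m)$ the equation $$\dot x(t)=Ax(t)+\sum_{i=1}^m u_i(t)f_i\big(t,x(t)\big),\qquad x(0)=\xi_0,$$ has a unique mild solution on $[0,T]$, and the solution operator $$\Phi:L^p([0,T],\mathbb{R}^m)\to C([0,T],X),$$ which assigns to each control $u$ the unique mild solution, is compact and locally Lipschitz continuous.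
   Context: $\mathbb{R}_0^+=[0,\infty)$; $X$ is real or complex; $C([0,T],X)$ carries the maximum norm. A mild solution on $[0,T]$ is a continuous $x:[0,T]\to X$ with $x(t)=e^{tA}\xi_0+\sum_{i=1}^m\int_0^t e^{(t-s)A}u_i(s)f_i(s,x(s))\,ds$ for all $t\in[0,T]$ (Bochner integral). Assumption (A1) for $f:\mathbb{R}_0^+\times X\to X$: for every bounded set $C\subset X$ there exists $L\in L^\infty_{\rm loc}(\mathbb{R}_0^+,\mathbb{R}_0^+)$ such that $\|f(t,\xi)-f(t,\eta)\|\le L(t)\|\xi-\eta\|$ for all $\xi,\eta\in C$ and all $t\in\mathbb{R}_0^+$. Assumption (A2) for $f$: there exist $\alpha,\beta\in L^\infty_{\rm loc}(\mathbb{R}_0^+,\mathbb{R}_0^+)$ such that $\|f(t,\xi)\|\le\alpha(t)\|\xi\|+\beta(t)$ for all $\xi\in X$ and all $t\in\mathbb{R}_0^+$. A (not necessarily linear) map is compact if it maps bounded sets to relatively compact sets. A map is locally Lipschitz continuous if every point has a neighborhood on which the map is Lipschitz. *)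

(* Defs.v *)
From HB Require Import structures.
From mathcomp Require Import all_boot all_order all_algebra.
From mathcomp Require Import complex.
From mathcomp Require Import all_classical all_reals all_analysis.
Set Implicit Arguments.
Unset Strict Implicit.
Unset Printing Implicit Defensive.
Import Order.TTheory GRing.Theory Num.Theory.
Import numFieldNormedType.Exports.
Local Open Scope classical_set_scope.
Local Open Scope ring_scope.

(* Banach spaces may be real or complex: the scalar field is R[i] if [cplx] is
   true and R otherwise. A norm over this field has values in the field, hence
   the projection [norm] to R; real scalars act through [emb]. *)
Definition scalars (R : realType) (cplx : bool) : numFieldType :=
  if cplx then R[i] : numFieldType else R : numFieldType.

Definition emb (R : realType) (cplx : bool) : R -> scalars R cplx :=
  match cplx return R -> scalars R cplx with
  | true => fun r => real_complex R r
  | false => fun r => r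
  end.

Definition to_real (R : realType) (cplx : bool) : scalars R cplx -> R :=
  match cplx return scalars R cplx -> R with
  | true => fun z => complex.Re z
  | false => fun z => z
  end.

Definition norm (R : realType) (cplx : bool)
  (X : normedModType (scalars R cplx)) (x : X) : R := to_real `|x|.

Section Semigroup.
Context (R : realType) (cplx : bool) (X : normedModType (scalars R cplx)).

Definition bounded_linear (B : X -> X) :=
  linear B /\ exists M : R, forall x, norm (B x) <= M * norm x.

(* Only the values [S t] with [0 <= t] are meaningful. *)
Definition C0_semigroup (S : R -> X -> X) :=
  [/\ forall t, 0 <= t -> bounded_linear (S t),
      forall x, S 0 x = x,
      forall s t x, 0 <= s -> 0 <= t -> S (s + t) x = S s (S t x)
    & forall x, S h x @[h --> 0^'+] --> x].

(* An unbounded operator is given by its domain [DA] and a map [A] of which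
   only the values on [DA] are meaningful. *)
Definition infinitesimal_generator (DA : set X) (A : X -> X)
    (S : R -> X -> X) :=
  let quotient x h := emb cplx h^-1 *: (S h x - x) in
  DA = [set x | cvg (quotient x h @[h --> 0^'+])] /\
  forall x, DA x -> quotient x h @[h --> 0^'+] --> A x.

End Semigroup.

Section Bochner.
Context d (T : measurableType d) (R : realType).
Variable mu : {measure set T -> \bar R}.
Context (cplx : bool) (X : normedModType (scalars R cplx)).

Definition simple_on (D : set T) (s : T -> X) :=
  [/\ finite_set (s @` D),
      forall v, measurable (D `&` s @^-1` [set v])
    & forall v, v != 0 -> (mu (D `&` s @^-1` [set v]) < +oo)%E].

Definition simple_integral (D : set T) (s : T -> X) : X :=
  \sum_(v \in s @` D) emb cplx (fine (mu (D `&` s @^-1` [set v]))) *: v.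

(* [g] is Bochner integrable on [D] and [I] is its Bochner integral. *)
Definition has_Bochner_integral (D : set T) (g : T -> X) (I : X) :=
  exists s : nat -> T -> X,
  [/\ forall n, simple_on D (s n),
      {ae mu, forall t, D t -> s n t @[n --> \oo] --> g t},
      (\int[mu]_(t in D) (norm (g t - s n t))%:E)%E @[n --> \oo] --> 0%E
    & simple_integral D (s n) @[n --> \oo] --> I].

End Bochner.

Section Assumptions.
Context (R : realType) (cplx : bool) (X : normedModType (scalars R cplx)).

(* [measurable_fun] is Borel measurability; Lebesgue measurability is being
   almost everywhere equal to a Borel measurable function. *)
Definition Linfty_loc_nneg (L : R -> R) :=
  [/\ forall t, 0 <= t -> 0 <= L t,
      exists g : R -> R, measurable_fun (`[0, +oo[ : set R) g /\
        {ae lebesgue_measure, forall t, 0 <= t -> L t = g t}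
    & forall T, exists M, {ae lebesgue_measure, forall t, 0 <= t <= T ->
        L t <= M}].

(* A map on [0, oo) x X is given by its values [f t xi] with [0 <= t]. *)
Definition continuous_field (f : R -> X -> X) :=
  {within [set z : R * X | 0 <= z.1], continuous (fun z => f z.1 z.2)}.

Definition assumption_A1 (f : R -> X -> X) :=
  forall C : set X, bounded_set C ->
  exists2 L, Linfty_loc_nneg L &
    forall t xi eta, 0 <= t -> C xi -> C eta ->
      norm (f t xi - f t eta) <= L t * norm (xi - eta).

Definition assumption_A2 (f : R -> X -> X) :=
  exists alpha beta, [/\ Linfty_loc_nneg alpha, Linfty_loc_nneg beta &
    forall t xi, 0 <= t -> norm (f t xi) <= alpha t * norm xi + beta t].

End Assumptions.

Section Controls.
Context (R : realType) (m : nat).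

(* Lebesgue measure restricted to [0, T] *)
Definition leb (T : R) : {measure set (measurableTypeR R) -> \bar R} :=
  mrestr lebesgue_measure (measurable_itv `[0, T]).

(* The space L^p([0, T], R^m) consists of functions here, not of classes modulo
   almost everywhere equality: [Lp_norm] is a seminorm, and for the solution
   operator independence of the representative is part of the Lipschitz
   property. *)
Definition Lp (T : R) (p : \bar R) : set ('I_m -> R -> R) :=
  [set u | forall i, u i \in Lfun (leb T) p].

Definition Lp_norm (T : R) (p : \bar R) (u : 'I_m -> R -> R) : \bar R :=
  Lnorm (leb T) p (fun t => (Num.sqrt (\sum_(i < m) u i t ^+ 2))%:E).

Definition Lp_dist (T : R) (p : \bar R) (u v : 'I_m -> R -> R) : \bar R :=
  Lp_norm T p (fun i t => u i t - v i t).

End Controls.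
Arguments Lp {R m} T p _.

Section Solutions.
Context (R : realType) (cplx : bool) (X : normedModType (scalars R cplx)).

(* A map on [0, T] is represented by a map on R of which only the values on
   [0, T] matter; the uniform structure of [{uniform` `[0, T] -> X}], like
   [max_norm T], ignores the other values. *)
Definition C0T (T : R) : set {uniform` `[0, T] -> X} :=
  [set x | {within `[0, T], continuous (x : R -> X)}].
Arguments C0T T : clear implicits.

Definition max_norm (T : R) (x : R -> X) : R := sup [set norm (x t) | t in `[0, T]].

Definition mild_solution (S : R -> X -> X) (m : nat) (f : 'I_m -> R -> X -> X)
    (T : R) (xi0 : X) (u : 'I_m -> R -> R) (x : R -> X) :=
  C0T T x /\
  forall t, 0 <= t <= T -> exists I : 'I_m -> X,
    (forall i, has_Bochner_integral lebesgue_measure `[0, t]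
       (fun s => S (t - s) (emb cplx (u i s) *: f i s (x s))) (I i)) /\
    x t = S t xi0 + \sum_(i < m) I i.

Section Operators.
Context (m : nat) (T : R) (p : \bar R) (Phi : ('I_m -> R -> R) -> R -> X).

(* Closure and compactness in the subspace [C0T T]. *)
Definition compact_operator :=
  forall B : set ('I_m -> R -> R), B `<=` Lp T p ->
  (exists M : R, forall u, B u -> (Lp_norm T p u <= M%:E)%E) ->
  compact (closure (Phi @` B : set {uniform` `[0, T] -> X}) `&` C0T T).

Definition locally_Lipschitz_operator :=
  forall u0, Lp T p u0 -> exists r k : R, 0 < r /\
  forall u v, Lp T p u -> Lp T p v ->
    (Lp_dist T p u u0 < r%:E)%E -> (Lp_dist T p v u0 < r%:E)%E ->
    ((max_norm T (fun t => Phi u t - Phi v t)%R)%:E <= k%:E * Lp_dist T p u v)%E.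

End Operators.
End Solutions.

(* Main.v *)
Require Import Defs.
From mathcomp Require Import all_boot all_order all_algebra.
From mathcomp Require Import complex lra ring.
From mathcomp Require Import all_classical all_reals all_analysis.
From mathcomp Require Import measurable_realfun ess_sup_inf.
Set Implicit Arguments.
Unset Strict Implicit.
Unset Printing Implicit Defensive.
Import Order.TTheory GRing.Theory Num.Theory.
Import numFieldNormedType.Exports.
Import HBSimple.
Local Open Scope classical_set_scope.
Local Open Scope ring_scope.

(** Picard iteration [x_0 = e^{tA} xi0], [x_(k+1) = F_u x_k], where [F_u] is the
    right-hand side of the mild equation, converges to the solution uniformly
    over every bounded set of controls: since [p > 1], Hoelder's inequality
    bounds the mass of the controls on an interval by [C |I|^theta] with
    [theta > 0], so one weight [exp (lam t)] makes all the maps [F_u]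
    contractions by 1/2.  (A2) keeps the iterates in a fixed ball, on which (A1)
    is a global Lipschitz condition; the same contraction gives uniqueness and
    the Lipschitz estimate.

    Compactness needs no weak topology.  It is enough that each iterate
    [u |-> x_k u] has a totally bounded image, and this is proved by induction
    on [k]: up to a small error [f_i(s, x_k(s))] takes finitely many values
    [g], and for fixed [g] the map sending [u] to the function
    [t |-> int_0^t e^{(t-s)A} u(s) g(s) ds] is approximated by a
    Riemann-Stieltjes sum, which depends on finitely many bounded numbers: the
    integrals of [u] over the cells of a grid.  The cell containing [t]
    contributes little, again because [p > 1]. *)

(** * Real-valued norm on real and complex spaces *)

(** Strong continuity gives no continuity of [e^{tA}] in operator norm, so kernels can be compared
    only along curves: for continuous [h] the map [(t, s) |-> e^{tA} h(s)] is uniformly continuous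
    on a compact square, and the continuity and Riemann-sum estimates rest on this. The functions in
    (A1) and (A2) are bounded only almost everywhere; continuity of the fields in time turns them
    into constants valid at every time of [[0, T]]. The constants are chosen in a fixed order: (A2)
    and a first weight give a ball, the ball gives a Lipschitz constant by (A1), and this constant
    determines the weight for which the maps contract. [L^p] enters the analysis of the equation
    only through bounds on the mass of controls on intervals; the same estimates thus serve single
    controls, balls and bounded sets, and [p = oo] is treated like the other exponents. Total
    boundedness is turned into compactness through ultrafilters and the completeness of [X]. *)

Section Norm.
Context (R : realType) (cplx : bool).
Local Notation K := (scalars R cplx).

Lemma emb0 : emb cplx (0 : R) = 0.
Proof. by case: cplx. Qed.

Lemma emb1 : emb cplx (1 : R) = 1.
Proof. by case: cplx. Qed.

Lemma embD (a b : R) : emb cplx (a + b) = emb cplx a + emb cplx b.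
Proof. by case: cplx => //=; exact: rmorphD. Qed.

Lemma embM (a b : R) : emb cplx (a * b) = emb cplx a * emb cplx b.
Proof. by case: cplx => //=; exact: rmorphM. Qed.

Lemma embN (a : R) : emb cplx (- a) = - emb cplx a.
Proof. by case: cplx => //=; exact: rmorphN. Qed.

Lemma norm_emb (a : R) : `|emb cplx a| = emb cplx `|a|.
Proof. by case: cplx => //=; rewrite normc_def /= expr0n addr0 sqrtr_sqr. Qed.

Lemma emb_le (a b : R) : (emb cplx a <= emb cplx b) = (a <= b).
Proof. by case: cplx => //=; rewrite lecR. Qed.

Lemma emb_lt (a b : R) : (emb cplx a < emb cplx b) = (a < b).
Proof. by case: cplx => //=; rewrite ltcR. Qed.

Lemma embK (z : K) : 0 <= z -> emb cplx (to_real z) = z.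
Proof.
case: cplx z => //= z z0; move: z0; rewrite lecE /= => /andP[/eqP z0 _].
by case: z z0 => a b /= ->.
Qed.

Lemma to_real_emb (a : R) : to_real (emb cplx a) = a.
Proof. by case: cplx. Qed.

Context (X : normedModType K).
Implicit Types x y : X.

Lemma normE x : emb cplx (norm x) = `|x|.
Proof. by rewrite embK. Qed.

Lemma norm_ge0 x : 0 <= norm x.
Proof. by rewrite -emb_le normE emb0. Qed.

Lemma norm0 : norm (0 : X) = 0.
Proof. by rewrite /norm normr0 -emb0 to_real_emb. Qed.

Lemma norm_eq0 x : norm x = 0 -> x = 0.
Proof. by move=> x0; apply/eqP; rewrite -normr_eq0 -normE x0 emb0. Qed.

Lemma norm_le0 x : norm x <= 0 -> x = 0.
Proof. by move=> x0; apply/norm_eq0/eqP; rewrite eq_le x0 norm_ge0. Qed.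

Lemma normN x : norm (- x) = norm x.
Proof. by rewrite /norm normrN. Qed.

Lemma normB x y : norm (x - y) = norm (y - x).
Proof. by rewrite /norm distrC. Qed.

Lemma normD x y : norm (x + y) <= norm x + norm y.
Proof. by rewrite -emb_le embD !normE ler_normD. Qed.

Lemma norm_triangle z x y : norm (x - y) <= norm (x - z) + norm (z - y).
Proof. by rewrite -emb_le embD !normE ler_distD. Qed.

Lemma norm_sub x y : norm (x - y) <= norm x + norm y.
Proof. by rewrite (le_trans (normD _ _))// normN. Qed.

Lemma norm_le_sub x y : norm x <= norm y + norm (x - y).
Proof. by rewrite -[leLHS](_ : norm (y + (x - y)) = _) ?normD// addrC subrK. Qed.

Lemma norm_dist x y : `|norm x - norm y| <= norm (x - y).
Proof.
have h1 := norm_le_sub x y; have h2 := norm_le_sub y x.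
by rewrite normB in h2; rewrite ler_norml; apply/andP; split; lra.
Qed.

Lemma normZ (a : R) x : norm (emb cplx a *: x) = `|a| * norm x.
Proof.
have : emb cplx (norm (emb cplx a *: x)) = emb cplx (`|a| * norm x).
  by rewrite normE normrZ norm_emb embM normE.
by move=> /(congr1 (@to_real R cplx)); rewrite !to_real_emb.
Qed.

Lemma norm_sum (I : Type) (r : seq I) (P : pred I) (F : I -> X) :
  norm (\sum_(i <- r | P i) F i) <= \sum_(i <- r | P i) norm (F i).
Proof.
elim/big_ind2 : _ => //; first by rewrite norm0.
by move=> a b c d h1 h2; rewrite (le_trans (normD _ _))// lerD.
Qed.

Lemma cvg_normP T (F : set_system T) (f : T -> X) x : Filter F ->
  (f @ F --> x) <-> (forall e : R, 0 < e -> \forall t \near F, norm (f t - x) < e).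
Proof.
move=> FF; split=> [/cvgrPdist_lt fx e e0|fx].
  have e0' : 0 < emb cplx e by rewrite -emb0 emb_lt.
  by apply: filterS (fx _ e0') => t; rewrite -normE emb_lt normB.
apply/cvgrPdist_lt => e e0; have e0' : 0 < to_real e.
  by rewrite -emb_lt embK ?ltW// emb0.
by apply: filterS (fx _ e0') => t; rewrite -emb_lt normE embK ?ltW// distrC.
Qed.

Lemma nbhs_norm_realP x (P : set X) :
  nbhs x P <-> exists2 e : R, 0 < e & forall y, norm (y - x) < e -> P y.
Proof.
split=> [/nbhs_ballP[e /= e0 eP]|[e e0 eP]].
  exists (to_real e); first by rewrite -emb_lt embK ?ltW// emb0.
  move=> y; rewrite -emb_lt normE embK ?ltW// => xy; apply: eP.
  by rewrite -ball_normE /= distrC.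
apply/nbhs_ballP; exists (emb cplx e) => /=; first by rewrite -emb0 emb_lt.
by move=> y; rewrite -ball_normE /= distrC -normE emb_lt => /eP.
Qed.

Lemma entourage_normP (E : set (X * X)) :
  entourage E <-> exists2 e : R, 0 < e & forall x y, norm (x - y) < e -> E (x, y).
Proof.
rewrite -entourage_ballE; split=> [[e /= e0 eP]|[e e0 eP]].
  exists (to_real e); first by rewrite -emb_lt embK ?ltW// emb0.
  move=> x y; rewrite -emb_lt normE embK ?ltW// => xy; apply: eP => /=.
  by rewrite -ball_normE /=.
exists (emb cplx e) => /=; first by rewrite -emb0 emb_lt.
by move=> [x y] /=; rewrite -ball_normE /= -normE emb_lt => /eP.
Qed.

Lemma cvg_seq_normP (f : nat -> X) x : f @ \oo --> x <->
  (forall e : R, 0 < e -> exists N, forall n, (N <= n)%N -> norm (f n - x) < e).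
Proof.
rewrite cvg_normP; split=> h e /h.
  by move=> [N _ hN]; exists N => n Nn; exact: hN.
by move=> [N hN]; exists N => // n /= Nn; exact: hN.
Qed.

Lemma norm_cvg (f : nat -> X) x : f @ \oo --> x -> norm (f n) @[n --> \oo] --> norm x.
Proof.
move=> /cvg_seq_normP fx; apply/cvgrPdist_lt => e /fx[N hN].
by exists N => // n /= /hN h; rewrite distrC (le_lt_trans (norm_dist _ _)).
Qed.

Lemma norm_lim_le (f : nat -> X) x (c : R) : f @ \oo --> x ->
  (forall n, norm (f n) <= c) -> norm x <= c.
Proof.
move=> /cvg_seq_normP fx fc; rewrite leNgt; apply/negP => cx.
have e0 : 0 < norm x - c by lra.
have [N /(_ N (leqnn _)) hN] := fx _ e0; have := norm_le_sub x (f N).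
by rewrite normB => h; have := fc N; lra.
Qed.

End Norm.

(** Stated for filters, because it has to serve sequences and, in the compactness proof, the image
    of an ultrafilter under evaluation at a point. *)
Lemma cauchy_norm_cvg (R : realType) (cplx : bool)
    (X : completeNormedModType (scalars R cplx)) (F : set_system X) :
  ProperFilter F ->
  (forall e : R, 0 < e -> exists2 A, F A & forall x y, A x -> A y -> norm (x - y) <= e) ->
  exists x : X, F --> x.
Proof.
move=> FF h; have Fc : cauchy F.
  move=> E /entourage_normP[e e0 eE].
  have e20 : 0 < e / 2 by lra.
  have [A FA hA] := h _ e20.
  exists (A, A) => //= -[x y] /= [Ax Ay]; apply: eE.
  by rewrite (le_lt_trans (hA _ _ Ax Ay))//; lra.
exists (lim F); exact: cauchy_cvg.
Qed.

(** * Integrals of finitely valued functions *)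

Section Simple.
Context d (T : measurableType d) (R : realType).
Variable mu : {measure set T -> \bar R}.
Variable D : set T.
Hypothesis mD : measurable D.
Hypothesis muD : (mu D < +oo)%E.

(** The codomain is an arbitrary type, so that the pair of two simple functions is again of this
    kind and plays the role of their common refinement. *)
Definition finite_range (K : Type) (q : T -> K) :=
  finite_set (q @` D) /\ forall k, measurable (D `&` q @^-1` [set k]).

Definition fiber_mass (K : Type) (q : T -> K) (k : K) : R :=
  fine (mu (D `&` q @^-1` [set k])).

Lemma fiber_massE (K : Type) (q : T -> K) k : finite_range q ->
  (fiber_mass q k)%:E = mu (D `&` q @^-1` [set k]).
Proof.
move=> [_ mq]; rewrite fineK// ge0_fin_numE// (le_lt_trans _ muD)//.
by rewrite le_measure ?inE//; exact: mq.
Qed.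

Lemma finite_range_seq (K : choiceType) (q : T -> K) : finite_range q ->
  exists r : seq K, uniq r /\ forall t, D t -> q t \in r.
Proof.
move=> [/finite_seqP[r qr] _]; exists (undup r); split; first exact: undup_uniq.
move=> t Dt; rewrite mem_undup; have : [set` r] (q t) by rewrite -qr; exists t.
by [].
Qed.

Lemma finite_range_setU (K : choiceType) (q : T -> K) (r : seq K) (P : set K) :
  (forall t, D t -> q t \in r) ->
  D `&` q @^-1` P =
  \big[setU/set0]_(k <- r | `[< P k >]) (D `&` q @^-1` [set k]).
Proof.
move=> qr; rewrite -bigcup_seq_cond; apply/seteqP; split=> [t /= [Dt Pt]|t /=].
  by exists (q t) => //=; rewrite qr//=; exact/asboolP.
by move=> [k /= /andP[_ /asboolP Pk] [Dt qk]]; rewrite qk.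
Qed.

Lemma finite_range_measurable (K : choiceType) (q : T -> K) (P : set K) :
  finite_range q -> measurable (D `&` q @^-1` P).
Proof.
move=> Fq; have [r [_ qr]] := finite_range_seq Fq.
rewrite (finite_range_setU _ qr); apply: bigsetU_measurable => k _.
by case: Fq => _; exact.
Qed.

Lemma finite_range_comp (K K' : choiceType) (q : T -> K) (phi : K -> K') :
  finite_range q -> finite_range (phi \o q).
Proof.
move=> Fq; split=> [|k].
  by rewrite -image_comp; apply: finite_image; case: Fq.
by rewrite comp_preimage; exact: finite_range_measurable.
Qed.

Lemma finite_range_pair (K K' : choiceType) (q : T -> K) (q' : T -> K') :
  finite_range q -> finite_range q' -> finite_range (fun t => (q t, q' t)).
Proof.
move=> [Fq mq] [Fq' mq']; split=> [|[k k']].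
  apply: (sub_finite_set _ (finite_setX Fq Fq')).
  by move=> _ [t Dt <-]; split => /=; exists t.
rewrite (_ : _ `&` _ = (D `&` q @^-1` [set k]) `&` (D `&` q' @^-1` [set k'])).
  exact: measurableI.
apply/seteqP; split=> t /=; first by move=> [Dt [-> ->]].
by move=> [[Dt ->] [_ ->]].
Qed.

Lemma finite_range_comp2 (K1 K2 K' : choiceType) (q1 : T -> K1) (q2 : T -> K2)
  (h : K1 -> K2 -> K') : finite_range q1 -> finite_range q2 ->
  finite_range (fun t => h (q1 t) (q2 t)).
Proof.
move=> F1 F2.
exact: (finite_range_comp (fun k => h k.1 k.2) (finite_range_pair F1 F2)).
Qed.

Lemma finite_range_cst (K : choiceType) (c : K) : finite_range (fun=> c).
Proof.
split=> [|k]; first by apply: (sub_finite_set _ (finite_set1 c)) => _ [t _ <-].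
by rewrite preimage_cst; case: ifP => _; rewrite ?setIT// setI0.
Qed.

Lemma finite_range_measurable_fun (K : choiceType) (q : T -> K) (h : K -> R) :
  finite_range q -> measurable_fun D (fun t => h (q t)).
Proof.
move=> Fq _ Y mY; rewrite -[X in _ `&` X]/((h \o q) @^-1` Y) comp_preimage.
exact: finite_range_measurable.
Qed.

Lemma finite_range_bool (K : choiceType) (q : T -> K) (A : set T) (c : K) :
  measurable A -> finite_range q ->
  finite_range (fun t => if t \in A then q t else c).
Proof.
move=> mA Fq.
have FA : finite_range (fun t => t \in A).
  split=> [|[]]; first exact: finite_finset.
    rewrite (_ : _ `&` _ = D `&` A); first exact: measurableI.
    by apply/seteqP; split=> t /= [Dt] At; split=> //; [exact: set_mem|exact: mem_set].
  rewrite (_ : _ `&` _ = D `\` A); first exact: measurableD.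
  apply/seteqP; split=> t /= [Dt].
    by move=> /negbT /negP h; split=> // At; apply: h; exact/mem_set.
  by move=> nA; split=> //; apply/negbTE/negP => /set_mem.
exact: (finite_range_comp2 (fun (b : bool) k => if b then k else c) FA Fq).
Qed.

(** Any duplicate-free list containing the values will do, since empty fibres have mass 0; one list
    can serve several functions of the same [q]. *)
Lemma integral_finite_range (K : choiceType) (q : T -> K) (r : seq K)
    (h : K -> R) :
  finite_range q -> uniq r -> (forall t, D t -> q t \in r) ->
  (forall k, 0 <= h k) ->
  (\int[mu]_(t in D) (h (q t))%:E)%E = (\sum_(k <- r) fiber_mass q k * h k)%:E.
Proof.
move=> Fq ur qr h0.
have DE : D = \big[setU/set0]_(k <- r) (D `&` q @^-1` [set k]).
  rewrite -[LHS]setIT -(preimage_setT q) (finite_range_setU _ qr).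
  by apply: eq_bigl => k; apply/asboolP.
rewrite [in LHS]DE ge0_integral_bigsetU//; last first.
- by move=> t _; rewrite lee_fin.
- by rewrite -DE; apply/measurable_EFinP; exact: finite_range_measurable_fun.
- by move=> k k' _ _ [t /= [[_ <-] [_ <-]]].
- by case: Fq.
rewrite -sumEFin; apply: eq_bigr => k _.
rewrite (eq_integral (cst (h k)%:E)).
  by rewrite integral_cst ?fiber_massE//; [rewrite -fiber_massE// -EFinM mulrC|case: Fq].
by move=> t /set_mem [_ /= ->].
Qed.

Lemma fiber_mass_comp (K K' : choiceType) (q : T -> K) (r : seq K)
    (phi : K -> K') v :
  finite_range q -> uniq r -> (forall t, D t -> q t \in r) ->
  fiber_mass (phi \o q) v = \sum_(k <- r | phi k == v) fiber_mass q k.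
Proof.
(* Additivity of [mu] over the fibres of [q] is read off from the integral of the indicator of
   [phi k = v]. *)
move=> Fq ur qr; have := @integral_finite_range _ _ _ (fun k => (phi k == v)%:R) Fq ur qr.
move=> /(_ (fun=> ler0n _ _)).
rewrite (eq_integral (fun t => (\1_(D `&` (phi \o q) @^-1` [set v]) t)%:E)); last first.
  move=> t /set_mem Dt; rewrite indicE; congr (_%:R%:E); congr nat_of_bool.
  by apply/eqP/idP => [h|/set_mem[_]//]; exact/mem_set.
rewrite integral_indic//; last by apply: (finite_range_comp phi Fq).2.
rewrite setIAC setIid -fiber_massE; last exact: finite_range_comp.
move=> [->]; rewrite [RHS]big_mkcond; apply: eq_bigr => k _.
by case: ifP => _; rewrite ?mulr1// mulr0.
Qed.

Context (cplx : bool) (X : normedModType (scalars R cplx)).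

Lemma simple_onP (s : T -> X) : simple_on mu D s <-> finite_range s.
Proof.
split=> [[? ? _]//|[Fs ms]]; split=> // v _.
by rewrite -fiber_massE// ltry.
Qed.

(** Change of variables: the sum over the values of [phi \o q] is regrouped by the fibres of [q].
    With [q] a pair, the integrals of both components and of their combinations become sums over one
    index set. *)
Lemma simple_integral_comp (K : choiceType) (q : T -> K) (r : seq K)
    (phi : K -> X) :
  finite_range q -> uniq r -> (forall t, D t -> q t \in r) ->
  simple_integral mu D (phi \o q) =
  \sum_(k <- r) emb cplx (fiber_mass q k) *: phi k.
Proof.
move=> Fq ur qr; rewrite /simple_integral.
rewrite (fsbig_fwiden (undup (map phi r)))//=; last 3 first.
- move=> _ [t Dt <-]; rewrite /= mem_undup.
  by apply/mapP; exists (q t) => //; exact: qr.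
- exact: undup_uniq.
- move=> v [/= _ nv]; rewrite (_ : _ `&` _ = set0) ?measure0 ?emb0 ?scale0r//.
  by apply/seteqP; split=> // t /= [Dt tv]; apply: nv; exists t.
transitivity (\sum_(v <- undup (map phi r))
    \sum_(k <- r | phi k == v) emb cplx (fiber_mass q k) *: phi k).
  apply: eq_bigr => v _; rewrite -/(fiber_mass _ _) (fiber_mass_comp _ _ Fq ur qr).
  rewrite (big_morph _ (@embD R cplx) (@emb0 R cplx)) scaler_suml.
  by apply: eq_bigr => k /eqP ->.
rewrite (exchange_big_dep xpredT)//= big_seq [RHS]big_seq.
apply: eq_bigr => k kr; rewrite -big_filter.
suff -> : [seq v <- undup (map phi r) | phi k == v] = [:: phi k].
  by rewrite big_seq1.
rewrite (eq_filter (a2 := pred1 (phi k))); last by move=> v /=; rewrite eq_sym.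
by rewrite filter_pred1_uniq ?undup_uniq// mem_undup map_f.
Qed.

Lemma norm_simple_integral (s : T -> X) : finite_range s ->
  ((norm (simple_integral mu D s))%:E <= \int[mu]_(t in D) (norm (s t))%:E)%E.
Proof.
move=> Fs; have [r [ur sr]] := finite_range_seq Fs.
rewrite -[s]/(id \o s) (simple_integral_comp _ Fs ur sr).
rewrite (@integral_finite_range _ _ _ (@norm _ _ X) Fs ur sr); last first.
  by move=> k; exact: norm_ge0.
rewrite lee_fin (le_trans (norm_sum _ _ _))//; apply: ler_sum => k _.
by rewrite normZ ger0_norm// fine_ge0.
Qed.

Lemma simple_integral_lin (a : R) (s1 s2 : T -> X) :
  finite_range s1 -> finite_range s2 ->
  simple_integral mu D (fun t => emb cplx a *: s1 t + s2 t) =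
  emb cplx a *: simple_integral mu D s1 + simple_integral mu D s2.
Proof.
move=> F1 F2; have F12 := finite_range_pair F1 F2.
have [r [ur sr]] := finite_range_seq F12.
rewrite -[s1 in RHS]/(fst \o (fun t => (s1 t, s2 t))).
rewrite -[s2 in RHS]/(snd \o (fun t => (s1 t, s2 t))).
rewrite -[X in simple_integral _ _ X]/((fun k => emb cplx a *: k.1 + k.2) \o
  (fun t => (s1 t, s2 t))).
rewrite !(simple_integral_comp _ F12 ur sr) scaler_sumr -big_split/=.
apply: eq_bigr => k _; rewrite scalerDr; congr (_ + _).
by rewrite !scalerA mulrC.
Qed.

End Simple.

Lemma simple_integral_linear_map d (T : measurableType d) (R : realType)
    (mu : {measure set T -> \bar R}) (D : set T) (mD : measurable D)
    (muD : (mu D < +oo)%E) (b c : bool)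
    (Y : normedModType (scalars R b)) (X : normedModType (scalars R c))
    (L : Y -> X) (s : T -> Y) :
  {morph L : x y / x + y} ->
  (forall (a : R) y, L (emb b a *: y) = emb c a *: L y) ->
  finite_range D s ->
  L (simple_integral mu D s) = simple_integral mu D (L \o s).
Proof.
move=> LD LZ Fs; have [r [ur sr]] := finite_range_seq Fs.
have L0 : L 0 = 0 by rewrite -[X in L X](scale0r 0) -emb0 LZ emb0 scale0r.
rewrite (simple_integral_comp mD muD _ Fs ur sr).
rewrite -[s in LHS]/(id \o s) (simple_integral_comp mD muD _ Fs ur sr).
by rewrite (big_morph _ LD L0); apply: eq_bigr => k _; rewrite LZ.
Qed.

(** * Bochner integrals *)

Lemma ecvg0P (R : realType) (u : nat -> \bar R) :
  (forall n, (0 <= u n)%E) ->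
  u @ \oo --> 0%E <->
  (forall e : R, 0 < e -> exists N, forall n, (N <= n)%N -> (u n < e%:E)%E).
Proof.
move=> u0; split=> [uc e e0|h].
  have : nbhs (0%:E : \bar R) [set x | (x < e%:E)%E].
    by apply: open_nbhs_nbhs; split; [exact: open_ereal_lt_ereal|rewrite /= lte_fin].
  by move=> /uc[N _ hN]; exists N.
apply/fine_cvgP; split.
  have [N hN] := h 1 ltr01; exists N => // n /= /hN un.
  by rewrite ge0_fin_numE// (lt_trans un)// ltry.
apply/cvgrPdist_lt => e /h[N hN]; exists N => // n /= /hN un.
rewrite sub0r normrN ger0_norm ?fine_ge0// -lte_fin fineK//.
by rewrite ge0_fin_numE// (lt_trans un)// ltry.
Qed.

Lemma half_gap_absurd (R : realType) (a b c x : R) :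
  c < (b - x) / 2 -> a < x + (b - x) / 2 -> b <= a + c -> False.
Proof. by move=> *; lra. Qed.

Section Bochner.
Context d (T : measurableType d) (R : realType).
Variable mu : {measure set T -> \bar R}.
Variable D : set T.
Hypothesis mD : measurable D.
Hypothesis muD : (mu D < +oo)%E.

Section Normed.
Context (cplx : bool) (X : normedModType (scalars R cplx)).
Implicit Types (g s : T -> X) (I : X).

(** The limits hold everywhere on [D], whereas [has_Bochner_integral] has them almost everywhere.
    This makes norms of such functions Borel measurable, so that their integrals can be added and
    compared. *)
Definition strongly_measurable g :=
  exists s : nat -> T -> X, (forall n, finite_range D (s n)) /\
    forall t, D t -> s n t @[n --> \oo] --> g t.

Lemma simple_strongly_measurable s : finite_range D s -> strongly_measurable s.
Proof. by move=> Fs; exists (fun=> s); split=> // t _; exact: cvg_cst. Qed.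

Lemma strongly_measurable_norm g : strongly_measurable g ->
  measurable_fun D (fun t => norm (g t)).
Proof.
move=> [s [Fs sg]]; apply: (@measurable_fun_cvg _ _ _ _ (fun n t => norm (s n t))).
  by move=> n; exact: finite_range_measurable_fun.
by move=> t /sg; exact: norm_cvg.
Qed.

Lemma strongly_measurable_lin (a : R) g1 g2 :
  strongly_measurable g1 -> strongly_measurable g2 ->
  strongly_measurable (fun t => emb cplx a *: g1 t + g2 t).
Proof.
move=> [s1 [F1 h1]] [s2 [F2 h2]].
exists (fun n t => emb cplx a *: s1 n t + s2 n t); split.
  move=> n.
  exact: (finite_range_comp2 (fun x y : X => emb cplx a *: x + y) (F1 n) (F2 n)).
by move=> t Dt; apply: cvgD; [apply: cvgZr; exact: h1|exact: h2].
Qed.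

Lemma strongly_measurableB g1 g2 :
  strongly_measurable g1 -> strongly_measurable g2 ->
  strongly_measurable (fun t => g1 t - g2 t).
Proof.
move=> h1 h2; have := strongly_measurable_lin (-1) h2 h1.
by congr strongly_measurable; apply/funext => t; rewrite embN emb1 scaleN1r addrC.
Qed.

Lemma measurable_norm g : strongly_measurable g ->
  measurable_fun D (fun t => (norm (g t))%:E).
Proof. by move=> /strongly_measurable_norm h; exact/measurable_EFinP. Qed.

Lemma integral_normB_le g h k :
  strongly_measurable g -> strongly_measurable h -> strongly_measurable k ->
  (\int[mu]_(t in D) (norm (g t - h t))%:E <=
   \int[mu]_(t in D) (norm (k t - g t))%:E +
   \int[mu]_(t in D) (norm (k t - h t))%:E)%E.
Proof.
move=> mg mh mk; rewrite -ge0_integralD//; first last.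
- by apply: measurable_norm; exact: strongly_measurableB.
- by move=> t _; rewrite lee_fin norm_ge0.
- by apply: measurable_norm; exact: strongly_measurableB.
- by move=> t _; rewrite lee_fin norm_ge0.
apply: ge0_le_integral => //.
- by move=> t _; rewrite lee_fin norm_ge0.
- by apply: measurable_norm; exact: strongly_measurableB.
- by apply: emeasurable_funD; apply: measurable_norm; exact: strongly_measurableB.
- by move=> t _; rewrite -EFinD lee_fin (normB (k t) (g t)) norm_triangle.
Qed.

Lemma integral_norm_le g h :
  strongly_measurable g -> strongly_measurable h ->
  (\int[mu]_(t in D) (norm (h t))%:E <=
   \int[mu]_(t in D) (norm (g t))%:E +
   \int[mu]_(t in D) (norm (g t - h t))%:E)%E.
Proof.
move=> mg mh.
have m0 : strongly_measurable (fun=> 0).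
  by apply: simple_strongly_measurable; exact: finite_range_cst.
have := integral_normB_le m0 mh mg.
under eq_integral do rewrite sub0r normN.
by under [in X in (_ <= X + _)%E -> _]eq_integral do rewrite subr0.
Qed.

Lemma norm_simple_integralB s1 s2 : finite_range D s1 -> finite_range D s2 ->
  ((norm (simple_integral mu D s1 - simple_integral mu D s2))%:E <=
  \int[mu]_(t in D) (norm (s1 t - s2 t))%:E)%E.
Proof.
move=> F1 F2.
have -> : simple_integral mu D s1 - simple_integral mu D s2 =
    simple_integral mu D (fun t => emb cplx (-1) *: s2 t + s1 t).
  by rewrite (simple_integral_lin mD muD)// embN emb1 scaleN1r addrC.
have F21 := finite_range_comp2 (fun x y : X => emb cplx (-1) *: x + y) F2 F1.
rewrite (le_trans (norm_simple_integral mD muD F21))// le_eqVlt; apply/orP; left.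
by apply/eqP/eq_integral => t _; rewrite embN emb1 scaleN1r addrC.
Qed.

(** The bound for simple functions passes to the limit: if it failed with a finite right-hand side
    [G], an approximating function within half of the gap [norm I - G], both in mean and in
    integral, would contradict the simple case. *)
Lemma norm_Bochner g I : strongly_measurable g -> has_Bochner_integral mu D g I ->
  ((norm I)%:E <= \int[mu]_(t in D) (norm (g t))%:E)%E.
Proof.
move=> mg [s [Fs _ gs sI]].
have g0 : (0 <= \int[mu]_(t in D) (norm (g t))%:E)%E.
  by apply: integral_ge0 => t _; rewrite lee_fin norm_ge0.
have [->|] := eqVneq (\int[mu]_(t in D) (norm (g t))%:E)%E +oo%E; first by rewrite leey.
rewrite -ltey -ge0_fin_numE// => gfin.
rewrite -(fineK gfin) lee_fin leNgt; apply/negP => gI.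
set G := fine _ in gI.
have e0 : 0 < (norm I - G) / 2 by lra.
have int0 n : (0 <= \int[mu]_(t in D) (norm (g t - s n t))%:E)%E.
  by apply: integral_ge0 => t _; rewrite lee_fin norm_ge0.
have [N1 h1] := (ecvg0P int0).1 gs _ e0.
have [N2 h2] := (cvg_seq_normP _ _).1 sI _ e0.
have {h1} := h1 (maxn N1 N2) (leq_maxl _ _).
have {h2} := h2 (maxn N1 N2) (leq_maxr _ _).
set n := maxn N1 N2 => h2 h1; have Fn := (simple_onP mD muD _).1 (Fs n).
have h3 := norm_simple_integral mD muD Fn.
have h4 := integral_norm_le mg (simple_strongly_measurable Fn).
have : ((norm (simple_integral mu D (s n)))%:E < G%:E + ((norm I - G) / 2)%:E)%E.
  by rewrite (le_lt_trans h3)// (le_lt_trans h4)// -(fineK gfin) lteD2lE.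
rewrite -EFinD lte_fin => h5.
have := norm_le_sub I (simple_integral mu D (s n)); rewrite normB => h6.
exact: half_gap_absurd h2 h5 h6.
Qed.

Lemma Bochner_lin (a : R) g1 g2 I1 I2 :
  strongly_measurable g1 -> strongly_measurable g2 ->
  has_Bochner_integral mu D g1 I1 -> has_Bochner_integral mu D g2 I2 ->
  has_Bochner_integral mu D (fun t => emb cplx a *: g1 t + g2 t)
    (emb cplx a *: I1 + I2).
Proof.
move=> m1 m2 [s1 [F1 ae1 c1 i1]] [s2 [F2 ae2 c2 i2]].
have {}F1 n := (simple_onP mD muD _).1 (F1 n).
have {}F2 n := (simple_onP mD muD _).1 (F2 n).
have F12 n : finite_range D (fun t => emb cplx a *: s1 n t + s2 n t).
  exact: (finite_range_comp2 (fun x y : X => emb cplx a *: x + y) (F1 n) (F2 n)).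
exists (fun n t => emb cplx a *: s1 n t + s2 n t); split.
- by move=> n; apply/(simple_onP mD muD).
- apply: filterS2 ae1 ae2 => t h1 h2 Dt.
  by apply: cvgD; [apply: cvgZr; exact: h1|exact: h2].
- have m1s n : strongly_measurable (fun t => g1 t - s1 n t).
    by apply: strongly_measurableB => //; exact: simple_strongly_measurable.
  have m2s n : strongly_measurable (fun t => g2 t - s2 n t).
    by apply: strongly_measurableB => //; exact: simple_strongly_measurable.
  apply: (@squeeze_cvge _ _ _ _ (fun=> 0%E) _ (fun n =>
    `|a|%:E * \int[mu]_(t in D) (norm (g1 t - s1 n t))%:E +
    \int[mu]_(t in D) (norm (g2 t - s2 n t))%:E)%E).
  + apply: nearW => n; apply/andP; split.
      by apply: integral_ge0 => t _; rewrite lee_fin norm_ge0.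
    rewrite -ge0_integralZl//; last 2 first.
    * exact: measurable_norm.
    * by move=> t _; rewrite lee_fin norm_ge0.
    rewrite -ge0_integralD//; first last.
    * exact: measurable_norm.
    * by move=> t _; rewrite lee_fin norm_ge0.
    * by apply: measurable_funeM; exact: measurable_norm.
    * by move=> t _; rewrite mule_ge0 ?lee_fin ?norm_ge0.
    apply: ge0_le_integral => //.
    * by move=> t _; rewrite lee_fin norm_ge0.
    * apply: measurable_norm; apply: strongly_measurableB.
        exact: strongly_measurable_lin.
      exact: simple_strongly_measurable.
    * apply: emeasurable_funD; last exact: measurable_norm.
      by apply: measurable_funeM; exact: measurable_norm.
    * move=> t _; rewrite -EFinM -EFinD lee_fin -normZ.
      apply: le_trans (normD _ _); rewrite le_eqVlt; apply/orP; left; apply/eqP.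
      by congr norm; rewrite scalerBr opprD addrACA.
  + exact: cvg_cst.
  + rewrite -[X in _ --> X](_ : (`|a|%:E * 0 + 0)%E = 0%E); last by rewrite mule0 adde0.
    by apply: cvgeD => //; apply: cvgeZl.
- apply: cvg_trans (cvgD (cvgZr i1) i2).
  apply: near_eq_cvg; apply: nearW => n.
  by rewrite (simple_integral_lin mD muD).
Qed.

Lemma BochnerB g1 g2 I1 I2 :
  strongly_measurable g1 -> strongly_measurable g2 ->
  has_Bochner_integral mu D g1 I1 -> has_Bochner_integral mu D g2 I2 ->
  has_Bochner_integral mu D (fun t => g1 t - g2 t) (I1 - I2).
Proof.
move=> m1 m2 h1 h2; have := Bochner_lin (-1) m2 m1 h2 h1.
rewrite embN emb1 scaleN1r addrC; congr has_Bochner_integral.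
by apply/funext => t; rewrite scaleN1r addrC.
Qed.

Lemma Bochner_unique g I1 I2 : strongly_measurable g ->
  has_Bochner_integral mu D g I1 -> has_Bochner_integral mu D g I2 -> I1 = I2.
Proof.
move=> mg h1 h2; apply/eqP; rewrite -subr_eq0; apply/eqP/norm_le0.
rewrite -lee_fin (le_trans (norm_Bochner _ (BochnerB mg mg h1 h2)))//.
  exact: strongly_measurableB.
by rewrite integral0_eq// => t _; rewrite subrr norm0.
Qed.

End Normed.

Section Complete.
Context (cplx : bool) (X : completeNormedModType (scalars R cplx)).

Lemma Bochner_exists (g : T -> X) : strongly_measurable g ->
  (\int[mu]_(t in D) (norm (g t))%:E < +oo)%E ->
  exists I, has_Bochner_integral mu D g I.
Proof.
move=> mg gfin; have [s [Fs sg]] := mg.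
have ng := strongly_measurable_norm mg.
(* Pointwise approximations need not converge in mean, so a value exceeding twice the norm of [g] is
   replaced by 0. Where [g] is not 0 this eventually happens no more, and [3 * norm g] dominates the
   errors. *)
pose E n := D `&` [set t | norm (s n t) <= 2 * norm (g t)].
have mE n : measurable (E n).
  apply: measurable_fun_le => //; last exact: measurable_funM.
  exact: (finite_range_measurable_fun (@norm _ _ X) (Fs n)).
pose s' n t := if t \in E n then s n t else 0.
have Fs' n : finite_range D (s' n) by exact: finite_range_bool.
have le_s' n t : norm (s' n t) <= 2 * norm (g t).
  rewrite /s'; case: ifPn => [/set_mem[]//|_].
  by rewrite norm0 mulr_ge0// norm_ge0.
have s'g t : D t -> s' n t @[n --> \oo] --> g t.
  move=> Dt; have [g0|gn0] := eqVneq (g t) 0.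
    rewrite (_ : (fun n => s' n t) = fun=> g t); first exact: cvg_cst.
    apply/funext => n; rewrite g0; apply/norm_le0.
    by rewrite (le_trans (le_s' _ _))// g0 norm0 mulr0.
  have gt0 : 0 < norm (g t).
    by rewrite lt_neqAle norm_ge0 andbT eq_sym; apply: contra_neq gn0; exact: norm_eq0.
  apply: cvg_trans (sg t Dt); apply: near_eq_cvg.
  have [N hN] := (cvg_seq_normP _ _).1 (sg t Dt) _ gt0.
  exists N => // n /= /hN h; rewrite /s' ifT//; apply/mem_set; split=> //=.
  by rewrite (le_trans (norm_le_sub _ (g t)))// mulr_natl mulr2n lerD2l ltW.
have ms' n : strongly_measurable (s' n) by exact: simple_strongly_measurable.
have dom : (\int[mu]_(t in D) (norm (g t - s' n t))%:E)%E @[n --> \oo] --> 0%E.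
  have := @dominated_convergence _ _ _ mu D mD
    (fun n t => (norm (g t - s' n t))%:E) (fun=> 0%E) (fun t => (3 * norm (g t))%:E).
  case.
  - by move=> n; apply: measurable_norm; exact: strongly_measurableB.
  - exact: measurable_cst.
  - apply/aeW => t Dt; apply/ecvg0P => [n|e e0]; first by rewrite lee_fin norm_ge0.
    have [N hN] := (cvg_seq_normP _ _).1 (s'g t Dt) _ e0.
    by exists N => n /hN; rewrite lte_fin normB.
  - apply/integrableP; split; first by apply/measurable_EFinP; exact: measurable_funM.
    under eq_integral => t _ do rewrite abse_EFin ger0_norm ?mulr_ge0 ?norm_ge0// EFinM.
    rewrite ge0_integralZl//; last 2 first.
    + exact/measurable_EFinP.
    + by move=> t _; rewrite lee_fin norm_ge0.
    by rewrite lte_mul_pinfty.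
  - apply/aeW => t n Dt; rewrite abse_EFin ger0_norm ?norm_ge0// lee_fin.
    by rewrite (le_trans (norm_sub _ _))//; have := le_s' n t; lra.
  by move=> _ _; rewrite integral0.
have int0 n : (0 <= \int[mu]_(t in D) (norm (g t - s' n t))%:E)%E.
  by apply: integral_ge0 => t _; rewrite lee_fin norm_ge0.
have [I sI] : exists I : X, simple_integral mu D (s' n) @[n --> \oo] --> I.
  apply: cauchy_norm_cvg => e e0.
  have e20 : 0 < e / 2 by lra.
  have [N hN] := (ecvg0P int0).1 dom _ e20.
  exists [set x | exists2 n, (N <= n)%N & x = simple_integral mu D (s' n)].
    by exists N => // n /= Nn; exists n.
  move=> _ _ [n Nn ->] [k Nk ->].
  rewrite -lee_fin (le_trans (norm_simple_integralB (Fs' n) (Fs' k)))//.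
  rewrite (le_trans (integral_normB_le (ms' n) (ms' k) mg))//.
  by rewrite [e%:E](_ : _ = ((e / 2)%:E + (e / 2)%:E)%E) ?leeD ?ltW ?hN// -EFinD -splitr.
exists I, s'; split=> //; last exact/aeW.
by move=> n; apply/(simple_onP mD muD).
Qed.

End Complete.

End Bochner.

(** [Y] and [X] may have different scalar fields, and [L] has to respect real scalars only: the
    application takes the real line for [Y] and lets [L] multiply a fixed vector of [X]. *)
Lemma Bochner_map d (T : measurableType d) (R : realType)
    (mu : {measure set T -> \bar R}) (D : set T) (mD : measurable D)
    (muD : (mu D < +oo)%E) (b c : bool)
    (Y : normedModType (scalars R b)) (X : normedModType (scalars R c))
    (L : Y -> X) (M : R) (g : T -> Y) (I : Y) :
  {morph L : x y / x + y} ->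
  (forall (a : R) y, L (emb b a *: y) = emb c a *: L y) ->
  (forall y, norm (L y) <= M * norm y) ->
  strongly_measurable D g -> has_Bochner_integral mu D g I ->
  strongly_measurable D (L \o g) /\ has_Bochner_integral mu D (L \o g) (L I).
Proof.
move=> LD LZ LM mg [s [Fs aes cs iS]].
have LB x y : L (x - y) = L x - L y.
  by rewrite LD -scaleN1r -emb1 -embN LZ embN emb1 scaleN1r.
have Lc (f : nat -> Y) y : f @ \oo --> y -> L (f n) @[n --> \oo] --> L y.
  move=> /cvg_seq_normP fy; apply/cvg_seq_normP => e e0.
  have M0 : 0 < `|M| + 1 by rewrite ltr_wpDl.
  have [N hN] := fy (e / (`|M| + 1)) (divr_gt0 e0 M0).
  exists N => n /hN; rewrite ltr_pdivlMr// => h; rewrite -LB (le_lt_trans (LM _))//.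
  apply: le_lt_trans h; rewrite mulrC ler_wpM2l ?norm_ge0//.
  by rewrite (le_trans (ler_norm _))// lerDl.
have {}Fs n := (simple_onP mD muD _).1 (Fs n).
have mLg : strongly_measurable D (L \o g).
  have [s' [Fs' sg']] := mg; exists (fun n => L \o s' n); split.
    by move=> n; exact: finite_range_comp.
  by move=> t /sg'; exact: Lc.
split=> //; exists (fun n => L \o s n); split.
- by move=> n; apply/(simple_onP mD muD); exact: finite_range_comp.
- by apply: filterS aes => t h /h; exact: Lc.
- apply: (@squeeze_cvge _ _ _ _ (fun=> 0%E) _ (fun n =>
    `|M|%:E * \int[mu]_(t in D) (norm (g t - s n t))%:E)%E).
  + apply: nearW => n; apply/andP; split.
      by apply: integral_ge0 => t _; rewrite lee_fin norm_ge0.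
    have mB : strongly_measurable D (fun t => g t - s n t).
      by apply: strongly_measurableB => //; exact: simple_strongly_measurable.
    rewrite -ge0_integralZl//; last 2 first.
    * exact: measurable_norm.
    * by move=> t _; rewrite lee_fin norm_ge0.
    apply: ge0_le_integral => //.
    * by move=> t _; rewrite lee_fin norm_ge0.
    * apply: measurable_norm; apply: strongly_measurableB => //.
      by apply: simple_strongly_measurable; exact: finite_range_comp.
    * by apply: measurable_funeM; exact: measurable_norm.
    * move=> t _; rewrite -EFinM lee_fin /= -LB (le_trans (LM _))//.
      by rewrite ler_wpM2r ?norm_ge0 ?ler_norm.
  + exact: cvg_cst.
  + rewrite -[X in _ --> X](_ : (`|M|%:E * 0)%E = 0%E); last by rewrite mule0.
    exact: cvgeZl.
- apply: cvg_trans (Lc _ _ iS); apply: near_eq_cvg; apply: nearW => n.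
  exact: simple_integral_linear_map.
Qed.

Lemma finite_range_extend d (T : measurableType d) (D E : set T)
    (mD : measurable D) (mE : measurable E) (DE : D `<=` E) (K : choiceType)
    (c : K) (q : T -> K) :
  finite_range D q -> finite_range E (fun t => if t \in D then q t else c).
Proof.
move=> [Fn mn]; split.
  have F0 : finite_set ([set c] `|` q @` D).
    by rewrite finite_setU; split => //; exact: finite_set1.
  apply: (sub_finite_set _ F0) => _ [t Et <-].
  by case: ifPn => [/set_mem Dt|_]; [right; exists t|left].
move=> k; rewrite (_ : E `&` _ =
    (D `&` q @^-1` [set k]) `|` (if `[< k = c >] then E `\` D else set0)).
  by apply: measurableU => //; case: asboolP => // _; exact: measurableD.
apply/seteqP; split=> t /=.
  move=> [Et]; case: ifPn => [/set_mem Dt sk|/negP nD k0]; first by left.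
  by right; rewrite ifT; [split=> // Dt; apply: nD; exact/mem_set|exact/asboolP].
move=> [[Dt sk]|]; first by split; [exact: DE|rewrite mem_set].
by case: asboolP => // -> [Et nD]; split=> //; rewrite memNset.
Qed.

Lemma strongly_measurable_extend d (T : measurableType d) (R : realType)
    (D E : set T) (mD : measurable D) (mE : measurable E) (DE : D `<=` E)
    (c : bool) (X : normedModType (scalars R c)) (g : T -> X) :
  strongly_measurable D g ->
  strongly_measurable E (fun t => if t \in D then g t else 0).
Proof.
move=> [s [Fs sg]]; exists (fun n t => if t \in D then s n t else 0); split.
  by move=> n; exact: finite_range_extend.
by move=> t Et; case: ifPn => [/set_mem/sg//|_]; exact: cvg_cst.
Qed.

(** Convolutions at two times are integrals over different intervals; extension by zero brings both
    to the larger one. *)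
Lemma Bochner_extend d (T : measurableType d) (R : realType)
    (mu : {measure set T -> \bar R}) (D E : set T) (mD : measurable D)
    (mE : measurable E) (muE : (mu E < +oo)%E) (DE : D `<=` E) (c : bool)
    (X : normedModType (scalars R c)) (g : T -> X) (I : X) :
  has_Bochner_integral mu D g I ->
  has_Bochner_integral mu E (fun t => if t \in D then g t else 0) I.
Proof.
have muD : (mu D < +oo)%E.
  by rewrite (le_lt_trans _ muE)// le_measure ?inE.
move=> [s [Fs aes cs iS]].
have {}Fs n := (simple_onP mD muD _).1 (Fs n).
pose s' n t := if t \in D then s n t else 0.
have Fs' n : finite_range E (s' n) by exact: finite_range_extend.
exists s'; split.
- by move=> n; apply/(simple_onP mE muE).
- apply: filterS aes => t h Et; rewrite /s'; case: ifPn => [/set_mem/h//|_].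
  exact: cvg_cst.
- apply: cvg_trans cs; apply: near_eq_cvg; apply: nearW => n.
  rewrite [RHS]integral_mkcond [LHS]integral_mkcond; apply: eq_integral => t _.
  rewrite !patchE /s'; case: (boolP (t \in D)) => [tD|_].
    by rewrite mem_set//; apply/DE/set_mem.
  by case: ifP => // _; rewrite subrr norm0.
- apply: cvg_trans iS; apply: near_eq_cvg; apply: nearW => n.
  have [r [ur sr]] := finite_range_seq (Fs' n).
  have sr' t : D t -> s n t \in r.
    by move=> Dt; have := sr _ (DE _ Dt); rewrite /s' mem_set.
  rewrite -[s n]/(id \o s n) -[X in _ = simple_integral _ _ X]/(id \o s' n).
  rewrite (simple_integral_comp mD muD _ (Fs n) ur sr').
  rewrite (simple_integral_comp mE muE _ (Fs' n) ur sr).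
  (* Extension enlarges only the fibre of 0, whose term in the sum vanishes. *)
  apply: eq_bigr => k _; have [->|k0] := eqVneq k 0; first by rewrite !scaler0.
  congr (emb _ (fine (mu _)) *: _); apply/seteqP; split=> t /=; rewrite /s'.
    by move=> [Dt sk]; split; [exact: DE|rewrite mem_set].
  move=> [Et]; case: ifPn => [/set_mem//|_ /esym/eqP].
  by rewrite (negPf k0).
Qed.

(** * Strongly continuous semigroups *)

Section UniformBoundedness.
Context (R : realType) (cplx : bool) (X : completeNormedModType (scalars R cplx)).

Lemma bounded_linearD (B : X -> X) : bounded_linear B -> {morph B : x y / x + y}.
Proof.
move=> [lB _] x y; have := lB 1 x y.
by rewrite !scale1r.
Qed.

Lemma bounded_linearZ (B : X -> X) (k : scalars R cplx) x :
  bounded_linear B -> B (k *: x) = k *: B x.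
Proof.
move=> BB; have [lB _] := BB; have := lB k x 0; rewrite addr0 => ->.
suff -> : B 0 = 0 by rewrite addr0.
have := bounded_linearD BB 0 0; rewrite addr0 => /eqP.
by rewrite -subr_eq0 opprD addNKr oppr_eq0 => /eqP.
Qed.

Lemma bounded_linearB (B : X -> X) x y : bounded_linear B -> B (x - y) = B x - B y.
Proof.
move=> BB; rewrite bounded_linearD//; congr (_ + _).
by rewrite -[- y]scaleN1r bounded_linearZ// scaleN1r.
Qed.

(** If [w] is the multiple of [z] of norm [r], then [2 B w = B (x + w) - B (x - w)], so one of the
    points [x + w] and [x - w] has the required image, whatever [B x] is. *)
Lemma bounded_linear_large_nearby (B : X -> X) (M r : R) x z :
  bounded_linear B -> 0 < r -> M * norm z < norm (B z) ->
  exists y, norm (y - x) <= r /\ M * r <= norm (B y).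
Proof.
move=> BB r0 Mz.
have B0 : B 0 = 0 by have := bounded_linearB 0 0 BB; rewrite !subrr.
have z0 : 0 < norm z.
  rewrite lt_neqAle norm_ge0 andbT eq_sym; apply/negP => /eqP/norm_eq0 z0.
  by move: Mz; rewrite z0 B0 norm0 mulr0 ltxx.
pose w := emb cplx (r / norm z) *: z.
have nw : norm w = r by rewrite normZ gtr0_norm ?divr_gt0// divfK ?gt_eqF.
have Mw : M * r <= norm (B w).
  rewrite bounded_linearZ// normZ gtr0_norm ?divr_gt0//.
  have -> : M * r = r / norm z * (M * norm z) by field; rewrite gt_eqF.
  by rewrite ler_wpM2l ?ltW// divr_gt0.
have : norm (B w) + norm (B w) <= norm (B (x + w)) + norm (B (x - w)).
  have -> : norm (B w) + norm (B w) = norm (B (x + w) - B (x - w)).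
    rewrite -bounded_linearB// opprB [w - x]addrC addrACA subrr add0r.
    rewrite (_ : w + w = emb cplx 2 *: w); last first.
      by rewrite -[2]/(1 + 1) embD emb1 scalerDl scale1r.
    by rewrite (bounded_linearZ _ w BB) [RHS]normZ ger0_norm//; lra.
  exact: norm_sub.
have [h _|h1 h2] := leP (norm (B w)) (norm (B (x + w))).
  by exists (x + w); rewrite addrC addKr nw; split=> //; exact: le_trans h.
exists (x - w); rewrite addrC addKr normN nw; split=> //.
by rewrite (le_trans Mw)//; lra.
Qed.

(* Nested balls on which ever larger values are taken, as in Baire's theorem. *)
Lemma uniform_boundedness (F : nat -> X -> X) :
  (forall n, bounded_linear (F n)) ->
  (forall x, exists M : R, forall n, norm (F n x) <= M) ->
  exists M : R, forall n x, norm (F n x) <= M * norm x.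
Proof.
move=> BF Fpt; apply: contrapT => nM.
have large M : exists n z, M * norm z < norm (F n z).
  apply: contrapT => h; apply: nM; exists M => n x; rewrite leNgt; apply/negP => ?.
  by apply: h; exists n, x.
have step (q : (X * R) * nat) : exists q' : X * R, 0 < q.1.2 ->
    [/\ 0 < q'.2, q'.2 <= q.1.2 / 2, norm (q'.1 - q.1.1) <= q.1.2 &
     exists n, forall y, norm (y - q'.1) <= 2 * q'.2 -> q.2%:R <= norm (F n y)].
  case: q => -[x r] k /=; have [r0|_] := ltP 0 r; last by exists (x, r).
  (* This slope makes the image of [y] at least [k + 1]; the new radius is so small that [F n]
     differs from its value at [y] by at most 1 on the ball of twice that radius. *)
  have [n [z nz]] := large ((k%:R + 1) / r).
  have [y [yx yB]] := bounded_linear_large_nearby x (BF n) r0 nz.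
  have [_ [C hC]] := BF n.
  have C0 : 0 < 2 * (`|C| + 1) by rewrite mulr_gt0// ltr_wpDl.
  exists (y, Num.min (r / 2) (2 * (`|C| + 1))^-1) => _ /=; split=> //.
  - by rewrite lt_min invr_gt0 C0 divr_gt0.
  - by rewrite ge_min lexx.
  exists n => v vy.
  have h1 : norm (v - y) * (`|C| + 1) <= 1.
    rewrite -ler_pdivlMr ?ltr_wpDl// (le_trans vy)//.
    rewrite (@le_trans _ _ (2 * (2 * (`|C| + 1))^-1))//.
      by rewrite ler_wpM2l// ge_min lexx orbT.
    by rewrite le_eqVlt; apply/orP; left; apply/eqP; field; rewrite gt_eqF// ltr_wpDl.
  have h2 : norm (F n (v - y)) <= 1.
    rewrite (le_trans (hC _))// (le_trans _ h1)// mulrC ler_wpM2l ?norm_ge0//.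
    by rewrite (le_trans (ler_norm _))// lerDl.
  have h3 := norm_le_sub (F n y) (F n v).
  rewrite normB -bounded_linearB// in h3.
  rewrite divfK ?gt_eqF// in yB; lra.
have [f hf] := choice step.
pose s := fix s k := if k is k'.+1 then f (s k', k) else f ((0, 1), 0%N).
have s0 k : 0 < (s k).2.
  by elim: k => [|k IH]; [have [] := hf ((0, 1), 0%N) ltr01|have [] := hf (s k, k.+1) IH].
have sS k := hf (s k, k.+1) (s0 k).
have hits k : exists n, forall y, norm (y - (s k).1) <= 2 * (s k).2 ->
    k%:R <= norm (F n y).
  by case: k => [|k]; [have [] := hf ((0, 1), 0%N) ltr01|have [] := sS k].
(* The radii at least halve, so each step moves the centre by at most [2 r_k - 2 r_(k+1)], and this
   telescopes. The limit lies within [2 r_k] of every centre, which is why the lower bounds are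
   required on balls of doubled radius. *)
have near_s k j : norm ((s (k + j)%N).1 - (s k).1) <= 2 * (s k).2 - 2 * (s (k + j)%N).2.
  elim: j => [|j IH]; first by rewrite addn0 !subrr norm0.
  rewrite (le_trans (norm_triangle (s (k + j)%N).1 _ _))// addnS.
  by have [_ h1 h2 _] := sS (k + j)%N; move: h1 h2 => /= h1 h2; lra.
have near_s' k n : (k <= n)%N -> norm ((s n).1 - (s k).1) <= 2 * (s k).2.
  by move=> /subnKC <-; have := near_s k (n - k)%N; have := s0 (k + (n - k))%N; lra.
have r_small k : (s k).2 * k.+1%:R <= 1.
  have h : (s k).2 * 2 ^+ k <= 1.
    elim: k => [|k IH]; first by rewrite mulr1; have [_ /=] := hf ((0, 1), 0%N) ltr01; lra.
    have [_ /= h _ _] := sS k.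
    rewrite exprS mulrA (le_trans _ IH)// ler_wpM2r ?exprn_ge0//; lra.
  rewrite (le_trans _ h)// ler_wpM2l ?(ltW (s0 _))// -natrX ler_nat.
  exact: ltn_expl.
have [x sx] : exists x : X, (s n).1 @[n --> \oo] --> x.
  apply: cauchy_norm_cvg => e e0.
  have [k hk] : exists k, 4 / e < k.+1%:R.
    by exists (Num.truncn (4 / e)); exact: truncnS_gt.
  exists [set y | exists2 n, (k <= n)%N & y = (s n).1]; first by exists k => // n /= kn; exists n.
  move=> _ _ [n kn ->] [m km ->].
  rewrite (le_trans (norm_triangle (s k).1 _ _))//.
  have := near_s' _ _ kn; have := near_s' _ _ km; rewrite (normB (s k).1) => h1 h2.
  have h3 := r_small k; move: hk; rewrite ltr_pdivrMr// => hk.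
  have h4 : 4 * (s k).2 <= e.
    rewrite -(@ler_pM2r _ k.+1%:R)//; lra.
  lra.
have [M hM] := Fpt x.
have [n hn] := hits (Num.truncn M).+1.
have := hM n; apply/negP; rewrite -ltNge (lt_le_trans (truncnS_gt M))//.
apply: hn; apply: (@norm_lim_le _ _ _
  (fun j => (s (j + (Num.truncn M).+1)%N).1 - (s (Num.truncn M).+1).1)).
  by apply: cvgB; [rewrite (cvg_shiftn _ (fun j => (s j).1))|exact: cvg_cst].
by move=> j; apply: near_s'; rewrite leq_addl.
Qed.

End UniformBoundedness.

(** * Local boundedness of the semigroup *)

Section Semigroup.
Context (R : realType) (cplx : bool) (X : completeNormedModType (scalars R cplx)).
Variable S : R -> X -> X.
Hypothesis HS : C0_semigroup S.

Lemma semigroup_right_continuous x (e : R) : 0 < e ->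
  exists2 d : R, 0 < d & forall h, 0 <= h -> h < d -> norm (S h x - x) < e.
Proof.
move=> e0; have [_ S0 _ /(_ x) Sx] := HS.
have [d /= d0 hd] := (cvg_normP _ _ _).1 Sx _ e0.
exists d => // h; rewrite le_eqVlt => /predU1P[<- _|h0 hd'].
  by rewrite S0 subrr norm0.
by apply: hd => //; rewrite /ball /= sub0r normrN gtr0_norm.
Qed.

(** Otherwise there are times [t_n] tending to 0 with [S t_n] of norm above [n + 1]. At each [x] the
    values [S t_n x] are bounded, as they tend to [x], which contradicts uniform boundedness. *)
Lemma semigroup_bounded_near0 : exists d M : R, [/\ 0 < d, 1 <= M &
  forall t x, 0 <= t -> t <= d -> norm (S t x) <= M * norm x].
Proof.
apply: contrapT => nb.
have step n : exists p : R * X, [/\ 0 <= p.1, p.1 <= n.+1%:R^-1 &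
    n.+1%:R * norm p.2 < norm (S p.1 p.2)].
  apply: contrapT => h; apply: nb; exists n.+1%:R^-1, n.+1%:R; split=> //.
    by rewrite ler1n.
  move=> t x t0 tn; rewrite leNgt; apply/negP => ?; apply: h.
  by exists (t, x).
have [p hp] := choice step.
have [lS _ _ _] := HS.
have [M hM] : exists M : R, forall n x, norm (S (p n).1 x) <= M * norm x.
  apply: uniform_boundedness.
    by move=> n; apply: lS; have [] := hp n.
  move=> x; have [d d0 hd] := semigroup_right_continuous x ltr01.
  pose N := (Num.truncn d^-1).+1.
  exists (\sum_(i < N) norm (S (p i).1 x) + (norm x + 1)) => n.
  have sum0 : 0 <= \sum_(i < N) norm (S (p i).1 x) by apply: sumr_ge0 => i _; exact: norm_ge0.
  have [nN|Nn] := ltnP n N.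
    rewrite (bigD1 (Ordinal nN))//= -addrA lerDl addr_ge0//.
      by apply: sumr_ge0 => i _; exact: norm_ge0.
    by rewrite addr_ge0// norm_ge0.
  have [p0 pn _] := hp n.
  have : norm (S (p n).1 x - x) < 1.
    apply: hd => //; rewrite (le_lt_trans pn)// invf_plt ?posrE//.
    by rewrite (lt_le_trans (truncnS_gt _))// ler_nat (leq_trans Nn).
  by have := norm_le_sub (S (p n).1 x) x; lra.
pose n := Num.truncn M.
have [_ _ h] := hp n; have := hM n (p n).2.
have : M * norm (p n).2 <= n.+1%:R * norm (p n).2.
  by rewrite ler_wpM2r ?norm_ge0// ltW// truncnS_gt.
lra.
Qed.

(** The semigroup law cuts a time into steps of length [d], each costing a factor [M]. *)
Lemma semigroup_bounded (T : R) : exists2 M : R, 1 <= M &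
  forall t x, 0 <= t <= T -> norm (S t x) <= M * norm x.
Proof.
have [d [M [d0 M1 dM]]] := semigroup_bounded_near0.
have [_ _ SD _] := HS.
have h n t x : 0 <= t -> t <= n.+1%:R * d -> norm (S t x) <= M ^+ n.+1 * norm x.
  elim: n t => [|n IH] t t0; first by rewrite mul1r expr1; exact: dM.
  move=> tn; have [td|dt] := leP t d.
    rewrite (le_trans (dM _ _ _ _))// ler_wpM2r ?norm_ge0//.
    by rewrite exprS ler_peMr ?exprn_ege1// (le_trans _ M1).
  have -> : t = d + (t - d) by rewrite addrC subrK.
  rewrite SD; [|exact: ltW|by rewrite subr_ge0 ltW].
  rewrite (le_trans (dM _ _ (ltW d0) (lexx d)))//.
  rewrite exprS -mulrA ler_wpM2l ?(le_trans _ M1)// IH//; first by lra.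
  by rewrite lerBlDr -{2}(mul1r d) -mulrDl natr1.
exists (M ^+ (Num.truncn (T / d)).+1); first exact: exprn_ege1.
move=> t x /andP[t0 tT]; apply: h => //.
by rewrite (le_trans tT)// -ler_pdivrMr// ltW// truncnS_gt.
Qed.

End Semigroup.

(** * Uniformity on compact time intervals *)

Section UniformContinuity.
Context (R : realType) (cplx : bool) (X : normedModType (scalars R cplx)).
Implicit Types (h : R -> X) (T : R).

Definition continuous_upto T h := forall s, 0 <= s <= T -> forall e : R, 0 < e ->
  exists2 d : R, 0 < d & forall s', 0 <= s' <= T -> `|s' - s| < d ->
    norm (h s' - h s) < e.

Lemma continuous_uptoP T h :
  {within `[0, T], continuous h} <-> continuous_upto T h.
Proof.
split=> [/subspace_continuousP hc s sT e e0|hc].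
  have sI : `[0, T]%classic s by rewrite /= in_itv.
  have /(cvg_normP _ _ _).1 /(_ e e0) := hc s sI.
  move=> /nbhs_ballP[d /= d0 hd]; exists d => // s' s'T sd.
  by apply: hd; rewrite /ball /= ?in_itv//= distrC.
apply/subspace_continuousP => s; rewrite /= in_itv /= => sT.
apply/cvg_normP => e /(hc s sT)[d d0 hd].
apply/nbhs_ballP; exists d => //= s'; rewrite /ball /= distrC => sd.
by rewrite in_itv => s'T; exact: hd.
Qed.

(** A Lebesgue number argument. It is kept abstract because it yields both upper bounds, with [d]
    the reciprocal of the bound, and uniform continuity, with [d] the tolerance. *)
Lemma uniform_gauge T (P : R -> R -> Prop) :
  (forall d d' s, 0 < d -> d <= d' -> P d' s -> P d s) ->
  (forall s, 0 <= s <= T -> exists2 d, 0 < d &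
    forall s', 0 <= s' <= T -> `|s' - s| < d -> P d s') ->
  exists2 d, 0 < d & forall s, 0 <= s <= T -> P d s.
Proof.
move=> Pd Ploc.
have cT : compact (`[0, T]%classic : set R) by exact: segment_compact.
have /compact_near_coveringP/near_covering_withinP := cT.
move=> /(_ R (0 : R)^'+ P).
case=> [s|d /= d0 hd].
  rewrite /= in_itv /= => /Ploc[d d0 hd].
  exists ([set s' | `|s' - s| < d], [set d' | 0 < d' <= d]) => /=.
    split; first by apply/nbhs_ballP; exists d => //= s'; rewrite /ball /= distrC.
    near=> d'; rewrite /=; apply/andP; split; first by near: d'; exact: nbhs_right_gt.
    by near: d'; exact: nbhs_right_le.
  move=> [s' d'] /= [ss' /andP[d'0 d'd]]; rewrite in_itv /= => s'T.
  by apply: Pd (hd _ s'T ss').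
exists (d / 2); first exact: divr_gt0.
move=> s sT; apply: (hd (d / 2)) => //=.
  by rewrite sub0r normrN gtr0_norm ?divr_gt0//; move: d0 => /=; lra.
exact: divr_gt0.
Unshelve. all: by end_near. Qed.

Lemma continuous_upto_bounded T h : continuous_upto T h ->
  exists2 K : R, 0 < K & forall s, 0 <= s <= T -> norm (h s) <= K.
Proof.
move=> hc; have [||d d0 hd] := @uniform_gauge T (fun d s => norm (h s) <= d^-1).
- by move=> d d' s d0 dd' /le_trans; apply; rewrite lef_pV2// posrE (lt_le_trans d0).
- move=> s sT; have [d d0 hd] := hc s sT 1 ltr01.
  have n0 : 0 < norm (h s) + 1 by rewrite ltr_wpDl ?norm_ge0.
  exists (Num.min d (norm (h s) + 1)^-1); first by rewrite lt_min d0 invr_gt0.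
  move=> s' s'T; rewrite lt_min => /andP[/hd-/(_ s'T) h1 _].
  rewrite (@le_trans _ _ (norm (h s) + 1))//.
    by have := norm_le_sub (h s') (h s); lra.
  by rewrite -[leLHS]invrK lef_pV2 ?posrE ?invr_gt0// ?lt_min ?d0 ?invr_gt0// ge_min lexx orbT.
by exists d^-1; rewrite ?invr_gt0.
Qed.

End UniformContinuity.

(** Right continuity at time 0 is made uniform along the compact curve [h], and for [a <= b] the
    semigroup law [S b - S a = S a (S (b - a) - 1)] carries it from 0 to arbitrary times. *)
Lemma semigroup_orbit_unif (R : realType) (cplx : bool)
    (X : completeNormedModType (scalars R cplx)) (S : R -> X -> X)
    (HS : C0_semigroup S) (T : R) (h : R -> X) :
  continuous_upto T h -> forall e : R, 0 < e ->
  exists2 d : R, 0 < d & forall s s' t t' : R,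
    0 <= s <= T -> 0 <= s' <= T -> 0 <= t <= T -> 0 <= t' <= T ->
    `|s - s'| < d -> `|t - t'| < d -> norm (S t (h s) - S t' (h s')) < e.
Proof.
move=> hc e e0; have [lS _ SD _] := HS.
have [M M1 hM] := semigroup_bounded HS (T + 1).
have M0 : 0 < M by rewrite (lt_le_trans _ M1).
have MV0 : 0 < M^-1 by rewrite invr_gt0.
pose e1 := e / 4 / M; have e10 : 0 < e1 by rewrite !divr_gt0.
pose e2 := e1 / (4 * M); have e20 : 0 < e2 by rewrite divr_gt0// mulr_gt0.
have Me1 : M * e1 = e / 4 by rewrite /e1 mulrCA divff ?mulr1// gt_eqF.
have Me2 : M * e2 = e1 / 4 by rewrite /e2; field; rewrite gt_eqF.
have e21 : e2 <= e1 / 4 by rewrite -Me2 ler_peMl// ltW.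
(* The gauge controls two things at once: the oscillation of [h] near [s] and the displacement of
   [h s] by the semigroup in small times. *)
have [||d d0 hd] := @uniform_gauge R T (fun d s =>
    (forall s', 0 <= s' <= T -> `|s' - s| < d -> norm (h s' - h s) < e1) /\
    (forall k, 0 <= k -> k < d -> k <= T -> norm (S k (h s) - h s) < e1)).
- move=> d d' s d0 dd' [h1 h2]; split.
    by move=> s' s'T sd; apply: h1 => //; exact: lt_le_trans dd'.
  by move=> k k0 kd kT; apply: h2 => //; exact: lt_le_trans dd'.
- move=> s sT; have [d d0 hd] := hc s sT _ e20.
  have [k k0 hk] := semigroup_right_continuous HS (h s) e20.
  have m0 : 0 < Num.min (d / 2) k by rewrite lt_min k0 divr_gt0.
  exists (Num.min (d / 2) k) => // s1 s1T; rewrite lt_min => /andP[ss1 _]; split.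
    move=> s2 s2T; rewrite lt_min => /andP[ss2 _].
    have h1 : norm (h s1 - h s) < e2 by apply: hd => //; lra.
    have h2 : norm (h s2 - h s) < e2.
      by apply: hd => //; rewrite (le_lt_trans (ler_distD s1 _ _))//; lra.
    rewrite (le_lt_trans (norm_triangle (h s) _ _))// (normB (h s)); lra.
  move=> j j0; rewrite lt_min => /andP[_ jk] jT.
  have h1 : norm (h s1 - h s) < e2 by apply: hd => //; lra.
  have h2 := hk j j0 jk.
  have h3 : norm (S j (h s1) - S j (h s)) <= M * e2.
    rewrite -bounded_linearB; last exact: lS.
    rewrite (le_trans (hM _ _ _))//; first by rewrite j0 /=; lra.
    by rewrite ler_wpM2l ?ltW.
  rewrite (le_lt_trans (norm_triangle (S j (h s)) _ _))//.
  by have := norm_triangle (h s) (S j (h s)) (h s1); rewrite (normB (h s)); lra.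
exists d => // s s' t t' sT s'T + + ss'.
have main a b : 0 <= a <= T -> 0 <= b <= T -> a <= b -> `|a - b| < d ->
    norm (S a (h s) - S b (h s)) <= M * e1.
  move=> /andP[a0 aT] /andP[b0 bT] ab abd.
  have -> : b = a + (b - a) by rewrite addrC subrK.
  rewrite SD ?subr_ge0// -bounded_linearB; last exact: lS.
  rewrite (le_trans (hM _ _ _))//; first by rewrite a0 /=; lra.
  rewrite ler_wpM2l ?(ltW M0)// normB ltW//; apply: (hd s sT).2.
  - by rewrite subr_ge0.
  - by rewrite distrC ger0_norm ?subr_ge0 in abd.
  - by lra.
move=> tT t'T tt'.
have h1 : norm (S t (h s) - S t' (h s)) <= M * e1.
  have [tt|tt] := leP t t'; first exact: main.
  by rewrite normB main// ?ltW// distrC.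
have h2 : norm (S t' (h s) - S t' (h s')) <= M * e1.
  move/andP: t'T => [t'0 t'T].
  rewrite -bounded_linearB; last exact: lS.
  rewrite (le_trans (hM _ _ _))//; first by rewrite t'0 /=; lra.
  rewrite ler_wpM2l ?(ltW M0)// ltW//; exact: (hd s' s'T).1.
by rewrite (le_lt_trans (norm_triangle (S t' (h s)) _ _))//; lra.
Qed.

(** * Mass of controls on short intervals *)

Section IntervalIntegrals.
Context (R : realType).
Local Notation mu := (@lebesgue_measure R).
Implicit Types (T a b t e : R) (omega v u : R -> R).

Lemma lebesgue_segment a b : a <= b -> mu (`[a, b]%classic : set R) = (b - a)%:E.
Proof.
rewrite lebesgue_measure_itv /= lte_fin le_eqVlt => /predU1P[->|->]//.
by rewrite ltxx subrr.
Qed.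

Lemma lebesgue_segment_fin a b : (mu (`[a, b]%classic : set R) < +oo)%E.
Proof. by rewrite lebesgue_measure_itv /=; case: ifP => _; rewrite ?ltry// -EFinD ltry. Qed.

Lemma measurable_abs_EFin (D : set R) v : measurable_fun setT v ->
  measurable_fun D (fun s => `|v s|%:E).
Proof.
move=> mv; apply/measurable_EFinP; apply: measurable_funTS.
exact: measurableT_comp.
Qed.

(** [theta] is [1 - 1/p], the exponent that Hoelder's inequality puts on the length of the interval,
    and 1 if [p = oo]; [p > 1] makes it positive. *)
Lemma hoelder_segment (p : \bar R) : (1 < p)%E -> exists2 theta : R, 0 < theta &
  forall T a b v, measurable_fun setT v -> 0 <= a -> a <= b -> b <= T ->
    (\int[mu]_(s in `[a, b]) `|v s|%:E <=
     ((b - a) `^ theta)%:E * Lnorm (leb T) p (EFin \o v))%E.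
Proof.
have lebE T a b : 0 <= a -> a <= b -> b <= T -> leb T (`[a, b]%classic : set R) = (b - a)%:E.
  move=> a0 ab bT; rewrite /leb /= /mrestr setIidl ?lebesgue_segment//.
  by move=> x /=; rewrite !in_itv /= => /andP[? ?]; apply/andP; split; lra.
have intE T a b v : 0 <= a -> a <= b -> b <= T ->
    (\int[mu]_(s in `[a, b]) `|v s|%:E = \int[leb T]_(s in `[a, b]) `|v s|%:E)%E.
  move=> a0 ab bT; apply: eq_measure_integral => A mA Aab.
  rewrite /leb /= /mrestr setIidl// => x /Aab /=; rewrite !in_itv /= => /andP[? ?].
  by apply/andP; split; lra.
case: p => [p| |]//; rewrite ?lte_fin => p1.
- have p0 : 0 < p by rewrite (lt_trans _ p1).
  have q0 : 0 < 1 - p^-1 by rewrite subr_gt0 invf_lt1.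
  exists (1 - p^-1) => // T a b v mv a0 ab bT.
  rewrite (intE T)//.
  pose g : R -> R := \1_(`[a, b]%classic).
  have mg : measurable_fun setT g by exact: measurable_indic.
  have := @hoelder _ _ _ (leb T) v g p (1 - p^-1)^-1 mv mg p0.
  rewrite invr_gt0 q0 invrK => /(_ isT); rewrite addrC subrK => /(_ erefl).
  rewrite Lnorm1; have -> : (\int[leb T]_x `|(EFin \o (v \* g)%R) x| =
      \int[leb T]_(s in `[a, b]) `|v s|%:E)%E.
    rewrite [RHS]integral_mkcond; apply: eq_integral => x _.
    rewrite patchE /= /g indicE; case: ifP => _; first by rewrite mulr1.
    by rewrite mulr0 normr0.
  suff -> : Lnorm (leb T) (1 - p^-1)^-1%:E (EFin \o g) = ((b - a) `^ (1 - p^-1))%:E.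
    by rewrite muleC.
  rewrite unlock invrK (_ : (\int[leb T]_x _)%E = (b - a)%:E) ?poweR_EFin//.
  transitivity (\int[leb T]_x (\1_(`[a, b]%classic : set R) x)%:E)%E; last first.
    by rewrite integral_indic//= setIT lebE.
  apply: eq_integral => x _.
  rewrite /= /g indicE; case: (x \in _) => /=.
    by rewrite normr1 powR1.
  by rewrite normr0 powR0// invr_neq0// gt_eqF.
- exists 1 => // T a b v mv a0 ab bT.
  rewrite (intE T)// unlock powRr1 ?subr_ge0//.
  have mab : measurable_fun `[a, b] (fun s => `|v s|%:E) by exact: measurable_abs_EFin.
  (* On a null space, here for [T = 0], the norm for [p = oo] is 0 by convention; the integral over
     the null interval vanishes as well. *)
  case: ifPn => [m0|]; last first.
    rewrite -leNgt measure_le0 mule0 => /eqP m0.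
    have : (leb T (`[a, b]%classic : set R) <= leb T [set: R])%E by rewrite le_measure ?inE.
    by rewrite m0 measure_le0 => /eqP h; rewrite null_set_integral.
  rewrite -(lebE T)// muleC -integral_cst//.
  apply: ae_ge0_le_integral => //.
  + move=> x _ /=; apply: ess_sup_gee => //; apply: nearW => y /=.
    by rewrite lee_fin.
  + by apply: filterS (ess_sup_ge (leb T) (abse \o (EFin \o v))) => x /=.
Qed.

(* Controls are measured by a bound [omega] on their mass on short intervals;
   on bounded sets of [L^p] such a bound is uniform precisely because [1 < p]. *)
Definition modulus omega := forall e, 0 < e -> exists2 d, 0 < d &
  forall h, 0 <= h -> h <= d -> omega h <= e.

Definition mass_le T omega v := measurable_fun setT v /\
  forall a b, 0 <= a -> a <= b -> b <= T ->
    (\int[mu]_(s in `[a, b]) `|v s|%:E <= (omega (b - a))%:E)%E.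

Lemma modulus_powR (M theta : R) : 0 < theta -> modulus (fun h => M * h `^ theta).
Proof.
move=> t0 e e0; pose K := `|M| + 1.
have K0 : 0 < K by rewrite ltr_wpDl.
exists ((e / K) `^ theta^-1); first by rewrite powR_gt0// divr_gt0.
move=> h h0 hd; rewrite (@le_trans _ _ (K * h `^ theta))//.
  by rewrite ler_wpM2r ?powR_ge0// (le_trans (ler_norm _))// lerDl.
rewrite -ler_pdivlMl// mulrC.
have := ge0_ler_powR (ltW t0) _ _ hd; rewrite !nnegrE => /(_ h0 (powR_ge0 _ _)).
by rewrite -powRrM mulVf ?gt_eqF// powRr1// divr_ge0// ltW.
Qed.

Lemma modulusD omega1 omega2 : modulus omega1 -> modulus omega2 ->
  modulus (fun h => omega1 h + omega2 h).
Proof.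
move=> m1 m2 e e0; have e20 : 0 < e / 2 by rewrite divr_gt0.
have [d1 d10 h1] := m1 _ e20; have [d2 d20 h2] := m2 _ e20.
exists (Num.min d1 d2); first by rewrite lt_min d10.
move=> h h0; rewrite le_min => /andP[/(h1 _ h0) ? /(h2 _ h0) ?]; lra.
Qed.

Lemma mass_le_sub T omega1 omega2 u v :
  mass_le T omega1 u -> mass_le T omega2 v ->
  mass_le T (fun h => omega1 h + omega2 h) (fun s => u s - v s).
Proof.
move=> [mu_ hu] [mv hv]; split; first exact: measurable_funB.
move=> a b a0 ab bT; rewrite EFinD (le_trans _ (leeD (hu _ _ a0 ab bT) (hv _ _ a0 ab bT)))//.
rewrite -ge0_integralD//; last 2 first.
- exact: measurable_abs_EFin.
- exact: measurable_abs_EFin.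
apply: ge0_le_integral => //.
- by apply: measurable_abs_EFin; exact: measurable_funB.
- by apply: emeasurable_funD; exact: measurable_abs_EFin.
- by move=> s _; rewrite -EFinD lee_fin ler_normB.
Qed.

(** The weight of Bielecki's norm. Before [t - d] it is at most [exp (- lam d)] times its value at
    [t]; after [t - d] the mass of the control is at most [e / 2]. The choice of [lam] depends on
    [omega], [T] and [e], but not on the control. *)
Lemma mass_le_exp_weight T omega e : 0 <= T -> modulus omega -> 0 < e ->
  exists2 lam : R, 0 <= lam & forall v, mass_le T omega v -> forall t, 0 <= t <= T ->
    (\int[mu]_(s in `[0%R, t]) (`|v s| * expR (lam * s))%:E <=
     (e * expR (lam * t))%:E)%E.
Proof.
move=> T0 mo e0; have e20 : 0 < e / 2 by rewrite divr_gt0.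
have [d d0 hd] := mo _ e20.
(* Chosen so that [1 + x <= exp x] gives [omega T <= e / 2 * exp (lam * d)]: the mass before [t - d]
   then contributes at most one half. *)
pose lam := 2 * `|omega T| / e / d; exists lam.
  by rewrite !divr_ge0 ?mulr_ge0// ltW.
have omT : `|omega T| <= e / 2 * expR (lam * d).
  rewrite -ler_pdivrMl// (le_trans _ (expR_ge1Dx _))//.
  by rewrite /lam divfK ?gt_eqF// invf_div; lra.
have lam0 : 0 <= lam by rewrite !divr_ge0 ?mulr_ge0// ltW.
move=> v [mv hv] t /andP[t0 tT].
pose c := Num.max 0 (t - d).
have c0 : 0 <= c by rewrite le_max lexx.
have ct : c <= t by rewrite ge_max t0 gerBl ltW.
have mV D : measurable_fun D (fun s => `|v s|%:E) by exact: measurable_abs_EFin.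
pose f1 s := ((expR (lam * (t - d)))%:E * `|v s|%:E)%E.
pose f2 s := ((expR (lam * t))%:E * ((fun s => `|v s|%:E) \_ `[c, t]) s)%E.
have mp : measurable_fun `[0, t] ((fun s => `|v s|%:E) \_ `[c, t]).
  by apply/measurable_restrict => //; exact: mV.
have mf1 : measurable_fun `[0, t] f1 by apply: measurable_funeM.
have mf2 : measurable_fun `[0, t] f2 by apply: measurable_funeM.
have p0 s : (0 <= ((fun s => `|v s|%:E) \_ `[c, t]) s)%E.
  by rewrite patchE; case: ifP => _; rewrite ?lee_fin.
have f10 s : `[0, t]%classic s -> (0 <= f1 s)%E by move=> _; rewrite mule_ge0 ?lee_fin ?expR_ge0.
have f20 s : `[0, t]%classic s -> (0 <= f2 s)%E by move=> _; rewrite mule_ge0 ?lee_fin ?expR_ge0.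
apply: (@le_trans _ _ (\int[mu]_(s in `[0%R, t]) (f1 s + f2 s))%E).
  apply: ge0_le_integral => //.
  - apply/measurable_EFinP; apply: measurable_funM.
      by apply/measurable_EFinP; exact: mV.
    apply: measurable_funTS; apply: (@measurableT_comp _ _ _ _ _ _ expR).
      exact: measurable_expR.
    exact: mulrl_measurable.
  - exact: emeasurable_funD.
  - move=> s; rewrite /= in_itv /= => /andP[s0 st].
    rewrite /f1 /f2 patchE; case: ifPn => [_|].
      rewrite -!EFinM -EFinD lee_fin.
      have h1 : 0 <= expR (lam * (t - d)) * `|v s| by rewrite mulr_ge0 ?expR_ge0.
      have h2 : expR (lam * s) * `|v s| <= expR (lam * t) * `|v s|.
        by rewrite ler_wpM2r// ler_expR ler_wpM2l.
      lra.
    rewrite notin_setE /= in_itv /= st andbT => /negP; rewrite -ltNge lt_max.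
    rewrite ltNge s0 /= => sd; rewrite mule0 adde0 -EFinM lee_fin mulrC.
    by rewrite ler_wpM2r// ler_expR ler_wpM2l// ltW.
rewrite ge0_integralD// ge0_integralZl ?lee_fin ?expR_ge0//.
rewrite [X in (_ + X)%E]ge0_integralZl ?lee_fin ?expR_ge0//.
rewrite -integral_mkcondr setIidr; last first.
  by move=> s /=; rewrite !in_itv /= => /andP[cs ->]; rewrite (le_trans c0).
have -> : (e * expR (lam * t))%:E =
    ((expR (lam * (t - d)))%:E * (e / 2 * expR (lam * d))%:E +
     (expR (lam * t))%:E * (e / 2)%:E)%E.
  rewrite -!EFinM -EFinD; congr EFin.
  have -> : expR (lam * t) = expR (lam * (t - d)) * expR (lam * d).
    by rewrite -expRD -mulrDr subrK.
  by field.
apply: leeD; apply: lee_wpmul2l; rewrite ?lee_fin ?expR_ge0//.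
  rewrite (@le_trans _ _ (omega T)%:E)//; last by rewrite lee_fin (le_trans (ler_norm _)).
  have := hv 0 T (lexx _) T0 (lexx _); rewrite subr0; apply: le_trans.
  apply: ge0_subset_integral => //; first exact: mV.
  move=> s /=.
  by rewrite !in_itv /= => /andP[-> st] /=; exact: le_trans tT.
rewrite (le_trans (hv _ _ c0 ct tT))// lee_fin hd ?subr_ge0//.
  by rewrite lerBlDr -lerBlDl le_max lexx orbT.
exact: mV.
Qed.

End IntervalIntegrals.

(** * Convolution with the semigroup *)

Section StrongMeasurability.
Context d (T : measurableType d) (R : realType) (cplx : bool).
Context (X : normedModType (scalars R cplx)).
Variable D : set T.
Hypothesis mD : measurable D.

Lemma eq_strongly_measurable (g g' : T -> X) : (forall t, D t -> g t = g' t) ->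
  strongly_measurable D g -> strongly_measurable D g'.
Proof. by move=> gg' [s [Fs sg]]; exists s; split=> // t Dt; rewrite -gg'//; exact: sg. Qed.

Lemma emb_cvg (a : nat -> R) (b : R) : a @ \oo --> b ->
  emb cplx (a n) @[n --> \oo] --> emb cplx b.
Proof.
move=> ab; apply/cvgrPdist_lt => e e0; have e0' : 0 < to_real e.
  by rewrite -(@emb_lt R cplx) embK ?ltW// emb0.
move/cvgrPdist_lt: ab => /(_ _ e0')[N _ hN]; exists N => // n /= /hN.
by rewrite -(@emb_lt R cplx) embK ?ltW// -norm_emb embD embN.
Qed.

Lemma strongly_measurableZ (u : T -> R) (g : T -> X) : measurable_fun D u ->
  strongly_measurable D g -> strongly_measurable D (fun t => emb cplx (u t) *: g t).
Proof.
move=> mu_ [s [Fs sg]].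
have mu' : measurable_fun D (EFin \o u) by exact/measurable_EFinP.
have [a ha] := approximation_sfun mD mu'.
exists (fun n t => emb cplx (a n t) *: s n t); split.
  move=> n; apply: (finite_range_comp2 (fun (x : R) (y : X) => emb cplx x *: y)) => //.
  split; first by apply: (sub_finite_set _ (fimfunP (a n))) => _ [t _ <-]; exists t.
  by move=> k; apply: measurableI => //; exact: measurable_sfunP.
move=> t Dt; apply: cvgZ; last exact: sg.
by apply: emb_cvg; have /fine_cvgP[_] := ha t Dt.
Qed.

End StrongMeasurability.

Lemma eq_Bochner d (T : measurableType d) (R : realType)
    (mu : {measure set T -> \bar R}) (D : set T) (c : bool)
    (X : normedModType (scalars R c)) (g g' : T -> X) (I : X) :
  (forall t, D t -> g t = g' t) ->
  has_Bochner_integral mu D g I -> has_Bochner_integral mu D g' I.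
Proof.
move=> gg' [s [Fs aes cs iS]]; exists s; split=> //.
  by apply: filterS aes => t h Dt; rewrite -gg'//; exact: h.
apply: cvg_trans cs; apply: near_eq_cvg; apply: nearW => n.
by apply: eq_integral => t /set_mem Dt; rewrite gg'.
Qed.

Section ContinuousMeasurable.
Context (R : realType) (cplx : bool) (X : normedModType (scalars R cplx)).

(** Sampling at the left ends [k / (n + 1)] of grid cells: they stay in [[0, t]], where [g] is
    continuous, and the index of the cell takes finitely many values on intervals. *)
Lemma continuous_strongly_measurable (t : R) (g : R -> X) :
  continuous_upto t g -> strongly_measurable (`[0, t]%classic : set R) g.
Proof.
move=> gc; pose q n (s : R) := Num.truncn (s * n.+1%:R).
exists (fun n s => g ((q n s)%:R / n.+1%:R)); split=> [n|s].
  apply: (finite_range_comp (fun k : nat => g (k%:R / n.+1%:R)) (q := q n)); split.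
    apply: (sub_finite_set _ (finite_II (q n t).+1)) => _ [s st <-] /=.
    move: st; rewrite /= in_itv /= => /andP[s0 st]; rewrite ltnS.
    by apply: le_truncn; rewrite ler_wpM2r.
  move=> k; rewrite (_ : _ `&` _ = `[0, t] `&` `[k%:R / n.+1%:R, k.+1%:R / n.+1%:R[).
    exact: measurableI.
  apply/seteqP; split=> s /=; rewrite !in_itv /= => -[/andP[s0 st]].
    move=> qs; rewrite s0 st; split=> //.
    have := @truncn_itv _ (s * n.+1%:R); rewrite mulr_ge0// -/(q n s) qs.
    by move=> /(_ isT) /andP[? ?]; rewrite ler_pdivrMr// ltr_pdivlMr//; apply/andP.
  rewrite ler_pdivrMr// ltr_pdivlMr// => h; rewrite s0 st; split=> //.
  exact: truncn_def.
rewrite /= in_itv /= => st; move/andP: (st) => [s0 st'].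
apply/cvg_seq_normP => e e0; have [d d0 hd] := gc s st e e0.
exists (Num.truncn d^-1) => n nd.
have /andP[h1 h2] : (q n s)%:R <= s * n.+1%:R < (q n s).+1%:R.
  by apply: truncn_itv; rewrite mulr_ge0.
apply: hd.
  by rewrite divr_ge0// ler_pdivrMr// (le_trans h1)// ler_wpM2r.
have n0 : 0 < n.+1%:R :> R by [].
have nd1 : n.+1%:R^-1 < d.
  by rewrite invf_plt ?posrE// (lt_le_trans (truncnS_gt _))// ler_nat.
rewrite distrC ger0_norm ?subr_ge0 ?ler_pdivrMr//.
apply: lt_trans nd1; rewrite ltrBlDr -{1}(mulfK (lt0r_neq0 n0) s) -{2}(mul1r n.+1%:R^-1) -mulrDl.
by rewrite ltr_pM2r ?invr_gt0// addrC natr1.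
Qed.

End ContinuousMeasurable.

Section Convolution.
Context (R : realType) (cplx : bool) (X : completeNormedModType (scalars R cplx)).
Local Notation mu := (@lebesgue_measure R).
Variable S : R -> X -> X.
Hypothesis HS : C0_semigroup S.
Implicit Types (T t : R) (u v : R -> R) (h : R -> X).

(** The Bochner integral if there is one, and 0 otherwise; [convolutionP] shows that there is one
    for controls of bounded mass and continuous [h]. *)
Definition convolution u h t : X :=
  xget 0 [set I | has_Bochner_integral mu `[0, t]
    (fun s => S (t - s) (emb cplx (u s) *: h s)) I].

(** Linearity takes the merely measurable scalar [u s] out of the semigroup; the remaining factor is
    continuous in [s]. *)
Lemma kernel_strongly_measurable T u h t : measurable_fun setT u ->
  continuous_upto T h -> 0 <= t <= T ->
  strongly_measurable (`[0, t]%classic : set R)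
    (fun s => S (t - s) (emb cplx (u s) *: h s)).
Proof.
move=> mu_ hc /andP[t0 tT]; have [lS _ _ _] := HS.
apply: (@eq_strongly_measurable _ _ _ _ _ _ (fun s => emb cplx (u s) *: S (t - s) (h s))).
  move=> s; rewrite /= in_itv /= => /andP[s0 st].
  by rewrite bounded_linearZ//; apply: lS; rewrite subr_ge0.
apply: strongly_measurableZ => //; first exact: measurable_funTS.
apply: continuous_strongly_measurable => s /andP[s0 st] e e0.
have [d d0 hd] := semigroup_orbit_unif HS hc e0; exists d => // s' /andP[s'0 s't] ss'.
apply: hd => //; try (by apply/andP; split; lra).
by rewrite (_ : t - s' - (t - s) = s - s') 1?distrC//; ring.
Qed.

Variables (T M : R).
Hypothesis M1 : 1 <= M.
Hypothesis SM : forall t x, 0 <= t <= T -> norm (S t x) <= M * norm x.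

Let M0 : 0 <= M. Proof. by rewrite (le_trans _ M1). Qed.

Lemma norm_kernel_le u h t s : 0 <= s <= t -> t <= T ->
  norm (S (t - s) (emb cplx (u s) *: h s)) <= M * (`|u s| * norm (h s)).
Proof. by move=> st tT; rewrite (le_trans (SM _ _)) ?normZ//; lra. Qed.

Lemma measurable_kernel_bound u h t : measurable_fun setT u ->
  continuous_upto T h -> 0 <= t <= T ->
  measurable_fun (`[0, t]%classic : set R) (fun s => (M * (`|u s| * norm (h s)))%:E).
Proof.
move=> mu_ hc /andP[t0 tT]; apply/measurable_EFinP; apply: measurable_funM => //.
apply: measurable_funM.
  by apply: measurable_funTS; exact: measurableT_comp.
apply: strongly_measurable_norm => //.
apply: continuous_strongly_measurable => s /andP[s0 st] e e0.
have sT : 0 <= s <= T by apply/andP; split; lra.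
have [d d0 hd] := hc s sT e e0.
by exists d => // s' /andP[? ?]; apply: hd; apply/andP; split; lra.
Qed.

Lemma integral_kernel_le u h t : measurable_fun setT u ->
  continuous_upto T h -> 0 <= t <= T ->
  (\int[mu]_(s in `[0%R, t]) (norm (S (t - s) (emb cplx (u s) *: h s)))%:E <=
   \int[mu]_(s in `[0%R, t]) (M * (`|u s| * norm (h s)))%:E)%E.
Proof.
move=> mu_ hc tT; apply: ge0_le_integral => //.
- by move=> s _; rewrite lee_fin norm_ge0.
- by apply: measurable_norm => //; exact: kernel_strongly_measurable hc tT.
- exact: measurable_kernel_bound.
- move=> s; rewrite /= in_itv /= => st; rewrite lee_fin norm_kernel_le//.
  by case/andP: tT.
Qed.

Lemma integral_kernel_bound u h t (c : R) : measurable_fun setT u ->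
  continuous_upto T h -> 0 <= t <= T -> 0 <= c ->
  (forall s, 0 <= s <= t -> norm (h s) <= c) ->
  (\int[mu]_(s in `[0%R, t]) (M * (`|u s| * norm (h s)))%:E <=
   (M * c)%:E * \int[mu]_(s in `[0%R, t]) (`|u s|)%:E)%E.
Proof.
move=> mu_ hc tT c0 hle; rewrite -ge0_integralZl//; last 2 first.
- exact: measurable_abs_EFin.
- by rewrite lee_fin mulr_ge0.
apply: ge0_le_integral => //.
- by move=> s _; rewrite lee_fin !mulr_ge0 ?norm_ge0.
- exact: measurable_kernel_bound.
- by apply: measurable_funeM; exact: measurable_abs_EFin.
- move=> s; rewrite /= in_itv /= => st; rewrite lee_fin -mulrA ler_wpM2l//.
  by rewrite mulrC ler_wpM2r// hle.
Qed.

Lemma mass_fin omega u t : mass_le T omega u -> 0 <= t <= T ->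
  (\int[mu]_(s in `[0%R, t]) (`|u s|)%:E <= (omega T)%:E)%E.
Proof.
move=> [mu_ hu] /andP[t0 tT].
have := hu 0 T (lexx _) (le_trans t0 tT) (lexx _); rewrite subr0; apply: le_trans.
apply: ge0_subset_integral => //; first exact: measurable_abs_EFin.
by move=> s /=; rewrite !in_itv /= => /andP[-> st] /=; exact: le_trans tT.
Qed.

Lemma convolutionP omega u h t : mass_le T omega u -> continuous_upto T h ->
  0 <= t <= T -> has_Bochner_integral mu `[0, t]
    (fun s => S (t - s) (emb cplx (u s) *: h s)) (convolution u h t).
Proof.
move=> hu hc tT; have mu_ := hu.1.
suff [I hI] : exists I : X, has_Bochner_integral mu `[0, t]
    (fun s => S (t - s) (emb cplx (u s) *: h s)) I by exact: (xgetI 0 hI).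
apply: Bochner_exists => //.
- exact: lebesgue_segment_fin.
- exact: kernel_strongly_measurable hc tT.
rewrite (le_lt_trans (integral_kernel_le mu_ hc tT))//.
have [K K0 hK] := continuous_upto_bounded hc.
rewrite (le_lt_trans (integral_kernel_bound mu_ hc tT (ltW K0) _))//.
  by move=> s st; apply: hK; lra.
rewrite lte_mul_pinfty// ?lee_fin ?mulr_ge0 ?ltW//.
  exact: lt_le_trans M1.
by apply: le_lt_trans (mass_fin hu tT) _; rewrite ltry.
Qed.

Lemma convolution_unique omega u h t I : mass_le T omega u ->
  continuous_upto T h -> 0 <= t <= T ->
  has_Bochner_integral mu `[0, t] (fun s => S (t - s) (emb cplx (u s) *: h s)) I ->
  I = convolution u h t.
Proof.
move=> hu hc tT hI; have [mu_ _] := hu.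
apply: Bochner_unique hI (convolutionP hu hc tT) => //.
- exact: lebesgue_segment_fin.
- exact: kernel_strongly_measurable hc tT.
Qed.

Lemma norm_convolution_le omega u h t : mass_le T omega u ->
  continuous_upto T h -> 0 <= t <= T ->
  ((norm (convolution u h t))%:E <=
   \int[mu]_(s in `[0%R, t]) (M * (`|u s| * norm (h s)))%:E)%E.
Proof.
move=> hu hc tT; have [mu_ _] := hu.
apply: le_trans (integral_kernel_le mu_ hc tT).
apply: norm_Bochner (convolutionP hu hc tT) => //.
- exact: lebesgue_segment_fin.
- exact: kernel_strongly_measurable hc tT.
Qed.

Lemma norm_convolution_mass omega u h t (c d : R) : mass_le T omega u ->
  continuous_upto T h -> 0 <= t <= T -> 0 <= c ->
  (forall s, 0 <= s <= T -> norm (h s) <= c) ->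
  (\int[mu]_(s in `[0%R, T]) (`|u s|)%:E <= d%:E)%E ->
  norm (convolution u h t) <= M * c * d.
Proof.
move=> hu hc tT c0 hle ud; have [mu_ _] := hu.
rewrite -lee_fin (le_trans (norm_convolution_le hu hc tT))//.
rewrite (le_trans (integral_kernel_bound mu_ hc tT c0 _))//.
  by move=> s st; apply: hle; lra.
rewrite [in leRHS]EFinM; apply: lee_wpmul2l; first by rewrite lee_fin mulr_ge0.
apply: le_trans ud.
apply: ge0_subset_integral => //; first exact: measurable_abs_EFin.
move=> s /=; rewrite !in_itv /= => /andP[-> st] /=.
by case/andP: tT => _; exact: le_trans.
Qed.

(** The weight of [h] reappears in the bound, multiplied by [M * e]: with small [e] this is the
    source of the contraction. *)
Lemma norm_convolution_exp omega u h t (c lam e : R) : mass_le T omega u ->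
  continuous_upto T h -> 0 <= t <= T -> 0 <= c ->
  (forall s, 0 <= s <= t -> norm (h s) <= c * expR (lam * s)) ->
  (\int[mu]_(s in `[0%R, t]) (`|u s| * expR (lam * s))%:E <=
     (e * expR (lam * t))%:E)%E ->
  norm (convolution u h t) <= M * c * e * expR (lam * t).
Proof.
move=> hu hc tT c0 hle ue; have [mu_ _] := hu.
have mE : measurable_fun (`[0, t]%classic : set R) (fun s => (`|u s| * expR (lam * s))%:E).
  apply/measurable_EFinP; apply: measurable_funM.
    by apply/measurable_EFinP; exact: measurable_abs_EFin.
  apply: measurable_funTS; apply: (@measurableT_comp _ _ _ _ _ _ expR).
    exact: measurable_expR.
  exact: mulrl_measurable.
rewrite -lee_fin (le_trans (norm_convolution_le hu hc tT))//.
apply: (@le_trans _ _ ((M * c)%:E * \int[mu]_(s in `[0%R, t]) (`|u s| * expR (lam * s))%:E)%E).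
  rewrite -ge0_integralZl//; last by rewrite lee_fin mulr_ge0.
  apply: ge0_le_integral => //.
  - by move=> s _; rewrite lee_fin !mulr_ge0 ?norm_ge0.
  - exact: measurable_kernel_bound.
  - exact: measurable_funeM.
  - move=> s; rewrite /= in_itv /= => st; rewrite lee_fin -mulrA ler_wpM2l//.
    by rewrite mulrCA ler_wpM2l// hle.
by rewrite -mulrA [in leRHS]EFinM; apply: lee_wpmul2l => //; rewrite lee_fin mulr_ge0.
Qed.

Lemma convolutionBr omega u h1 h2 t : mass_le T omega u ->
  continuous_upto T h1 -> continuous_upto T h2 ->
  continuous_upto T (fun s => h1 s - h2 s) -> 0 <= t <= T ->
  convolution u h1 t - convolution u h2 t = convolution u (fun s => h1 s - h2 s) t.
Proof.
move=> hu c1 c2 c12 tT; apply: (convolution_unique hu c12 tT).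
have [mu_ _] := hu; have [lS _ _ _] := HS.
have hB : has_Bochner_integral mu `[0, t] (fun s => S (t - s) (emb cplx (u s) *: h1 s) -
    S (t - s) (emb cplx (u s) *: h2 s)) (convolution u h1 t - convolution u h2 t).
  apply: BochnerB => //; [exact: lebesgue_segment_fin|
    exact: kernel_strongly_measurable c1 tT|exact: kernel_strongly_measurable c2 tT|
    exact: convolutionP hu c1 tT|exact: convolutionP hu c2 tT].
apply: eq_Bochner hB.
move=> s; rewrite /= in_itv /= => /andP[s0 st].
have BS : bounded_linear (S (t - s)) by apply: lS; rewrite subr_ge0.
by rewrite -bounded_linearB// scalerBr.
Qed.

Lemma convolutionBl omega1 omega2 u1 u2 h t : mass_le T omega1 u1 ->
  mass_le T omega2 u2 -> continuous_upto T h -> 0 <= t <= T ->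
  convolution u1 h t - convolution u2 h t = convolution (fun s => u1 s - u2 s) h t.
Proof.
move=> hu1 hu2 hc tT; apply: (convolution_unique (mass_le_sub hu1 hu2)) => //.
have [mu1 _] := hu1; have [mu2 _] := hu2; have [lS _ _ _] := HS.
have hB : has_Bochner_integral mu `[0, t] (fun s => S (t - s) (emb cplx (u1 s) *: h s) -
    S (t - s) (emb cplx (u2 s) *: h s)) (convolution u1 h t - convolution u2 h t).
  apply: BochnerB => //; [exact: lebesgue_segment_fin|
    exact: kernel_strongly_measurable hc tT|exact: kernel_strongly_measurable hc tT|
    exact: convolutionP hu1 hc tT|exact: convolutionP hu2 hc tT].
apply: eq_Bochner hB.
move=> s; rewrite /= in_itv /= => /andP[s0 st].
have BS : bounded_linear (S (t - s)) by apply: lS; rewrite subr_ge0.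
by rewrite -bounded_linearB// -scalerBl embD embN.
Qed.

End Convolution.

(** * Finite covers and precompactness of the convolution *)

Section ScalarIntegral.
Context (R : realType).
Local Notation mu := (@lebesgue_measure R).
Implicit Types (D : set (measurableTypeR R)) (w : R -> R).

(** The Bochner integral in the real line itself, so that the preceding linearity and norm bounds
    apply and [Bochner_map] turns it into the integral of a scalar function times a fixed vector. *)
Definition scalar_integral D w : R :=
  xget 0 [set a : R^o | @has_Bochner_integral _ _ R mu false R^o D w a].

Definition summable_on D w :=
  measurable_fun D w /\ (\int[mu]_(s in D) `|w s|%:E < +oo)%E.

Section Domain.
Variable D : set (measurableTypeR R).
Hypothesis mD : measurable D.
Hypothesis muD : (mu D < +oo)%E.

Lemma scalar_strongly_measurable w : measurable_fun D w ->
  @strongly_measurable _ _ R D false R^o w.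
Proof.
move=> mw; have h1 : @strongly_measurable _ _ R D false R^o (fun=> 1).
  by apply: simple_strongly_measurable; exact: finite_range_cst.
have := strongly_measurableZ mD mw h1.
by apply: eq_strongly_measurable => s _ /=; rewrite /GRing.scale /= mulr1.
Qed.

Lemma scalar_integralP w : summable_on D w ->
  @has_Bochner_integral _ _ R mu false R^o D w (scalar_integral D w).
Proof.
move=> [mw iw].
suff [a ha] : exists a, @has_Bochner_integral _ _ R mu false R^o D w a.
  exact: (xgetI 0 ha).
apply: Bochner_exists => //; exact: scalar_strongly_measurable.
Qed.

Lemma scalar_integral_unique w (a : R) : summable_on D w ->
  @has_Bochner_integral _ _ R mu false R^o D w a -> a = scalar_integral D w.
Proof.
move=> sw ha; apply: (Bochner_unique mD muD _ ha (scalar_integralP sw)).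
by apply: scalar_strongly_measurable; case: sw.
Qed.

Lemma norm_scalar_integral w : summable_on D w ->
  (`|scalar_integral D w|%:E <= \int[mu]_(s in D) `|w s|%:E)%E.
Proof.
move=> sw; have := norm_Bochner mD muD _ (scalar_integralP sw); apply.
by apply: scalar_strongly_measurable; case: sw.
Qed.

Lemma summable_onB w1 w2 : summable_on D w1 -> summable_on D w2 ->
  summable_on D (fun s => w1 s - w2 s).
Proof.
move=> [m1 i1] [m2 i2]; split; first exact: measurable_funB.
have a1 : measurable_fun D (fun s => `|w1 s|%:E).
  by apply/measurable_EFinP; exact: measurableT_comp.
have a2 : measurable_fun D (fun s => `|w2 s|%:E).
  by apply/measurable_EFinP; exact: measurableT_comp.
apply: le_lt_trans (lte_add_pinfty i1 i2); rewrite -ge0_integralD//.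
apply: ge0_le_integral => //.
- by apply/measurable_EFinP; apply: measurableT_comp => //; exact: measurable_funB.
- exact: emeasurable_funD.
- by move=> s _; rewrite -EFinD lee_fin ler_normB.
Qed.

Lemma scalar_integralB w1 w2 : summable_on D w1 -> summable_on D w2 ->
  scalar_integral D (fun s => w1 s - w2 s) =
  scalar_integral D w1 - scalar_integral D w2.
Proof.
move=> s1 s2; apply/esym/scalar_integral_unique; first exact: summable_onB.
apply: (@BochnerB _ _ R mu D mD muD false R^o w1 w2).
- by apply: scalar_strongly_measurable; case: s1.
- by apply: scalar_strongly_measurable; case: s2.
- exact: scalar_integralP.
- exact: scalar_integralP.
Qed.

Lemma scalar_integral_vector (cplx : bool) (X : normedModType (scalars R cplx))
    w (v : X) : summable_on D w ->
  strongly_measurable D (fun s => emb cplx (w s) *: v) /\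
  has_Bochner_integral mu D (fun s => emb cplx (w s) *: v)
    (emb cplx (scalar_integral D w) *: v).
Proof.
move=> sw; apply: (@Bochner_map _ _ R mu D mD muD false cplx R^o X
  (fun a => emb cplx a *: v) (norm v) w); last exact: scalar_integralP.
- by move=> a b; rewrite embD scalerDl.
- by move=> a b; rewrite [RHS]scalerA -embM.
- by move=> a; rewrite normZ mulrC.
- by apply: scalar_strongly_measurable; case: sw.
Qed.

End Domain.

(** Meant for grid cells that lie within [[0, t]]: their integrals over [[0, t]] and over [[0, T]]
    agree, and so do not depend on [t]. *)
Lemma scalar_integral_extend D E w : measurable D -> measurable E ->
  (mu E < +oo)%E -> D `<=` E -> summable_on E w ->
  (forall s, E s -> ~ D s -> w s = 0) ->
  scalar_integral D w = scalar_integral E w.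
Proof.
move=> mD mE muE DE sw w0; apply: scalar_integral_unique => //.
have sD : summable_on D w.
  case: sw => mw iw; split; first exact: measurable_funS mw.
  apply: le_lt_trans iw; apply: ge0_subset_integral => //.
  by apply/measurable_EFinP; exact: measurableT_comp.
have muD : (mu D < +oo)%E by rewrite (le_lt_trans _ muE)// le_measure ?inE.
have := Bochner_extend mD mE muE DE (scalar_integralP mD muD sD).
apply: eq_Bochner => s Es; case: ifPn => // /negP nD.
by rewrite w0// => Ds; apply: nD; exact/mem_set.
Qed.

End ScalarIntegral.

Section BochnerSum.
Context d (T : measurableType d) (R : realType) (mu : {measure set T -> \bar R}).
Variable D : set T.
Hypothesis mD : measurable D.
Hypothesis muD : (mu D < +oo)%E.
Context (cplx : bool) (X : normedModType (scalars R cplx)).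

Lemma Bochner_sum (I : Type) (r : seq I) (g : I -> T -> X) (J : I -> X) :
  (forall i, strongly_measurable D (g i)) ->
  (forall i, has_Bochner_integral mu D (g i) (J i)) ->
  strongly_measurable D (fun t => \sum_(i <- r) g i t) /\
  has_Bochner_integral mu D (fun t => \sum_(i <- r) g i t) (\sum_(i <- r) J i).
Proof.
move=> mg hg; elim: r => [|i r [mr hr]].
  rewrite big_nil (_ : (fun=> _) = fun=> 0); last first.
    by apply/funext => t; rewrite big_nil.
  have F0 : finite_range D (fun=> 0 : X) by exact: finite_range_cst.
  have m0 := simple_strongly_measurable F0; split=> //.
  exists (fun=> fun=> 0); split.
  - by move=> _; apply/simple_onP.
  - by apply: aeW => t _; exact: cvg_cst.
  - rewrite (_ : (fun n => _) = fun=> 0%E); first exact: cvg_cst.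
    by apply/funext => n; apply: integral0_eq => t _; rewrite subrr norm0.
  - rewrite (_ : (fun n => _) = fun=> 0); first exact: cvg_cst.
    apply/funext => n; apply/norm_le0; rewrite -lee_fin.
    rewrite (le_trans (norm_simple_integral mD muD F0))//.
    by rewrite norm0 integral0.
have E t : \sum_(j <- i :: r) g j t = emb cplx 1 *: g i t + \sum_(j <- r) g j t.
  by rewrite big_cons emb1 scale1r.
have -> : (fun t => \sum_(j <- i :: r) g j t) =
    (fun t => emb cplx 1 *: g i t + \sum_(j <- r) g j t) by apply/funext.
rewrite big_cons; split; first exact: strongly_measurable_lin.
rewrite -[J i]scale1r -(emb1 R cplx); exact: Bochner_lin.
Qed.

End BochnerSum.

Section Segment.
Context (R : realType) (cplx : bool) (X : normedModType (scalars R cplx)).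
Local Notation mu := (@lebesgue_measure R).

Lemma norm_Bochner_segment (t : R) (g : R -> X) I :
  strongly_measurable (`[0, t]%classic : set R) g ->
  has_Bochner_integral mu `[0, t] g I ->
  ((norm I)%:E <= \int[mu]_(s in `[0%R, t]) (norm (g s))%:E)%E.
Proof. by move=> mg; apply: norm_Bochner => //; exact: lebesgue_segment_fin. Qed.

Lemma BochnerB_segment (t : R) (g1 g2 : R -> X) I1 I2 :
  strongly_measurable (`[0, t]%classic : set R) g1 ->
  strongly_measurable (`[0, t]%classic : set R) g2 ->
  has_Bochner_integral mu `[0, t] g1 I1 -> has_Bochner_integral mu `[0, t] g2 I2 ->
  has_Bochner_integral mu `[0, t] (fun s => g1 s - g2 s) (I1 - I2).
Proof. by move=> m1 m2; apply: BochnerB => //; exact: lebesgue_segment_fin. Qed.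

End Segment.

(** * Finite covers *)

Section FiniteCover.
Context (U : Type).

(* Total boundedness at the scale [P], inductively: no counting of pieces. *)
Inductive finitely_covered (P : U -> U -> Prop) : set U -> Prop :=
| covered_piece B : (forall u v, B u -> B v -> P u v) -> finitely_covered P B
| covered_union B B1 B2 : B `<=` B1 `|` B2 -> finitely_covered P B1 ->
    finitely_covered P B2 -> finitely_covered P B.

(** Refines a cover piece by piece. What the members of a piece already share may be used to choose
    the next condition; this is how successive approximations are combined. *)
Lemma finitely_covered_bind (P Q : U -> U -> Prop) B :
  finitely_covered P B ->
  (forall E, E `<=` B -> (forall u v, E u -> E v -> P u v) ->
    finitely_covered Q E) ->
  finitely_covered Q B.
Proof.
move=> fB; have : B `<=` B by [].
elim: fB {-2}B => {B} [B PB B' sB h|B B1 B2 sB _ h1 _ h2 B' sB' h].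
  by apply: h => // u v /sB Bu /sB Bv; exact: PB.
apply: (@covered_union _ _ (B1 `&` B') (B2 `&` B')).
- by move=> u B'u; case: (sB _ (sB' _ B'u)) => ?; [left|right].
- by apply: h1 => // E EB PE; apply: h => // u /EB[].
- by apply: h2 => // E EB PE; apply: h => // u /EB[].
Qed.

Lemma finitely_covered_bounded (R : realType) (a : U -> R) (C eta : R) (B : set U) :
  0 < eta -> (forall u, B u -> `|a u| <= C) ->
  finitely_covered (fun u v => `|a u - a v| <= eta) B.
Proof.
move=> eta0 aC.
(* Bisection of an interval of length [eta * 2 ^+ n] with left end [l]: after [n] halvings the
   values differ by at most [eta]. *)
have main n : forall (B' : set U) l, (forall u, B' u -> l <= a u <= l + eta * 2 ^+ n) ->
    finitely_covered (fun u v => `|a u - a v| <= eta) B'.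
  elim: n => [|n IH] B' l hB.
    apply: covered_piece => u v /hB /andP[? ?] /hB /andP[? ?].
    by rewrite ler_norml; apply/andP; split; lra.
  apply: (@covered_union _ _ (B' `&` [set u | a u <= l + eta * 2 ^+ n])
    (B' `&` [set u | l + eta * 2 ^+ n <= a u])).
  - by move=> u Bu; have [h|/ltW h] := leP (a u) (l + eta * 2 ^+ n); [left|right].
  - by apply: (IH _ l) => u [/hB /andP[-> _]].
  - apply: (IH _ (l + eta * 2 ^+ n)) => u [/hB /andP[_ h] ->].
    by rewrite (le_trans h)// exprS; lra.
pose n := Num.truncn (2 * C / eta).
apply: (main n _ (- C)) => u /aC; rewrite ler_norml => /andP[-> h] /=.
have h1 : 2 * C / eta < n.+1%:R by exact: truncnS_gt.
have h2 : n.+1%:R <= 2 ^+ n :> R by rewrite -natrX ler_nat ltn_expl.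
rewrite ltr_pdivrMr// in h1.
have h3 : n.+1%:R * eta <= 2 ^+ n * eta by rewrite ler_wpM2r// ltW.
lra.
Qed.

Lemma finitely_covered_bounded_ord (R : realType) (N : nat) (a : nat -> U -> R)
    (C eta : R) (B : set U) :
  0 < eta -> (forall k u, B u -> `|a k u| <= C) ->
  finitely_covered (fun u v => forall k, (k < N)%N -> `|a k u - a k v| <= eta) B.
Proof.
move=> eta0 aC; elim: N => [|N IH]; first exact: covered_piece.
apply: finitely_covered_bind IH _ => E EB PE.
have FE : finitely_covered (fun u v => `|a N u - a N v| <= eta) E.
  by apply: (finitely_covered_bounded (C := C)) => // u /EB; exact: aC.
apply: finitely_covered_bind FE _ => E' EE' PE'.
apply: covered_piece => u v E'u E'v k; rewrite ltnS leq_eqVlt => /predU1P[->|kN].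
  exact: PE'.
by apply: PE => //; exact: EE'.
Qed.

End FiniteCover.

(** * Continuity and total boundedness of the convolution *)

Section ConvolutionRegularity.
Context (R : realType) (cplx : bool) (X : completeNormedModType (scalars R cplx)).
Local Notation mu := (@lebesgue_measure R).
Variable S : R -> X -> X.
Hypothesis HS : C0_semigroup S.
Variables (T M : R).
Hypothesis T0 : 0 <= T.
Hypothesis M1 : 1 <= M.
Hypothesis SM : forall t x, 0 <= t <= T -> norm (S t x) <= M * norm x.

Let M0 : 0 <= M. Proof. by rewrite (le_trans _ M1). Qed.

Lemma mass_ge0 omega (u : R -> R) : mass_le T omega u -> 0 <= omega T.
Proof.
move=> hu; rewrite -lee_fin; have TT : 0 <= T <= T by rewrite T0 lexx.
apply: le_trans (mass_fin hu TT).
by apply: integral_ge0 => s _; rewrite lee_fin.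
Qed.

(** Up to [t] the two integrands differ by the increment of the kernel, weighted with the whole
    mass; from [t] to [t'] the integrand itself counts, weighted with the mass of a short
    interval. *)
Lemma convolution_shift_le omega u h (t t' e K : R) : mass_le T omega u ->
  continuous_upto T h -> 0 <= t -> t <= t' -> t' <= T -> 0 <= e -> 0 <= K ->
  (forall s, 0 <= s <= T -> norm (h s) <= K) ->
  (forall s, 0 <= s <= t -> norm (S (t' - s) (h s) - S (t - s) (h s)) <= e) ->
  norm (convolution S u h t' - convolution S u h t) <= e * omega T + M * K * omega (t' - t).
Proof.
move=> hu hc t0 tt' t'T e0 K0 hK he; have [mu_ hu'] := hu.
have tT : 0 <= t <= T by rewrite t0 (le_trans tt').
have t'T' : 0 <= t' <= T by rewrite (le_trans t0 tt').
have [lS _ _ _] := HS.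
have sub : `[0, t]%classic `<=` (`[0, t']%classic : set R).
  by move=> s /=; rewrite !in_itv /= => /andP[-> st]; rewrite (le_trans st).
pose g s := S (t' - s) (emb cplx (u s) *: h s) -
  (if s \in `[0, t]%classic then S (t - s) (emb cplx (u s) *: h s) else 0).
have mg1 := kernel_strongly_measurable HS mu_ hc t'T'.
have mg2 : strongly_measurable (`[0, t']%classic : set R)
    (fun s => if s \in `[0, t]%classic then S (t - s) (emb cplx (u s) *: h s) else 0).
  by apply: strongly_measurable_extend => //; exact: kernel_strongly_measurable hc tT.
have mg : strongly_measurable (`[0, t']%classic : set R) g.
  exact: strongly_measurableB.
have hB : has_Bochner_integral mu `[0, t'] (fun s => S (t' - s) (emb cplx (u s) *: h s) -
    (if s \in `[0, t]%classic then S (t - s) (emb cplx (u s) *: h s) else 0))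
    (convolution S u h t' - convolution S u h t).
  apply: BochnerB => //.
  - exact: lebesgue_segment_fin.
  - refine (convolutionP HS M1 SM hu hc t'T').
  - apply: Bochner_extend => //; first exact: lebesgue_segment_fin.
    refine (convolutionP HS M1 SM hu hc tT).
have nB := norm_Bochner_segment mg hB.
rewrite -lee_fin; apply: (le_trans nB).
have mV : measurable_fun (`[0, t']%classic : set R) (fun s => `|u s|%:E).
  exact: measurable_abs_EFin.
pose f1 s := (e%:E * `|u s|%:E)%E.
pose f2 s := ((M * K)%:E * ((fun s => `|u s|%:E) \_ `[t, t']) s)%E.
have mp : measurable_fun (`[0, t']%classic : set R) ((fun s => `|u s|%:E) \_ `[t, t']).
  by apply/measurable_restrict => //; exact: measurable_abs_EFin.
have mf1 : measurable_fun (`[0, t']%classic : set R) f1 by exact: measurable_funeM.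
have mf2 : measurable_fun (`[0, t']%classic : set R) f2 by exact: measurable_funeM.
have p0 s : (0 <= ((fun s => `|u s|%:E) \_ `[t, t']) s)%E.
  by rewrite patchE; case: ifP => _; rewrite ?lee_fin.
have f10 s : (0 <= f1 s)%E by rewrite mule_ge0 ?lee_fin.
have f20 s : (0 <= f2 s)%E by rewrite mule_ge0 ?lee_fin ?mulr_ge0.
apply: (@le_trans _ _ (\int[mu]_(s in `[0%R, t']) (f1 s + f2 s))%E).
  apply: ge0_le_integral => //.
  - by move=> s _; rewrite lee_fin norm_ge0.
  - exact: measurable_norm.
  - exact: emeasurable_funD.
  - move=> s; rewrite /= in_itv /= => /andP[s0 st'].
    rewrite /g; case: ifPn => [/set_mem|].
      rewrite /= in_itv /= => /andP[_ st].
      have B1 : bounded_linear (S (t' - s)) by apply: lS; rewrite subr_ge0.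
      have B2 : bounded_linear (S (t - s)) by apply: lS; rewrite subr_ge0.
      rewrite bounded_linearZ// [X in _ - X]bounded_linearZ// -scalerBr normZ.
      apply: (@le_trans _ _ (f1 s)); last by rewrite leeDl.
      by rewrite /f1 -EFinM lee_fin mulrC ler_wpM2r// he// s0.
    rewrite notin_setE /= in_itv /= s0 /= => /negP; rewrite -ltNge => ts.
    rewrite subr0; apply: (@le_trans _ _ (f2 s)); last by rewrite leeDr.
    rewrite /f2 patchE ifT; last by apply/mem_set; rewrite /= in_itv /= ltW.
    rewrite -EFinM lee_fin (le_trans (norm_kernel_le SM _ _ _ t'T))//.
      by rewrite s0.
    rewrite -mulrA ler_wpM2l// mulrC ler_wpM2r// hK// s0 /=; exact: le_trans t'T.
rewrite ge0_integralD//.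
rewrite EFinD; apply: leeD.
  rewrite ge0_integralZl// EFinM; apply: lee_wpmul2l => //; exact: mass_fin hu t'T'.
rewrite ge0_integralZl//; last by rewrite lee_fin mulr_ge0.
rewrite [leRHS]EFinM; apply: lee_wpmul2l; first by rewrite lee_fin mulr_ge0.
rewrite -integral_mkcondr setIidr; last first.
  by move=> s /=; rewrite !in_itv /= => /andP[ts ->]; rewrite (le_trans t0).
exact: hu'.
Qed.

Lemma convolution_continuous omega u h : modulus omega -> mass_le T omega u ->
  continuous_upto T h -> continuous_upto T (convolution S u h).
Proof.
move=> mo hu hc t tT e e0; have om0 := mass_ge0 hu.
have [K K0 hK] := continuous_upto_bounded hc.
have MK0 : 0 < M * K by rewrite mulr_gt0// (lt_le_trans _ M1).
have e20 : 0 < e / 4 / (M * K) by rewrite !divr_gt0.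
have e10 : 0 < e / 4 / (omega T + 1) by rewrite !divr_gt0// ltr_wpDl.
have [d1 d10 hd1] := semigroup_orbit_unif HS hc e10.
have [d2 d20 hd2] := mo _ e20.
have main a b : 0 <= a -> a <= b -> b <= T -> b - a < d1 -> b - a < d2 ->
    norm (convolution S u h b - convolution S u h a) < e.
  move=> a0 ab bT ab1 ab2.
  have := convolution_shift_le hu hc a0 ab bT (ltW e10) (ltW K0) hK.
  move=> /(_ _) /le_lt_trans; apply.
    move=> s /andP[s0 sa]; apply/ltW/hd1 => //; try (by apply/andP; split; lra).
    - by rewrite subrr normr0.
    - by rewrite (_ : b - s - (a - s) = b - a) ?ger0_norm ?subr_ge0//; ring.
  have h1 : e / 4 / (omega T + 1) * omega T <= e / 4.
    rewrite -{2}(divfK (lt0r_neq0 (_ : 0 < omega T + 1)) (e / 4)) ?ltr_wpDl//.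
    by rewrite ler_wpM2l ?(ltW e10)// lerDl.
  have h2 : M * K * omega (b - a) <= e / 4.
    rewrite -ler_pdivlMl// mulrC; apply: hd2; last exact: ltW.
    by rewrite subr_ge0.
  lra.
exists (Num.min d1 d2); first by rewrite lt_min d10.
move=> t' /andP[t'0 t'T]; rewrite lt_min => /andP[h1 h2]; case/andP: tT => t0 tT.
have [le_tt'|lt_t't] := leP t t'.
  by rewrite ger0_norm ?subr_ge0// in h1 h2; exact: main.
rewrite distrC ger0_norm ?subr_ge0 ?(ltW lt_t't)// in h1 h2.
by rewrite normB; apply: main => //; exact: ltW.
Qed.

(* Riemann-Stieltjes estimate: a control whose mean over every cell of a fine
   grid is small produces a small convolution. *)
Lemma convolution_grid_le omega w h (t dl e K eta rho : R) (N : nat) :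
  mass_le T omega w -> continuous_upto T h -> 0 <= t <= T ->
  0 < dl -> T < N%:R * dl -> 0 <= e -> 0 <= K -> 0 <= eta -> 0 <= rho ->
  (forall s, 0 <= s <= T -> norm (h s) <= K) ->
  (forall s s', 0 <= s' -> s' <= s -> s <= t -> s - s' <= dl ->
    norm (S (t - s) (h s) - S (t - s') (h s')) <= e) ->
  (forall k, (k < N)%N -> `|scalar_integral `[0, T]
    (fun s => w s * \1_(`[k%:R * dl, k.+1%:R * dl[%classic : set R) s)| <= eta) ->
  (forall r, 0 <= r -> r <= dl -> omega r <= rho) ->
  norm (convolution S w h t) <= e * omega T + M * K * (N%:R * eta + rho).
Proof.
move=> hw hc tT dl0 TN e0 K0 eta0 rho0 hK he hw_cell hrho.
have [mw hw'] := hw; have [lS _ _ _] := HS; have /andP[t0 tT'] := tT.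
pose I k : set R := `[k%:R * dl, k.+1%:R * dl[%classic.
pose wk k s := w s * \1_(I k) s.
(* The kernel at the left end of cell [k]. Cells beginning after [t] get 0, since the semigroup
   would be taken at a negative time there. *)
pose v k := if k%:R * dl <= t then S (t - k%:R * dl) (h (k%:R * dl)) else 0.
have mwk k D : measurable_fun D (wk k).
  apply: measurable_funTS; apply: measurable_funM => //.
  by apply: measurable_indic; exact: measurable_itv.
have wk_le k s : `|wk k s| <= `|w s|.
  by rewrite normrM ler_piMr// indicE; case: (_ \in _); rewrite ?normr1 ?normr0.
have swk k t1 : 0 <= t1 <= T -> summable_on `[0, t1] (wk k).
  move=> t1T; split; first exact: mwk.
  apply: le_lt_trans (ltry (omega T)); apply: le_trans (mass_fin hw t1T).
  apply: ge0_le_integral => //.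
  - by apply/measurable_EFinP; apply: measurableT_comp => //; exact: mwk.
  - exact: measurable_abs_EFin.
  - by move=> s _; rewrite lee_fin.
have nv k : norm (v k) <= M * K.
  rewrite /v; case: ifP => [kt|_]; last by rewrite norm0 mulr_ge0.
  have k0 : 0 <= k%:R * dl by rewrite mulr_ge0// ltW.
  rewrite (le_trans (SM _ _))//; first by lra.
  by rewrite ler_wpM2l// hK//; lra.
pose a k := scalar_integral `[0, t] (wk k).
(* The Riemann-Stieltjes sum is itself the Bochner integral of a step function, so its distance to
   the convolution is the norm of a single integral. *)
have vec k := scalar_integral_vector (measurable_itv _) (lebesgue_segment_fin _ _)
  (v k) (swk k t tT).
have [mp hp] := @Bochner_sum _ _ R mu (`[0, t]%classic : set R) (measurable_itv _)
  (lebesgue_segment_fin _ _) cplx X nat (iota 0 N) _ _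
  (fun k => (vec k).1) (fun k => (vec k).2).
have mk := kernel_strongly_measurable HS mw hc tT.
have cP := convolutionP HS M1 SM hw hc tT.
have hB := BochnerB_segment mk mp cP hp.
have nB := norm_Bochner_segment (strongly_measurableB mk mp) hB.
have h1 : norm (convolution S w h t -
    \sum_(k <- iota 0 N) emb cplx (a k) *: v k) <= e * omega T.
  rewrite -lee_fin; apply: (le_trans nB).
  rewrite EFinM; apply: (@le_trans _ _ (e%:E * \int[mu]_(s in `[0%R, t]) `|w s|%:E)%E); last first.
    by apply: lee_wpmul2l => //; exact: mass_fin hw tT.
  have mV : measurable_fun (`[0, t]%classic : set R) (fun s => `|w s|%:E).
    exact: measurable_abs_EFin.
  rewrite -ge0_integralZl//; apply: ge0_le_integral => //.
  - by move=> s _; rewrite lee_fin norm_ge0.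
  - by apply: measurable_norm => //; exact: strongly_measurableB.
  - exact: measurable_funeM.
  - move=> s; rewrite /= in_itv /= => /andP[s0 st].
    pose k0 := Num.truncn (s / dl).
    have sdl0 : 0 <= s / dl by rewrite divr_ge0// ltW.
    have /andP[k1 k2] : k0%:R <= s / dl < k0.+1%:R by exact: truncn_itv.
    rewrite ler_pdivlMr// in k1; rewrite ltr_pdivrMr// in k2.
    have k0N : (k0 < N)%N.
      rewrite -(@ltr_nat R) -(ltr_pM2r dl0); lra.
    have cell k : s \in I k -> k = k0.
      move=> /set_mem; rewrite /I /= in_itv /= => /andP[a1 a2].
      by apply/esym/truncn_def; rewrite ler_pdivlMr// ltr_pdivrMr// a1.
    have sI : s \in I k0 by apply/mem_set; rewrite /I /= in_itv /= k1.
    have -> : \sum_(k <- iota 0 N) emb cplx (wk k s) *: v k = emb cplx (w s) *: v k0.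
      rewrite (bigD1_seq k0) ?mem_iota ?iota_uniq//= big1 ?addr0.
        by rewrite /wk indicE sI mulr1.
      move=> k kk0; rewrite /wk indicE (_ : (s \in I k) = false) ?mulr0 ?emb0 ?scale0r//.
      by apply/negbTE/negP => /cell/eqP; rewrite (negbTE kk0).
    have B1 : bounded_linear (S (t - s)) by apply: lS; rewrite subr_ge0.
    rewrite bounded_linearZ// -scalerBr normZ -EFinM lee_fin mulrC ler_wpM2r//.
    rewrite /v ifT; last exact: le_trans st.
    by apply: he => //; [rewrite mulr_ge0// ltW|rewrite -natr1 in k2; lra].
(* The cell containing [t] is the only one cut by the upper limit. Its truncated integral is not
   among the quantities bounded by [eta], and is bounded by the mass [rho] of one cell instead. *)
pose kt := Num.truncn (t / dl).
have h2 k : (k < N)%N -> norm (emb cplx (a k) *: v k) <=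
    M * K * eta + (k == kt)%:R * (M * K * rho).
  move=> kN; rewrite normZ.
  have r0 : 0 <= (k == kt)%:R * (M * K * rho) by rewrite !mulr_ge0.
  have r1 : 0 <= M * K * eta by rewrite !mulr_ge0.
  have [kt1|kt1] := leP (k%:R * dl) t; last first.
    have -> : v k = 0 by rewrite /v leNgt kt1.
    by rewrite norm0 mulr0 addr_ge0.
  have k0 : 0 <= k%:R * dl by rewrite mulr_ge0// ltW.
  have [kt2|kt2] := leP (k.+1%:R * dl) t.
    have -> : a k = scalar_integral `[0, T] (wk k).
      apply: scalar_integral_extend => //.
      - exact: lebesgue_segment_fin.
      - by move=> s /=; rewrite !in_itv /= => /andP[-> st]; rewrite (le_trans st).
      - by apply: swk; rewrite T0 lexx.
      - move=> s /=; rewrite !in_itv /= => /andP[s0 sT] nst.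
        rewrite /wk indicE (_ : (s \in I k) = false) ?mulr0//.
        apply/negbTE/negP => /set_mem; rewrite /I /= in_itv /= => /andP[a1 a2].
        by apply: nst; rewrite s0 ltW// (lt_le_trans a2).
    rewrite ler_wpDr// mulrC; apply: ler_pM => //; first exact: norm_ge0.
    exact: hw_cell.
  have -> : k == kt.
    by apply/eqP/esym/truncn_def; rewrite ler_pdivlMr// ltr_pdivrMr// kt1.
  rewrite mul1r ler_wpDl// mulrC; apply: ler_pM => //; first exact: norm_ge0.
  rewrite -lee_fin.
  apply: (@le_trans _ _ (\int[mu]_(s in `[0%R, t]) `|wk k s|%:E)%E).
    apply: norm_scalar_integral (swk k t tT) => //; exact: lebesgue_segment_fin.
  apply: (@le_trans _ _ (\int[mu]_(s in `[(k%:R * dl)%R, t]) `|w s|%:E)%E); last first.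
    apply: (le_trans (hw' _ _ k0 kt1 tT')); rewrite lee_fin hrho ?subr_ge0//.
    by rewrite -natr1 in kt2; lra.
  have -> : (\int[mu]_(s in `[0%R, t]) `|wk k s|%:E)%E =
      (\int[mu]_(s in `[(k%:R * dl)%R, t]) `|wk k s|%:E)%E.
    rewrite integral_mkcond [RHS]integral_mkcond; apply: eq_integral => s _.
    rewrite !patchE.
    case: ifPn => q1; case: ifPn => q2 //.
      move/set_mem: q1; rewrite /= in_itv /= => /andP[s0 st].
      rewrite /wk indicE (_ : (s \in I k) = false) ?mulr0 ?normr0//.
      apply/negbTE/negP => /set_mem; rewrite /I /= in_itv /= => /andP[a1 a2].
      by move/negP: q2; apply; apply/mem_set; rewrite /= in_itv /= a1.
    move/set_mem: q2; rewrite /= in_itv /= => /andP[a1 a2].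
    by exfalso; move/negP: q1; apply; apply/mem_set; rewrite /= in_itv /= a2 (le_trans k0).
  apply: ge0_le_integral => //.
  - by apply/measurable_EFinP; apply: measurableT_comp => //; exact: mwk.
  - exact: measurable_abs_EFin.
  - by move=> s _; rewrite lee_fin.
rewrite (le_trans (norm_le_sub _ (\sum_(k <- iota 0 N) emb cplx (a k) *: v k)))//.
rewrite addrC lerD// (le_trans (norm_sum _ _ _))//.
rewrite (@le_trans _ _ (\sum_(k <- iota 0 N)
    (M * K * eta + (k == kt)%:R * (M * K * rho))))//.
  by rewrite big_seq [leRHS]big_seq; apply: ler_sum => k; rewrite mem_iota /= => /h2.
rewrite big_split /= mulrDr; apply: lerD.
  rewrite big_const_seq count_predT size_iota iter_addr_0.
  by rewrite -[leLHS]mulr_natl mulrCA.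
have MK : 0 <= M * K * rho by rewrite !mulr_ge0.
rewrite -mulr_suml ler_piMl//.
have [ktN|ktN] := boolP (kt \in iota 0 N).
  rewrite (bigD1_seq kt) ?iota_uniq//= eqxx big1 ?addr0// => k /negbTE ->//.
rewrite big_seq big1 ?ler01// => k kN.
by case: eqP => // kk; rewrite -kk kN in ktN.
Qed.

(** Controls with nearly equal cell integrals have nearly equal convolutions, by the grid estimate
    for their difference. The cell integrals over [[0, T]] do not involve [t], so one partition of
    [B] serves all [t]. *)
Lemma convolution_finitely_covered (U : Type) (B : set U) (w : U -> R -> R)
    omega h (e : R) : modulus omega ->
  (forall u, B u -> mass_le T omega (w u)) -> continuous_upto T h -> 0 < e ->
  finitely_covered (fun u v => forall t, 0 <= t <= T ->
    norm (convolution S (w u) h t - convolution S (w v) h t) <= e) B.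
Proof.
move=> mo hw hc e0.
have [K K0 hK] := continuous_upto_bounded hc.
have MK0 : 0 < M * K by rewrite mulr_gt0// (lt_le_trans _ M1).
pose W := 2 * `|omega T| + 1.
have W0 : 0 < W by rewrite ltr_wpDl// mulr_ge0.
have e10 : 0 < e / 3 / W by rewrite !divr_gt0.
(* The final half is there because the difference of two controls has the modulus [omega + omega];
   [W] bounds this sum at [T]. *)
have e20 : 0 < e / 3 / (M * K) / 2 by rewrite !divr_gt0.
have [d1 d10 hd1] := semigroup_orbit_unif HS hc e10.
have [d2 d20 hd2] := mo _ e20.
pose dl := Num.min (d1 / 2) d2.
have dl0 : 0 < dl by rewrite lt_min d20 divr_gt0.
have dld1 : dl < d1.
  by rewrite (@le_lt_trans _ _ (d1 / 2)) ?ge_min ?lexx//; lra.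
pose N := (Num.truncn (T / dl)).+1.
have TN : T < N%:R * dl by rewrite -ltr_pdivrMr// truncnS_gt.
(* The errors of all [N] cells, multiplied by [M * K], add up to [e / 3]. *)
pose eta := e / 3 / (M * K) / N%:R.
have eta0 : 0 < eta by rewrite !divr_gt0.
pose a k u := scalar_integral `[0, T]
  (fun s => w u s * \1_(`[k%:R * dl, k.+1%:R * dl[%classic : set R) s).
have TT : 0 <= T <= T by rewrite T0 lexx.
have su k u : B u -> summable_on `[0, T]
    (fun s => w u s * \1_(`[k%:R * dl, k.+1%:R * dl[%classic : set R) s) /\
    (\int[mu]_(s in `[0%R, T])
      `|w u s * \1_(`[k%:R * dl, k.+1%:R * dl[%classic : set R) s|%:E <= (omega T)%:E)%E.
  move=> /hw hu; have [mw _] := hu.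
  have mI : measurable_fun (`[0, T]%classic : set R)
      (fun s => w u s * \1_(`[k%:R * dl, k.+1%:R * dl[%classic : set R) s).
    by apply: measurable_funTS; apply: measurable_funM.
  have le : (\int[mu]_(s in `[0%R, T])
      `|w u s * \1_(`[k%:R * dl, k.+1%:R * dl[%classic : set R) s|%:E <= (omega T)%:E)%E.
    apply: le_trans (mass_fin hu TT); apply: ge0_le_integral => //.
    - by apply/measurable_EFinP; apply: measurableT_comp.
    - exact: measurable_abs_EFin.
    - move=> s _; rewrite lee_fin normrM ler_piMr// indicE.
      by case: (_ \in _); rewrite ?normr1 ?normr0.
  by split=> //; split=> //; apply: le_lt_trans le _; exact: ltry.
have aC k u : B u -> `|a k u| <= omega T.
  move=> /(su k)[s1 s2]; rewrite -lee_fin.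
  apply: le_trans s2.
  apply: norm_scalar_integral s1 => //; exact: lebesgue_segment_fin.
apply: finitely_covered_bind (finitely_covered_bounded_ord N eta0 aC) _ => E EB PE.
apply: covered_piece => u v Eu Ev t tT.
have hu := hw _ (EB _ Eu); have hv := hw _ (EB _ Ev).
rewrite (convolutionBl HS M1 SM hu hv hc tT).
have huv := mass_le_sub hu hv.
have W2 : omega T + omega T <= W.
  by have := ler_norm (omega T); rewrite /W; lra.
apply: (@le_trans _ _ (e / 3 / W * (omega T + omega T) +
    M * K * (N%:R * eta + e / 3 / (M * K)))); last first.
  have h1 : e / 3 / W * (omega T + omega T) <= e / 3.
    by rewrite -{2}(divfK (lt0r_neq0 W0) (e / 3)) ler_wpM2l// ltW.
  have h2 : M * K * (N%:R * eta + e / 3 / (M * K)) = e / 3 + e / 3.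
    rewrite /eta; field.
    by rewrite !lt0r_neq0// (lt_le_trans _ M1).
  lra.
apply: (convolution_grid_le huv hc tT dl0 TN); rewrite ?(ltW e10, ltW K0, ltW eta0)//.
- by rewrite !divr_ge0// ltW.
- move=> s s' s'0 s's st sdl; case/andP: tT => t0 tT; apply/ltW.
  apply: hd1; try (by apply/andP; split; lra).
    by rewrite ger0_norm ?subr_ge0//; lra.
  rewrite (_ : t - s - (t - s') = s' - s); last by ring.
  by rewrite distrC ger0_norm ?subr_ge0//; lra.
- move=> k kN.
  have -> : (fun s => (w u s - w v s) * \1_(`[k%:R * dl, k.+1%:R * dl[%classic : set R) s) =
    (fun s => w u s * \1_(`[k%:R * dl, k.+1%:R * dl[%classic : set R) s -
              w v s * \1_(`[k%:R * dl, k.+1%:R * dl[%classic : set R) s).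
    by apply/funext => s; rewrite mulrBl.
  rewrite scalar_integralB//; last 3 first.
  + exact: lebesgue_segment_fin.
  + exact: (su k u (EB _ Eu)).1.
  + exact: (su k v (EB _ Ev)).1.
  exact: PE.
- move=> r r0 rdl; have : omega r <= e / 3 / (M * K) / 2.
    by apply: hd2 => //; rewrite (le_trans rdl)// ge_min lexx orbT.
  lra.
Qed.

End ConvolutionRegularity.

(** * Picard iteration *)

Lemma norm_sum_ord_le (R : realType) (cplx : bool)
    (X : normedModType (scalars R cplx)) (m : nat) (a : 'I_m -> X) (b : R) :
  (forall i, norm (a i) <= b) -> norm (\sum_(i < m) a i) <= m%:R * b.
Proof.
move=> ab; rewrite (le_trans (norm_sum _ _ _))//.
rewrite (le_trans (ler_sum _ (fun i _ => ab i)))// sumr_const card_ord.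
by rewrite [leRHS]mulr_natl.
Qed.

(** Takes the place of Gronwall's inequality: from the crude bound [K0], iteration of
    [K |-> c + K / 2] brings the constant arbitrarily close to the fixed point [2 c]. *)
Lemma absorb_half (R : realType) (T lam c K0 : R) (phi : R -> R) :
  0 <= lam -> 0 <= c -> (forall s, 0 <= s <= T -> phi s <= K0) ->
  (forall K, 0 <= K -> (forall s, 0 <= s <= T -> phi s <= K * expR (lam * s)) ->
    forall s, 0 <= s <= T -> phi s <= (c + K / 2) * expR (lam * s)) ->
  forall s, 0 <= s <= T -> phi s <= 2 * c * expR (lam * s).
Proof.
move=> lam0 c0 phiK step.
have main n s : 0 <= s <= T -> phi s <= (2 * c + `|K0| / 2 ^+ n) * expR (lam * s).
  elim: n s => [|n IH] s sT.
    rewrite divr1; rewrite (le_trans (phiK _ sT))//.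
    have h1 : 1 <= expR (lam * s).
      apply: le_trans (expR_ge1Dx _); rewrite lerDl mulr_ge0//.
      by case/andP: sT.
    rewrite (le_trans (ler_norm _))//.
    have h2 : 0 <= 2 * c + `|K0| by rewrite addr_ge0// mulr_ge0.
    by rewrite (@le_trans _ _ (2 * c + `|K0|)) ?ler_peMr// lerDr mulr_ge0.
  have K1 : 0 <= 2 * c + `|K0| / 2 ^+ n.
    by rewrite addr_ge0 ?mulr_ge0// divr_ge0// exprn_ge0.
  rewrite (le_trans (step _ K1 IH _ sT))// ler_wpM2r ?expR_ge0//.
  rewrite exprS invfM; lra.
move=> s sT; rewrite leNgt; apply/negP => h.
pose E := expR (lam * s); have E0 : 0 < E by exact: expR_gt0.
pose g := phi s - 2 * c * E; have g0 : 0 < g by rewrite subr_gt0.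
pose n := Num.truncn (`|K0| * E / g).
have h1 : `|K0| * E / g < n.+1%:R by exact: truncnS_gt.
have h2 : n.+1%:R <= 2 ^+ n :> R by rewrite -natrX ler_nat ltn_expl.
have h3 : `|K0| * E < 2 ^+ n * g.
  by rewrite -ltr_pdivrMr//; exact: lt_le_trans h2.
have h4 := main n s sT.
have h5 : `|K0| / 2 ^+ n * E < g.
  by rewrite mulrAC ltr_pdivrMr ?exprn_gt0// mulrC [ltRHS]mulrC mulrC.
by move: h4; rewrite -/E mulrDl => h4; rewrite /g in h5; lra.
Qed.

Lemma finitely_covered_sub (U : Type) (P : U -> U -> Prop) (B B' : set U) :
  B' `<=` B -> finitely_covered P B -> finitely_covered P B'.
Proof.
move=> BB fB; elim: fB B' BB => {B} [B PB|B B1 B2 sB _ h1 _ h2] B' BB.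
  by apply: covered_piece => u v /BB Bu /BB; exact: PB.
apply: (@covered_union _ _ _ (B1 `&` B') (B2 `&` B')).
- by move=> u B'u; case: (sB _ (BB _ B'u)) => ?; [left|right].
- by apply: h1 => u [].
- by apply: h2 => u [].
Qed.

Lemma finitely_covered_all (U : Type) (m : nat) (P : 'I_m -> U -> U -> Prop) (B : set U) :
  (forall i, finitely_covered (P i) B) ->
  finitely_covered (fun u v => forall i, P i u v) B.
Proof.
move=> fP.
suff h (l : seq 'I_m) : finitely_covered (fun u v => forall i, i \in l -> P i u v) B.
  apply: finitely_covered_bind (h (enum 'I_m)) _ => E EB PE.
  by apply: covered_piece => u v Eu Ev i; apply: PE => //; rewrite mem_enum.
elim: l => [|i l IH]; first exact: covered_piece.
apply: finitely_covered_bind IH _ => E EB PE.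
apply: finitely_covered_bind (finitely_covered_sub EB (fP i)) _ => E' EE' PE'.
apply: covered_piece => u v Eu Ev j; rewrite inE => /predU1P[->|jl]; first exact: PE'.
by apply: PE => //; exact: EE'.
Qed.

Lemma half_pow_small (R : realType) (Q e : R) : 0 < e -> exists n, Q / 2 ^+ n < e.
Proof.
move=> e0; exists (Num.truncn (Q / e)).
rewrite ltr_pdivrMr ?exprn_gt0// mulrC -ltr_pdivrMr//.
rewrite (lt_le_trans (truncnS_gt _))// -natrX ler_nat; exact: ltn_expl.
Qed.

Lemma cvg_xget (R : realType) (cplx : bool) (X : normedModType (scalars R cplx))
    (a : nat -> X) (z : X) :
  a @ \oo --> z -> a @ \oo --> xget 0 [set y | a @ \oo --> y].
Proof.
by move=> az; apply: (@xgetPex X 0 [set y | a @ \oo --> y]); exists z.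
Qed.

Section Picard.
Context (R : realType) (cplx : bool) (X : completeNormedModType (scalars R cplx)).
Local Notation mu := (@lebesgue_measure R).
Variable S : R -> X -> X.
Hypothesis HS : C0_semigroup S.
Variables (T M : R).
Hypothesis T0 : 0 <= T.
Hypothesis M1 : 1 <= M.
Hypothesis SM : forall t x, 0 <= t <= T -> norm (S t x) <= M * norm x.
Variables (m : nat) (f : 'I_m -> R -> X -> X).
Hypothesis fc : forall i h, continuous_upto T h -> continuous_upto T (fun s => f i s (h s)).
Variables (al be : R).
Hypothesis al0 : 0 <= al.
Hypothesis be0 : 0 <= be.
Hypothesis f_growth : forall i t x, 0 <= t <= T -> norm (f i t x) <= al * norm x + be.
Hypothesis f_lip : forall r : R, exists2 L : R, 0 <= L & forall i t x y, 0 <= t <= T ->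
  norm x <= r -> norm y <= r -> norm (f i t x - f i t y) <= L * norm (x - y).
Variable xi0 : X.
Implicit Types (u v : 'I_m -> R -> R) (x y : R -> X) (omega : R -> R).

Let M0 : 0 <= M. Proof. by rewrite (le_trans _ M1). Qed.
Let TT : 0 <= T <= T. Proof. by rewrite T0 lexx. Qed.

Definition controls_mass_le omega u := forall i, mass_le T omega (u i).

Definition mild_map u x t : X :=
  S t xi0 + \sum_(i < m) convolution S (u i) (fun s => f i s (x s)) t.

Fixpoint picard u (k : nat) : R -> X :=
  if k is k'.+1 then mild_map u (picard u k') else fun t => S t xi0.

Lemma continuous_uptoD x y : continuous_upto T x -> continuous_upto T y ->
  continuous_upto T (fun t => x t + y t).
Proof.
move=> xc yc s sT e e0; have e20 : 0 < e / 2 by rewrite divr_gt0.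
have [d1 d10 h1] := xc s sT _ e20; have [d2 d20 h2] := yc s sT _ e20.
exists (Num.min d1 d2); first by rewrite lt_min d10.
move=> s' s'T; rewrite lt_min => /andP[/(h1 _ s'T) ? /(h2 _ s'T) ?].
by rewrite opprD addrACA (le_lt_trans (normD _ _))//; lra.
Qed.

Lemma continuous_uptoB x y : continuous_upto T x -> continuous_upto T y ->
  continuous_upto T (fun t => x t - y t).
Proof.
move=> xc yc; apply: continuous_uptoD => // s sT e e0.
have [d d0 hd] := yc s sT _ e0; exists d => // s' s'T /(hd _ s'T).
by rewrite -opprD normN.
Qed.

Lemma orbit_continuous (z : X) : continuous_upto T (fun t => S t z).
Proof.
move=> s sT e e0; have zc : continuous_upto T (fun=> z).
  by move=> ? _ e' e'0; exists 1 => // *; rewrite subrr norm0.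
have [d d0 hd] := semigroup_orbit_unif HS zc e0.
exists d => // s' s'T ss'; have OO : 0 <= (0 : R) <= T by rewrite lexx.
by apply: (hd 0 0) => //; rewrite subrr normr0.
Qed.

Lemma continuous_upto_sum (I : Type) (r : seq I) (h : I -> R -> X) :
  (forall i, continuous_upto T (h i)) ->
  continuous_upto T (fun t => \sum_(i <- r) h i t).
Proof.
move=> hc; elim: r => [|i r IH].
  by move=> s sT e e0; exists 1 => // *; rewrite !big_nil subrr norm0.
have -> : (fun t => \sum_(j <- i :: r) h j t) =
    (fun t => h i t + \sum_(j <- r) h j t) by apply/funext => t; rewrite big_cons.
exact: continuous_uptoD.
Qed.

Lemma mild_map_continuous omega u x : modulus omega -> controls_mass_le omega u ->
  continuous_upto T x -> continuous_upto T (mild_map u x).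
Proof.
move=> mo hu xc; apply: continuous_uptoD; first exact: orbit_continuous.
apply: continuous_upto_sum => i.
apply: (convolution_continuous HS T0 M1 SM mo (hu i)); exact: fc.
Qed.

Lemma picard_continuous omega u k : modulus omega -> controls_mass_le omega u ->
  continuous_upto T (picard u k).
Proof.
move=> mo hu; elim: k => [|k IH]; first exact: orbit_continuous.
exact: mild_map_continuous mo hu IH.
Qed.

Definition exp_bounded (lam e : R) u := forall i t, 0 <= t <= T ->
  (\int[mu]_(s in `[0%R, t]) (`|u i s| * expR (lam * s))%:E <=
   (e * expR (lam * t))%:E)%E.

(** [C] stands for a Lipschitz or growth constant. First [e] is fixed so that the [m] convolutions
    together have a factor of at most 1/2; then [lam] is found for this [e], uniformly over the
    controls with modulus [omega]. *)
Lemma exp_bounded_uniform omega (C : R) : modulus omega -> 0 <= C ->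
  exists lam e : R, [/\ 0 <= lam, 0 < e, m%:R * M * C * e <= 1 / 2 &
    forall u, controls_mass_le omega u -> exp_bounded lam e u].
Proof.
move=> mo C0; pose D := m%:R * M * C + 1.
have D0 : 0 < D by rewrite ltr_wpDl// !mulr_ge0.
have e0 : 0 < 1 / 2 / D by rewrite !divr_gt0.
have [lam lam0 hl] := mass_le_exp_weight T0 mo e0.
exists lam, (1 / 2 / D); split=> //.
  by rewrite mulrA ler_pdivrMr// /D; lra.
by move=> u hu i t tT; exact: hl.
Qed.

Lemma mild_map_diff omega u x y (r L c lam e t : R) : controls_mass_le omega u ->
  exp_bounded lam e u -> continuous_upto T x -> continuous_upto T y ->
  0 <= L -> 0 <= c ->
  (forall i s (a b : X), 0 <= s <= T ->
    norm a <= r -> norm b <= r -> norm (f i s a - f i s b) <= L * norm (a - b)) ->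
  (forall s, 0 <= s <= T -> norm (x s) <= r) ->
  (forall s, 0 <= s <= T -> norm (y s) <= r) ->
  (forall s, 0 <= s <= T -> norm (x s - y s) <= c * expR (lam * s)) ->
  0 <= t <= T ->
  norm (mild_map u x t - mild_map u y t) <= m%:R * M * L * e * c * expR (lam * t).
Proof.
move=> hu he xc yc L0 c0 lip xr yr xy tT.
rewrite /mild_map opprD addrACA subrr add0r -sumrB.
rewrite (_ : m%:R * M * L * e * c * expR (lam * t) =
  m%:R * (M * (L * c) * e * expR (lam * t))); last by ring.
apply: norm_sum_ord_le => i.
have hc := continuous_uptoB (fc i xc) (fc i yc).
rewrite (convolutionBr HS M1 SM (hu i) (fc i xc) (fc i yc) hc tT).
apply: (norm_convolution_exp HS M1 SM (hu i) hc tT); first exact: mulr_ge0.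
  move=> s /andP[s0 st]; have sT : 0 <= s <= T.
    by rewrite s0 (le_trans st)//; case/andP: tT.
  rewrite (le_trans (lip _ _ _ _ sT (xr _ sT) (yr _ sT)))// -mulrA ler_wpM2l//.
  exact: xy.
exact: he.
Qed.

Lemma mild_map_growth omega u x (c lam e t : R) : controls_mass_le omega u ->
  0 <= lam -> exp_bounded lam e u -> continuous_upto T x -> 0 <= c ->
  (forall s, 0 <= s <= T -> norm (x s) <= c * expR (lam * s)) -> 0 <= t <= T ->
  norm (mild_map u x t) <=
    (M * norm xi0 + m%:R * M * (al * c + be) * e) * expR (lam * t).
Proof.
move=> hu lam0 he xc c0 xle tT.
have E1 s : 0 <= s -> 1 <= expR (lam * s).
  by move=> s0; apply: le_trans (expR_ge1Dx _); rewrite lerDl mulr_ge0.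
rewrite (le_trans (normD _ _))// mulrDl; apply: lerD.
  rewrite (le_trans (SM _ tT))// ler_peMr ?mulr_ge0 ?norm_ge0//.
  by apply: E1; case/andP: tT.
rewrite (_ : _ * expR (lam * t) = m%:R * (M * (al * c + be) * e * expR (lam * t))); last by ring.
apply: norm_sum_ord_le => i.
apply: (norm_convolution_exp HS M1 SM (hu i) (fc i xc) tT).
- by rewrite addr_ge0// mulr_ge0.
- move=> s /andP[s0 st]; have sT : 0 <= s <= T.
    by rewrite s0 (le_trans st)//; case/andP: tT.
  rewrite (le_trans (f_growth _ _ sT))// mulrDl -mulrA lerD ?ler_wpM2l ?xle//.
  by rewrite ler_peMr// E1.
- exact: he.
Qed.

Lemma picard_bounded omega : modulus omega -> exists r : R,
  forall u, controls_mass_le omega u -> forall k t, 0 <= t <= T -> norm (picard u k t) <= r.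
Proof.
move=> mo; have [|lam [e [lam0 e0 he hexp]]] := @exp_bounded_uniform omega (al + 1) mo.
  by rewrite addr_ge0.
(* The ball of radius [c] in the weighted norm is invariant: since [be <= c], the growth term is at
   most [(al + 1) c], which the factor 1/2 reduces to [c / 2], and [M * norm xi0 + c / 2 <= c]. *)
pose c := 2 * (M * norm xi0) + be.
have Mx0 : 0 <= M * norm xi0 by rewrite mulr_ge0// norm_ge0.
have c0 : 0 <= c by rewrite addr_ge0// mulr_ge0.
exists (c * expR (lam * T)) => u hu k t tT.
rewrite (@le_trans _ _ (c * expR (lam * t)))//; last first.
  by rewrite ler_wpM2l// ler_expR ler_wpM2l//; case/andP: tT.
elim: k t tT => [|k IH] t tT.
  rewrite (le_trans (SM _ tT))// (@le_trans _ _ c)//.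
    by rewrite ler_wpDr// ler_peMl// ler1n.
  rewrite ler_peMr//; apply: le_trans (expR_ge1Dx _).
  by rewrite lerDl mulr_ge0//; case/andP: tT.
have pc := picard_continuous k mo hu.
rewrite (le_trans (mild_map_growth hu lam0 (hexp u hu) pc c0 IH tT))//.
rewrite ler_wpM2r ?expR_ge0//.
have h1 : m%:R * M * (al * c + be) * e <= m%:R * M * (al + 1) * e * c.
  rewrite (_ : m%:R * M * (al * c + be) * e = (m%:R * M * e) * (al * c + be)); last by ring.
  rewrite (_ : m%:R * M * (al + 1) * e * c = (m%:R * M * e) * (al * c + c)); last by ring.
  rewrite ler_wpM2l ?mulr_ge0 ?(ltW e0)//.
  by rewrite lerD2l /c lerDr mulr_ge0.
have h2 : m%:R * M * (al + 1) * e * c <= 1 / 2 * c by rewrite ler_wpM2r.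
by rewrite (le_trans (lerD (lexx _) (le_trans h1 h2)))// /c; have := be0; lra.
Qed.

Lemma picard_lim_cauchy omega : modulus omega -> exists2 Q : R, 0 <= Q &
  forall u, controls_mass_le omega u -> forall k j t, 0 <= t <= T ->
    norm (picard u (k + j) t - picard u k t) <= Q / 2 ^+ k.
Proof.
move=> mo; have [r hr] := picard_bounded mo.
have [L L0 lip] := f_lip r.
have [lam [e [lam0 e0 he hexp]]] := @exp_bounded_uniform omega L mo L0.
pose D := 2 * `|r|; have D0 : 0 <= D by rewrite mulr_ge0.
have expT t : 0 <= t <= T -> expR (lam * t) <= expR (lam * T).
  by move=> /andP[_ tT]; rewrite ler_expR ler_wpM2l.
exists (2 * D * expR (lam * T)); first by rewrite !mulr_ge0 ?expR_ge0.
move=> u hu.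
have step k t : 0 <= t <= T -> norm (picard u k.+1 t - picard u k t) <=
    D / 2 ^+ k * expR (lam * t).
  elim: k t => [|k IH] t tT.
    rewrite divr1 (@le_trans _ _ D)//.
      rewrite (le_trans (norm_sub _ _))//; have := hr u hu 0%N t tT.
      have := hr u hu 1%N t tT; have := ler_norm r; rewrite /D; lra.
    rewrite ler_peMr//; apply: le_trans (expR_ge1Dx _).
    by rewrite lerDl mulr_ge0//; case/andP: tT.
  have c0 : 0 <= D / 2 ^+ k by rewrite divr_ge0// exprn_ge0.
  rewrite (le_trans (mild_map_diff hu (hexp u hu) (picard_continuous _ mo hu)
    (picard_continuous _ mo hu) L0 c0 lip (hr u hu k.+1) (hr u hu k) IH tT))//.
  rewrite ler_wpM2r ?expR_ge0// exprS invfM mulrCA -mulrA.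
  rewrite ler_wpM2l// ler_wpM2r ?invr_ge0 ?exprn_ge0// mulrA.
  by rewrite -(div1r 2).
move=> k j t tT.
(* Writing the bound as a difference of two powers makes the geometric sum telescope in the
   induction on [j]. *)
have main : norm (picard u (k + j) t - picard u k t) <=
    2 * D * expR (lam * t) * ((2 ^+ k)^-1 - (2 ^+ (k + j))^-1).
  elim: j => [|j IHj]; first by rewrite addn0 !subrr norm0 mulr0.
  rewrite (le_trans (norm_triangle (picard u (k + j) t) _ _))// addnS.
  have := step (k + j)%N t tT; rewrite exprS invfM => h.
  rewrite (le_trans (lerD h IHj))// le_eqVlt; apply/orP; left; apply/eqP.
  by field; rewrite !expf_neq0.
rewrite (le_trans main)// ler_pM//.
- by rewrite !mulr_ge0 ?expR_ge0.
- by rewrite subr_ge0 lef_pV2 ?posrE ?exprn_gt0// ler_weXn2l ?leq_addr// ler1n.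
- by rewrite ler_wpM2l ?mulr_ge0// expT.
- by rewrite gerBl invr_ge0 exprn_ge0.
Qed.

Definition mild_flow u t : X :=
  xget 0 [set z | (fun k => picard u k t) @ \oo --> z].

(** The rate depends neither on [u] nor on [t]; this lets continuity, boundedness and total
    boundedness pass from the iterates to the limit. *)
Lemma picard_mild_flow omega : modulus omega -> exists2 Q : R, 0 <= Q &
  forall u, controls_mass_le omega u -> forall k t, 0 <= t <= T ->
    norm (picard u k t - mild_flow u t) <= Q / 2 ^+ k.
Proof.
move=> mo; have [Q Q0 hQ] := picard_lim_cauchy mo.
exists Q => // u hu k t tT.
have [z hz] : exists z : X, picard u k t @[k --> \oo] --> z.
  apply: cauchy_norm_cvg => e e0; have e20 : 0 < e / 2 by rewrite divr_gt0.
  have [n hn] := half_pow_small Q e20.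
  exists [set y | exists2 k, (n <= k)%N & y = picard u k t].
    by exists n => // k' /= nk; exists k'.
  move=> _ _ [i ni ->] [j nj ->].
  rewrite (le_trans (norm_triangle (picard u n t) _ _))//.
  have h1 := hQ u hu n (i - n)%N t tT; have h2 := hQ u hu n (j - n)%N t tT.
  by rewrite !subnKC// in h1 h2; rewrite (normB (picard u n t)); lra.
have flowE : (fun j => picard u j t) @ \oo --> mild_flow u t by exact: cvg_xget hz.
rewrite normB; apply: (@norm_lim_le _ _ _ (fun j => picard u (j + k)%N t - picard u k t)).
  by apply: cvgB; [rewrite (cvg_shiftn k (fun j => picard u j t))|exact: cvg_cst].
by move=> j; rewrite addnC hQ.
Qed.

Lemma mild_flow_continuous omega u : modulus omega -> controls_mass_le omega u ->
  continuous_upto T (mild_flow u).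
Proof.
move=> mo hu s sT e e0; have [Q Q0 hQ] := picard_mild_flow mo.
have e30 : 0 < e / 3 by rewrite divr_gt0.
have [n hn] := half_pow_small Q e30.
have [d d0 hd] := picard_continuous n mo hu sT e30.
exists d => // s' s'T ss'; have h1 := hd s' s'T ss'.
have h2 := hQ u hu n s sT; have h3 := hQ u hu n s' s'T.
rewrite (le_lt_trans (norm_triangle (picard u n s') _ _))//.
have := norm_triangle (picard u n s) (picard u n s') (mild_flow u s).
rewrite (normB (mild_flow u s')); lra.
Qed.

Lemma mild_flow_bounded omega : modulus omega -> exists r : R,
  forall u, controls_mass_le omega u -> forall t, 0 <= t <= T -> norm (mild_flow u t) <= r.
Proof.
move=> mo; have [r hr] := picard_bounded mo; have [Q Q0 hQ] := picard_mild_flow mo.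
exists (r + Q) => u hu t tT.
have := hr u hu 0%N t tT; have := hQ u hu 0%N t tT; rewrite divr1 normB.
have := norm_le_sub (mild_flow u t) (picard u 0 t); lra.
Qed.

Lemma mild_flow_fixed omega u t : modulus omega -> controls_mass_le omega u ->
  0 <= t <= T -> mild_flow u t = mild_map u (mild_flow u) t.
Proof.
move=> mo hu tT; have [Q Q0 hQ] := picard_mild_flow mo.
have [r1 hr1] := picard_bounded mo; have [r2 hr2] := mild_flow_bounded mo.
pose r := Num.max r1 r2; have [L L0 lip] := f_lip r.
have [lam [e [lam0 e0 he hexp]]] := @exp_bounded_uniform omega L mo L0.
have fcont := mild_flow_continuous mo hu.
have pr k s : 0 <= s <= T -> norm (picard u k s) <= r.
  by move=> sT; rewrite le_max hr1.
have fr s : 0 <= s <= T -> norm (mild_flow u s) <= r.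
  by move=> sT; rewrite le_max hr2 ?orbT.
have step k : norm (mild_map u (picard u k) t - mild_map u (mild_flow u) t) <=
    Q / 2 ^+ k * expR (lam * t).
  have c0 : 0 <= Q / 2 ^+ k by rewrite divr_ge0// exprn_ge0.
  have hk s : 0 <= s <= T ->
      norm (picard u k s - mild_flow u s) <= Q / 2 ^+ k * expR (lam * s).
    move=> sT; rewrite (le_trans (hQ u hu k s sT))// ler_peMr//.
    apply: le_trans (expR_ge1Dx _); rewrite lerDl mulr_ge0//.
    by case/andP: sT.
  rewrite (le_trans (mild_map_diff hu (hexp u hu) (picard_continuous _ mo hu)
    fcont L0 c0 lip (pr k) fr hk tT))//.
  rewrite ler_wpM2r ?expR_ge0// ler_piMl//; lra.
(* The map sends iterate [n] to iterate [n + 1], so the defect of the limit is at most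
   [(1 + exp (lam t)) Q / 2 ^ n] for every [n]. *)
apply/eqP; rewrite -subr_eq0; apply/eqP/norm_le0; rewrite leNgt; apply/negP => h.
pose E := 1 + expR (lam * t); have E0 : 0 < E by rewrite addr_gt0// expR_gt0.
have hE : 0 < norm (mild_flow u t - mild_map u (mild_flow u) t) / E by rewrite divr_gt0.
have [n hn] := half_pow_small Q hE.
rewrite ltr_pdivlMr// in hn.
have h1 := hQ u hu n.+1 t tT; have h2 := step n.
have h3 := norm_triangle (picard u n.+1 t) (mild_flow u t) (mild_map u (mild_flow u) t).
have h4 : Q / 2 ^+ n.+1 <= Q / 2 ^+ n.
  by rewrite ler_wpM2l// lef_pV2 ?posrE ?exprn_gt0// ler_weXn2l// ler1n.
rewrite normB in h1; rewrite /E mulrDr mulr1 in hn.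
have := le_lt_trans (le_trans h3 (lerD (le_trans h1 h4) h2)) hn.
by rewrite ltxx.
Qed.

(** Two continuous solutions lie in a common ball, and (A1) on that ball makes the map halve their
    weighted distance; [absorb_half] with [c = 0] leaves no distance at all. *)
Lemma mild_fixed_unique omega u x y : modulus omega -> controls_mass_le omega u ->
  continuous_upto T x -> continuous_upto T y ->
  (forall t, 0 <= t <= T -> x t = mild_map u x t) ->
  (forall t, 0 <= t <= T -> y t = mild_map u y t) ->
  forall t, 0 <= t <= T -> x t = y t.
Proof.
move=> mo hu xc yc xE yE.
have [K1 K10 hK1] := continuous_upto_bounded xc.
have [K2 K20 hK2] := continuous_upto_bounded yc.
pose r := Num.max K1 K2; have [L L0 lip] := f_lip r.
have [lam [e [lam0 e0 he hexp]]] := @exp_bounded_uniform omega L mo L0.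
have xr s : 0 <= s <= T -> norm (x s) <= r by move=> sT; rewrite le_max hK1.
have yr s : 0 <= s <= T -> norm (y s) <= r by move=> sT; rewrite le_max hK2 ?orbT.
move=> t tT; apply/eqP; rewrite -subr_eq0; apply/eqP/norm_le0.
have := @absorb_half R T lam 0 (K1 + K2) (fun s => norm (x s - y s)) lam0 (lexx _).
rewrite mulr0 => /(_ _ _ t tT); rewrite mul0r; apply.
  by move=> s sT; rewrite (le_trans (norm_sub _ _))// lerD ?hK1 ?hK2.
move=> K K0 hK s sT; rewrite xE// yE//.
rewrite (le_trans (mild_map_diff hu (hexp u hu) xc yc L0 K0 lip xr yr hK sT))//.
by rewrite ler_wpM2r ?expR_ge0// add0r mulrC ler_wpM2l//; lra.
Qed.

(** The difference of the fixed points splits into a change of the state under one control, which is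
    halved in the weighted distance, and a change of the control at a fixed state, bounded by
    [m M G d] with [G] a bound of the fields along the flow. Here [d] bounds the [L^1] distance of
    the components. *)
Lemma mild_flow_lipschitz omega : modulus omega -> exists2 k : R, 0 < k &
  forall u v (d : R), controls_mass_le omega u -> controls_mass_le omega v -> 0 <= d ->
    (forall i, (\int[mu]_(s in `[0%R, T]) `|u i s - v i s|%:E <= d%:E)%E) ->
    forall t, 0 <= t <= T -> norm (mild_flow u t - mild_flow v t) <= k * d.
Proof.
move=> mo; have [r hr] := mild_flow_bounded mo.
have [L L0 lip] := f_lip r.
have [lam [e [lam0 e0 he hexp]]] := @exp_bounded_uniform omega L mo L0.
pose G := al * `|r| + be; have G0 : 0 <= G by rewrite addr_ge0// mulr_ge0.
exists (2 * (m%:R * (M * G)) * expR (lam * T) + 1).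
  by rewrite ltr_wpDl// !mulr_ge0 ?expR_ge0.
move=> u v d hu hv d0 uv.
have uc := mild_flow_continuous mo hu; have vc := mild_flow_continuous mo hv.
pose c := m%:R * (M * G * d); have c0 : 0 <= c by rewrite !mulr_ge0.
have vG i s : 0 <= s <= T -> norm (f i s (mild_flow v s)) <= G.
  move=> sT; rewrite (le_trans (f_growth _ _ sT))// lerD2r ler_wpM2l//.
  by rewrite (le_trans (hr v hv s sT))// ler_norm.
have main : forall s, 0 <= s <= T ->
    norm (mild_flow u s - mild_flow v s) <= 2 * c * expR (lam * s).
  apply: (@absorb_half R T lam c (r + r)) => //.
    by move=> s sT; rewrite (le_trans (norm_sub _ _))// lerD ?hr.
  move=> K K0 hK s sT; rewrite mulrDl.
  rewrite (mild_flow_fixed mo hu sT) (mild_flow_fixed mo hv sT).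
  rewrite (le_trans (norm_triangle (mild_map u (mild_flow v) s) _ _))// addrC lerD//.
    rewrite /mild_map opprD addrACA subrr add0r -sumrB.
    apply: (@le_trans _ _ c).
      apply: norm_sum_ord_le => i.
      rewrite (convolutionBl HS M1 SM (hu i) (hv i) (fc i vc) sT).
      apply: (norm_convolution_mass HS M1 SM (mass_le_sub (hu i) (hv i)) (fc i vc) sT G0).
        exact: vG.
      exact: uv.
    rewrite ler_peMr//; apply: le_trans (expR_ge1Dx _).
    by rewrite lerDl mulr_ge0//; case/andP: sT.
  rewrite (le_trans (mild_map_diff hu (hexp u hu) uc vc L0 K0 lip (hr u hu) (hr v hv) hK sT))//.
  by rewrite ler_wpM2r ?expR_ge0// mulrC ler_wpM2l//; lra.
move=> t tT; rewrite (le_trans (main t tT))// [leRHS]mulrDl mul1r.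
rewrite ler_wpDr// (_ : _ * d = 2 * c * expR (lam * T)); last by rewrite /c; ring.
by rewrite ler_wpM2l ?mulr_ge0// ler_expR ler_wpM2l//; case/andP: tT.
Qed.

Lemma picard_finitely_covered (B : set ('I_m -> R -> R)) omega k (e : R) :
  modulus omega -> (forall u, B u -> controls_mass_le omega u) -> 0 < e ->
  finitely_covered (fun u v => forall t, 0 <= t <= T ->
    norm (picard u k t - picard v k t) <= e) B.
Proof.
move=> mo hB; elim: k e => [|k IH] e e0.
  (* The starting curve [S t xi0] does not depend on the control. *)
  by apply: covered_piece => u v _ _ t _; rewrite subrr norm0 ltW.
have [r hr] := picard_bounded mo; have [L L0 lip] := f_lip r.
(* The map amplifies errors of the state by at most [m M L omega(T)]; this fixes the accuracy
   required of the preceding iterate. *)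
pose D := m%:R * (M * L * `|omega T|) + 1.
have D0 : 0 < D by rewrite ltr_wpDl// !mulr_ge0.
have m1 : 0 < m%:R + 1 :> R by rewrite ltr_wpDl.
have d0 : 0 < e / 3 / D by rewrite !divr_gt0.
have d1 : 0 < e / 3 / (m%:R + 1) by rewrite !divr_gt0.
apply: finitely_covered_bind (IH _ d0) _ => E EB PE.
(* A representative of the piece: its curve [f i s (picard w k s)] replaces those of all other
   members, so that only the control varies in the convolutions to be covered. *)
have [[w Ew]|nE] := pselect (exists w, E w); last first.
  by apply: covered_piece => u v Eu; exfalso; apply: nE; exists u.
have pc u : B u -> continuous_upto T (picard u k).
  by move=> Bu; exact: picard_continuous mo (hB u Bu).
have hw := hB _ (EB _ Ew); have wc := pc _ (EB _ Ew).
have cov : finitely_covered (fun u v => forall i t, 0 <= t <= T ->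
    norm (convolution S (u i) (fun s => f i s (picard w k s)) t -
          convolution S (v i) (fun s => f i s (picard w k s)) t) <= e / 3 / (m%:R + 1)) E.
  apply: finitely_covered_all => i.
  apply: (convolution_finitely_covered HS T0 M1 SM mo _ (fc i wc) d1).
  by move=> u /EB /hB.
apply: finitely_covered_bind cov _ => E' EE' PE'.
have near_w u t : E' u -> 0 <= t <= T ->
    norm (mild_map u (picard u k) t - mild_map u (picard w k) t) <= e / 3.
  move=> E'u tT; have Eu := EE' _ E'u; have hu := hB _ (EB _ Eu).
  have uc := pc _ (EB _ Eu).
  rewrite /mild_map opprD addrACA subrr add0r -sumrB.
  apply: (@le_trans _ _ (m%:R * (M * (L * (e / 3 / D)) * omega T))).
    apply: norm_sum_ord_le => i.
    have hc := continuous_uptoB (fc i uc) (fc i wc).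
    rewrite (convolutionBr HS M1 SM (hu i) (fc i uc) (fc i wc) hc tT).
    apply: (norm_convolution_mass HS M1 SM (hu i) hc tT).
    - by rewrite mulr_ge0// ltW.
    - move=> s sT; rewrite (le_trans (lip _ _ _ _ sT (hr u hu k s sT) (hr w hw k s sT)))//.
      by rewrite ler_wpM2l// PE.
    - exact: mass_fin (hu i) TT.
  rewrite (_ : _ * _ = e / 3 / D * (m%:R * (M * L * omega T))); last by ring.
  rewrite -{2}(divfK (lt0r_neq0 D0) (e / 3)) ler_wpM2l ?(ltW d0)// /D.
  rewrite (@le_trans _ _ (m%:R * (M * L * `|omega T|)))// ?lerDl//.
  by rewrite ler_wpM2l// ler_wpM2l ?mulr_ge0// ler_norm.
apply: covered_piece => u v E'u E'v t tT.
have h1 := near_w u t E'u tT; have h2 := near_w v t E'v tT.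
have h3 : norm (mild_map u (picard w k) t - mild_map v (picard w k) t) <= e / 3.
  rewrite /mild_map opprD addrACA subrr add0r -sumrB.
  apply: (@le_trans _ _ (m%:R * (e / 3 / (m%:R + 1)))).
    by apply: norm_sum_ord_le => i; exact: PE'.
  rewrite mulrC -[leRHS](divfK (lt0r_neq0 m1)) ler_wpM2l ?(ltW d1)// lerDl.
  by [].
have h4 := norm_triangle (mild_map u (picard w k) t)
  (mild_map u (picard u k) t) (mild_map v (picard v k) t).
have h5 := norm_triangle (mild_map v (picard w k) t)
  (mild_map u (picard w k) t) (mild_map v (picard v k) t).
rewrite normB in h2.
have h6 := le_trans h4 (lerD h1 (le_trans h5 (lerD h3 h2))).
have -> : e = e / 3 + (e / 3 + e / 3) by field.
exact: h6.
Qed.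

Lemma mild_flow_finitely_covered (B : set ('I_m -> R -> R)) omega (e : R) :
  modulus omega -> (forall u, B u -> controls_mass_le omega u) -> 0 < e ->
  finitely_covered (fun u v => forall t, 0 <= t <= T ->
    norm (mild_flow u t - mild_flow v t) <= e) B.
Proof.
move=> mo hB e0; have [Q Q0 hQ] := picard_mild_flow mo.
have e30 : 0 < e / 3 by rewrite divr_gt0.
have [n hn] := half_pow_small Q e30.
apply: finitely_covered_bind (picard_finitely_covered n mo hB e30) _ => E EB PE.
apply: covered_piece => u v Eu Ev t tT.
have h1 := hQ u (hB _ (EB _ Eu)) n t tT; have h2 := hQ v (hB _ (EB _ Ev)) n t tT.
have h3 := PE u v Eu Ev t tT.
have h4 := norm_triangle (picard u n t) (mild_flow u t) (mild_flow v t).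
have h5 := norm_triangle (picard v n t) (picard u n t) (mild_flow v t).
by rewrite (normB (mild_flow u t) (picard u n t)) in h4; lra.
Qed.

End Picard.

(** * From the assumptions to the solution operator *)

Section EverywhereBounds.
Context (R : realType) (cplx : bool) (X : normedModType (scalars R cplx)).

Lemma le_all_eps (a b : R) : (forall e, 0 < e -> a <= b + e) -> a <= b.
Proof.
move=> h; rewrite leNgt; apply/negP => ab.
have e0 : 0 < (a - b) / 2 by lra.
by have := h _ e0; lra.
Qed.

(** A null set contains no interval of positive length; points to the right of [t] stay in the time
    domain [[0, oo)]. *)
Lemma ae_right (P : R -> Prop) (t d : R) :
  {ae lebesgue_measure, forall s, P s} -> 0 < d ->
  exists s, [/\ t < s, s < t + d & P s].
Proof.
move=> [N [mN N0 PN]] d0; apply: contrapT => h.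
have sub : `]t, (t + d)[%classic `<=` (N : set R).
  move=> s /=; rewrite in_itv /= => /andP[ts st]; apply: PN => Ps.
  by apply: h; exists s.
have muE : lebesgue_measure (`]t, (t + d)[%classic : set R) = d%:E.
  by rewrite lebesgue_measure_itv /= lte_fin ltrDl d0 -EFinD addrAC subrr add0r.
have : (lebesgue_measure (`]t, (t + d)%R[%classic : set R) <= lebesgue_measure (N : set R))%E.
  by apply: le_measure; rewrite ?inE.
by rewrite muE N0 lee_fin leNgt d0.
Qed.

Lemma continuous_fieldP (f : R -> X -> X) : continuous_field f ->
  forall t x, 0 <= t -> forall e : R, 0 < e -> exists2 d : R, 0 < d &
    forall t' x', 0 <= t' -> `|t' - t| < d -> norm (x' - x) < d ->
      norm (f t' x' - f t x) < e.
Proof.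
move=> /subspace_continuousP fcont t x t0 e e0.
have /(cvg_normP _ _ _).1 /(_ e e0) := fcont (t, x) t0.
move=> [[P Q] [/= nP nQ] PQ].
have /nbhs_ballP[d1 /= d10 hP] := nP.
have [d2 d20 hQ] := (nbhs_norm_realP x Q).1 nQ.
exists (Num.min d1 d2); first by rewrite lt_min d10.
move=> t' x' t'0; rewrite !lt_min => /andP[h1 _] /andP[_ h2].
apply: (PQ (t', x')) => //; split; last exact: hQ.
by apply: hP; rewrite /ball /= distrC.
Qed.

(** Points near [t <= T] may exceed [T], so the essential bound is taken on [[0, T + 1]]. Good times
    arbitrarily close to [t] are enough, as the fields are continuous. *)
Lemma Linfty_bound (L : R -> R) (T : R) : Linfty_loc_nneg L -> exists2 K : R, 0 <= K &
  forall t d, 0 <= t <= T -> 0 < d ->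
    exists s, [/\ 0 <= s, `|s - t| < d & L s <= K].
Proof.
move=> [_ _ /(_ (T + 1))[K hK]]; exists `|K| => // t d /andP[t0 tT] d0.
have d'0 : 0 < Num.min d 1 by rewrite lt_min d0 ltr01.
have [s [ts st hs]] := ae_right t hK d'0.
have [sd s1] : s < t + d /\ s < t + 1.
  by split; apply: (lt_le_trans st); rewrite lerD2l ge_min lexx ?orbT.
exists s; split; first by lra.
- by rewrite gtr0_norm ?subr_gt0//; lra.
- by rewrite (le_trans (hs _)) ?ler_norm//; lra.
Qed.

(** The bound holds with constants at good times [s] arbitrarily near [t]; continuity of the field
    in time carries it to [t] at the price of an arbitrary [e]. *)
Lemma field_growth (f : R -> X -> X) (T : R) : continuous_field f ->
  assumption_A2 f -> exists a b : R, [/\ 0 <= a, 0 <= b &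
    forall t x, 0 <= t <= T -> norm (f t x) <= a * norm x + b].
Proof.
move=> fcont [al [be [hal hbe fle]]].
(* [al] and [be] must be bounded at the same time [s], so their two exceptional null sets are
   united. *)
have [K K0 hK] : exists2 K : R, 0 <= K & forall t d, 0 <= t <= T -> 0 < d ->
    exists s, [/\ 0 <= s, `|s - t| < d, al s <= K & be s <= K].
  have [_ _ /(_ (T + 1))[K1 hK1]] := hal; have [_ _ /(_ (T + 1))[K2 hK2]] := hbe.
  exists (Num.max `|K1| `|K2|); first by rewrite le_max normr_ge0.
  move=> t d /andP[t0 tT] d0.
  have d'0 : 0 < Num.min d 1 by rewrite lt_min d0 ltr01.
  have hK : {ae lebesgue_measure, forall s : R,
      (0 <= s <= T + 1 -> al s <= K1) /\ (0 <= s <= T + 1 -> be s <= K2)}.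
    by apply: (negligibleS _ (negligibleU hK1 hK2)) => s /= /not_andP.
  have [s [ts st [h1 h2]]] := ae_right t hK d'0.
  have [sd s1] : s < t + d /\ s < t + 1.
    by split; apply: (lt_le_trans st); rewrite lerD2l ge_min lexx ?orbT.
  have sT : 0 <= s <= T + 1 by apply/andP; split; lra.
  exists s; split.
  - by lra.
  - by rewrite gtr0_norm ?subr_gt0//; lra.
  - by rewrite (le_trans (h1 sT))// le_max ler_norm.
  - by rewrite (le_trans (h2 sT))// le_max ler_norm orbT.
exists K, K; split=> // t x tT; apply: le_all_eps => e e0.
have t0 : 0 <= t by case/andP: tT.
have [d d0 hd] := continuous_fieldP fcont x t0 e0.
have [s [s0 sd alK beK]] := hK t d tT d0.
have h1 : norm (f s x - f t x) < e by apply: hd; rewrite ?subrr ?norm0.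
have h2 := norm_le_sub (f t x) (f s x); rewrite normB in h2.
have h3 := fle s x s0.
have h4 : al s * norm x <= K * norm x by rewrite ler_wpM2r ?norm_ge0.
lra.
Qed.

Lemma field_lipschitz (f : R -> X -> X) (T r : R) : continuous_field f ->
  assumption_A1 f -> exists2 L : R, 0 <= L & forall t x y, 0 <= t <= T ->
    norm x <= r -> norm y <= r -> norm (f t x - f t y) <= L * norm (x - y).
Proof.
move=> fcont /(_ [set x | norm x <= r])[].
  exists (emb cplx r); split.
    by rewrite realE -(@emb0 R cplx) !emb_le le_total.
  move=> K rK x /= xr; apply: le_trans (ltW rK).
  by rewrite -normE emb_le.
move=> L hL Llip; have [K K0 hK] := Linfty_bound T hL.
exists K => // t x y tT xr yr; apply: le_all_eps => e e0.
have t0 : 0 <= t by case/andP: tT.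
have e20 : 0 < e / 2 by rewrite divr_gt0.
have [d1 d10 hd1] := continuous_fieldP fcont x t0 e20.
have [d2 d20 hd2] := continuous_fieldP fcont y t0 e20.
have d0 : 0 < Num.min d1 d2 by rewrite lt_min d10.
have [s [s0]] := hK t _ tT d0; rewrite lt_min => /andP[sd1 sd2] LK.
have h1 : norm (f s x - f t x) < e / 2 by apply: hd1; rewrite ?subrr ?norm0.
have h2 : norm (f s y - f t y) < e / 2 by apply: hd2; rewrite ?subrr ?norm0.
have h3 := Llip s x y s0 xr yr.
have h4 : L s * norm (x - y) <= K * norm (x - y) by rewrite ler_wpM2r ?norm_ge0.
have h5 := norm_triangle (f s x) (f t x) (f t y).
have h6 := norm_triangle (f s y) (f s x) (f t y).
rewrite normB in h1; lra.
Qed.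

Lemma field_continuous_upto (f : R -> X -> X) (T : R) (h : R -> X) :
  continuous_field f -> continuous_upto T h -> continuous_upto T (fun s => f s (h s)).
Proof.
move=> fcont hc s sT e e0; have s0 : 0 <= s by case/andP: sT.
have [d d0 hd] := continuous_fieldP fcont (h s) s0 e0.
have [d' d'0 hd'] := hc s sT d d0.
exists (Num.min d d'); first by rewrite lt_min d0.
move=> s' s'T; rewrite lt_min => /andP[h1 h2].
by apply: hd => //; [case/andP: s'T|exact: hd'].
Qed.

End EverywhereBounds.

(** * Mass bounds for controls in [L^p] *)

Section ControlMass.
Context (R : realType) (m : nat).
Local Notation mu := (@lebesgue_measure R).
Implicit Types (u v : 'I_m -> R -> R) (T : R).

Lemma Lp_measurable T (p : \bar R) u i : Lp T p u -> measurable_fun setT (u i).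
Proof. by move=> /(_ i) /andP[/[!inE]]. Qed.

Lemma measurable_euclidean_norm u : (forall i, measurable_fun setT (u i)) ->
  measurable_fun setT (fun t => Num.sqrt (\sum_(i < m) u i t ^+ 2)).
Proof.
move=> mu_; apply: (@measurableT_comp _ _ _ _ _ _ (@Num.sqrt R)).
  by apply: continuous_measurable_fun; exact: sqrt_continuous.
by apply: measurable_sum => i; exact: measurable_funX.
Qed.

Lemma abs_le_euclidean_norm u i t : `|u i t| <= Num.sqrt (\sum_(j < m) u j t ^+ 2).
Proof.
rewrite -sqrtr_sqr ler_wsqrtr// (bigD1 i)//= lerDl.
by apply: sumr_ge0 => j _; exact: sqr_ge0.
Qed.

(** The first form is uniform on bounded sets and also applies to differences of controls. The
    second assigns a finite constant to a single control; it uses the norms of the components, whose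
    finiteness is what membership in [Lp] asserts. *)
Lemma hoelder_controls (p : \bar R) : (1 < p)%E -> exists2 theta : R, 0 < theta &
  (forall T u, (forall i, measurable_fun setT (u i)) ->
    forall i a b, 0 <= a -> a <= b -> b <= T ->
    (\int[mu]_(s in `[a, b]) `|u i s|%:E <=
     ((b - a) `^ theta)%:E * Lp_norm T p u)%E) /\
  forall T u, Lp T p u -> exists C : R,
    forall i, mass_le T (fun h => C * h `^ theta) (u i).
Proof.
move=> p1; have [theta th0 H] := hoelder_segment p1; exists theta => //; split.
  move=> T u mu_ i a b a0 ab bT.
  have mn := measurable_euclidean_norm mu_.
  apply: (le_trans _ (H T a b _ mn a0 ab bT)); apply: ge0_le_integral => //.
  - exact: measurable_abs_EFin.
  - exact: measurable_abs_EFin.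
  - move=> s _; rewrite lee_fin (le_trans (abs_le_euclidean_norm _ _ _))//.
    exact: ler_norm.
move=> T u Lu; exists (\sum_(i < m) fine (Lnorm (leb T) p (EFin \o u i))) => i.
have mu_ := Lp_measurable i Lu; split=> // a b a0 ab bT.
apply: (le_trans (H T a b _ mu_ a0 ab bT)).
have fin : (Lnorm (leb T) p (EFin \o u i) \is a fin_num)%E.
  rewrite ge0_fin_numE ?Lnorm_ge0//.
  by have := Lu i => /andP[_ /[!inE]].
rewrite -(fineK fin) -EFinM lee_fin mulrC ler_wpM2r ?powR_ge0//.
rewrite (bigD1 i)//= lerDl; apply: sumr_ge0 => j _.
by rewrite fine_ge0// Lnorm_ge0.
Qed.

Lemma mass_leN T (omega v : R -> R) : mass_le T omega v -> mass_le T omega (fun s => - v s).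
Proof.
move=> [mv hv]; split; first exact: measurableT_comp.
by move=> a b a0 ab bT; under eq_integral do rewrite normrN; exact: hv.
Qed.

Lemma mass_le_of_sub T (omega1 omega2 u v : R -> R) :
  mass_le T omega1 (fun s => u s - v s) -> mass_le T omega2 v ->
  mass_le T (fun h => omega1 h + omega2 h) u.
Proof.
move=> huv hv; have := mass_le_sub huv (mass_leN hv).
by congr mass_le; apply/funext => s; rewrite opprK subrK.
Qed.

End ControlMass.

(** * From finite covers to compactness *)

Section Compactness.
Context (R : realType) (cplx : bool) (X : completeNormedModType (scalars R cplx)).
Variables (T : R).

Lemma continuous_upto_uniform_limit (x : R -> X) :
  (forall e : R, 0 < e -> exists2 y : R -> X, continuous_upto T y &
    forall t, 0 <= t <= T -> norm (y t - x t) <= e) ->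
  continuous_upto T x.
Proof.
move=> hx s sT e e0; have e30 : 0 < e / 4 by rewrite divr_gt0.
have [y yc yx] := hx _ e30; have [d d0 hd] := yc s sT _ e30.
exists d => // s' s'T ss'.
have h1 := hd s' s'T ss'; have h2 := yx s sT; have h3 := yx s' s'T.
have h4 := norm_triangle (y s') (x s') (x s).
have h5 := norm_triangle (y s) (y s') (x s).
by rewrite normB in h3; lra.
Qed.

(** An ultrafilter that contains a union of two sets contains one of them; induction over the cover
    finds a piece whose [N]-neighbourhood it contains. *)
Lemma ultra_finitely_covered (U V : Type) (F : set_system V) (N : U -> V -> Prop)
    (P : U -> U -> Prop) (B : set U) : UltraFilter F ->
  finitely_covered P B -> F [set z | exists2 u, B u & N u z] ->
  exists E : set U, (forall u v, E u -> E v -> P u v) /\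
    F [set z | exists2 u, E u & N u z].
Proof.
move=> UF; elim=> [{}B PB FB|{}B B1 B2 sB _ h1 _ h2 FB]; first by exists B.
have [|F1] := in_ultra_setVsetC [set z | exists2 u, B1 u & N u z] UF; first exact: h1.
apply: h2; apply: filterS (filterI FB F1) => z [[u Bu Nz] nz].
by case: (sB _ Bu) => Bu'; [exfalso; apply: nz; exists u|exists u].
Qed.

(** Completeness of [X] gives pointwise limits. The estimate is uniform because at each [t] the
    comparison passes through an element [y'] of the small set that may depend on [t]. *)
Lemma uniform_Cauchy_limit (F : set_system (R -> X)) : ProperFilter F ->
  (forall e : R, 0 < e -> exists2 E : set (R -> X), F E &
    forall x y, E x -> E y -> forall t, 0 <= t <= T -> norm (x t - y t) <= e) ->
  exists x : R -> X, forall e : R, 0 < e ->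
    F [set y : R -> X | forall t, 0 <= t <= T -> norm (y t - x t) <= e].
Proof.
move=> PF small.
have ptlim t : exists z : X, 0 <= t <= T ->
    forall e : R, 0 < e -> F [set y : R -> X | norm (y t - z) <= e].
  have [tT|ntT] := pselect (is_true (0 <= t <= T)); last by exists 0.
  have [z hz] : exists z : X, (fun y : R -> X => y t) @ F --> z.
    apply: cauchy_norm_cvg => e /small[E FE hE].
    exists [set a | exists2 y, E y & a = y t].
      have : F [set y : R -> X | exists2 y', E y' & y t = y' t].
        by apply: filterS FE => y Ey; exists y.
      by [].
    by move=> _ _ [y Ey ->] [y' Ey' ->]; exact: hE.
  exists z => _ e e0.
  have Fz : F [set y : R -> X | norm (y t - z) < e].
    by have /cvg_normP/(_ e e0) := hz.
  by apply: filterS Fz => y /ltW.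
have [x hx] := choice ptlim.
exists x => e e0; have e20 : 0 < e / 2 by rewrite divr_gt0.
have [E FE hE] := small _ e20; apply: (filterS _ FE) => y Ey t tT.
have [y' [Ey' y'x]] := filter_ex (filterI FE (hx t tT _ e20)).
have := hE y y' Ey Ey' t tT; have := norm_triangle (y' t) (y t) (x t).
by move=> h1 h2; move: y'x => /= h3; lra.
Qed.

(** Points of the closure are [e / 3]-close to the image, so a finite cover of the image thickens to
    one of the closure. An ultrafilter selects a piece for each [e] and is therefore uniformly
    Cauchy; its limit is continuous as a uniform limit of elements of [C0T]. *)
Lemma compact_closure_image (U : Type) (B : set U) (Phi : U -> R -> X) :
  (forall e : R, 0 < e -> finitely_covered (fun u v => forall t, 0 <= t <= T ->
    norm (Phi u t - Phi v t) <= e) B) ->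
  compact (closure (Phi @` B : set {uniform` `[0, T] -> X}) `&` @C0T R cplx X T).
Proof.
move=> cov; rewrite compact_ultra => F UF FA.
have PF : ProperFilter F by exact: ultra_proper.
have small (e : R) : 0 < e -> exists2 E : set (R -> X), F E &
    forall x y, E x -> E y -> forall t, 0 <= t <= T -> norm (x t - y t) <= e.
  move=> e0; have e30 : 0 < e / 3 by rewrite divr_gt0.
  pose N u (z : R -> X) := forall t, 0 <= t <= T -> norm (z t - Phi u t) <= e / 3.
  have [|E [PE FE]] := @ultra_finitely_covered U _ F N _ B UF (cov _ e30).
    apply: filterS FA => z [zc _].
    have nz : nbhs (z : {uniform` `[0, T] -> X})
        [set h | forall t, 0 <= t <= T -> norm (z t - h t) < e / 3].
      apply/uniform_nbhs; exists [set q | norm (q.1 - q.2) < e / 3]; split.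
        by apply/entourage_normP; exists (e / 3).
      by move=> h hz t tT; apply: hz; rewrite /= in_itv.
    have [_ [[u Bu <-] hu]] := zc _ nz.
    by exists u => // t tT; exact/ltW/hu.
  exists [set z | exists2 u, E u & N u z] => //.
  move=> x y [u Eu xu] [v Ev yv] t tT.
  have h1 := xu t tT; have h2 := yv t tT; have h3 := PE u v Eu Ev t tT.
  have h4 := norm_triangle (Phi u t) (x t) (y t).
  have h5 := norm_triangle (Phi v t) (Phi u t) (y t).
  by rewrite normB in h2; lra.
have [x unif] := @uniform_Cauchy_limit F PF small.
have Fx : F --> (x : {uniform` `[0, T] -> X}).
  move=> W /uniform_nbhs[V [/entourage_normP[e e0 eV] VW]].
  have e20 : 0 < e / 2 by rewrite divr_gt0.
  apply: filterS (unif _ e20) => y hy; apply: VW => t.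
  rewrite /= in_itv /= => tT; apply: eV; rewrite normB.
  by apply: le_lt_trans (hy t tT) _; lra.
exists (x : {uniform` `[0, T] -> X}); split=> //; split.
  apply: (@closed_closure {uniform` `[0, T] -> X}) => W /Fx FW.
  have [z [[zc _] Wz]] := filter_ex (filterI FA FW).
  by exists z.
apply/continuous_uptoP; apply: continuous_upto_uniform_limit => e e0.
have [y [[_ yc] hy]] := filter_ex (filterI FA (unif e e0)).
by exists y => //; apply/continuous_uptoP.
Qed.

End Compactness.

(** * Mild solutions as fixed points *)

Section MildSolutions.
Context (R : realType) (cplx : bool) (X : completeNormedModType (scalars R cplx)).
Variable S : R -> X -> X.
Hypothesis HS : C0_semigroup S.
Variables (T M : R).
Hypothesis T0 : 0 <= T.
Hypothesis M1 : 1 <= M.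
Hypothesis SM : forall t x, 0 <= t <= T -> norm (S t x) <= M * norm x.
Variables (m : nat) (f : 'I_m -> R -> X -> X).
Hypothesis fc : forall i h, continuous_upto T h -> continuous_upto T (fun s => f i s (h s)).
Variables (xi0 : X) (omega : R -> R) (u : 'I_m -> R -> R).
Hypothesis hu : controls_mass_le T omega u.

(** Uniqueness of the Bochner integral turns the existential definition into a fixed point
    equation. *)
Lemma mild_solutionP (x : R -> X) : mild_solution S f T xi0 u x <->
  continuous_upto T x /\ forall t, 0 <= t <= T -> x t = mild_map S f xi0 u x t.
Proof.
split=> [[/continuous_uptoP xc xE]|[xc xE]].
  split=> // t tT; have [I [hI ->]] := xE t tT; congr (_ + _).
  apply: eq_bigr => i _; have fxc := fc i xc.
  exact: (convolution_unique HS M1 SM (hu i) fxc tT (hI i)).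
split; first exact/continuous_uptoP.
move=> t tT; exists (fun i => convolution S (u i) (fun s => f i s (x s)) t); split.
  by move=> i; have fxc := fc i xc; refine (convolutionP HS M1 SM (hu i) fxc tT).
exact: xE.
Qed.

End MildSolutions.

Lemma max_norm_le (R : realType) (cplx : bool) (X : normedModType (scalars R cplx))
    (T c : R) (x : R -> X) : 0 <= T -> (forall t, 0 <= t <= T -> norm (x t) <= c) ->
  max_norm T x <= c.
Proof.
move=> T0 xc; apply: ge_sup.
  by exists (norm (x 0)), 0 => //=; rewrite in_itv /= lexx.
by move=> _ [t /= + <-]; rewrite in_itv => /xc.
Qed.

Theorem theorem3p1 (R : realType) (cplx : bool)
    (X : completeNormedModType (scalars R cplx))
    (DA : set X) (A : X -> X) (etA : R -> X -> X)
    (HetA : C0_semigroup etA) (HA : infinitesimal_generator DA A etA)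
    (p : \bar R) (Hp : (1 < p)%E)
    (m : nat) (f : 'I_m -> R -> X -> X)
    (Hf : forall i, continuous_field (f i))
    (HA1 : forall i, assumption_A1 (f i))
    (HA2 : forall i, assumption_A2 (f i))
    (T : R) (HT : 0 <= T) (xi0 : X) :
  exists Phi : ('I_m -> R -> R) -> R -> X,
    [/\ forall u, Lp T p u ->
          mild_solution etA f T xi0 u (Phi u) /\
          (forall x, mild_solution etA f T xi0 u x ->
             {in `[0, T], x =1 Phi u}),
        compact_operator T p Phi
      & locally_Lipschitz_operator T p Phi].
Proof.
have [M M1 SM] := semigroup_bounded HetA T.
have fc i h (hc : continuous_upto T h) := field_continuous_upto (Hf i) hc.
have exab i : exists q : R * R, [/\ 0 <= q.1, 0 <= q.2 &
    forall t x, 0 <= t <= T -> norm (f i t x) <= q.1 * norm x + q.2].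
  by have [a [b h]] := field_growth T (Hf i) (HA2 i); exists (a, b).
have [ab hab] := choice exab.
(* Sums of nonnegative constants serve as bounds common to all fields. *)
pose al := \sum_i (ab i).1; pose be := \sum_i (ab i).2.
have al0 : 0 <= al by apply: sumr_ge0 => i _; case: (hab i).
have be0 : 0 <= be by apply: sumr_ge0 => i _; case: (hab i).
have growth i t x : 0 <= t <= T -> norm (f i t x) <= al * norm x + be.
  move=> tT; have [a0 b0 h] := hab i; rewrite (le_trans (h t x tT))// lerD//.
    rewrite ler_wpM2r ?norm_ge0// /al (bigD1 i)//= lerDl.
    by apply: sumr_ge0 => j _; case: (hab j).
  by rewrite /be (bigD1 i)//= lerDl; apply: sumr_ge0 => j _; case: (hab j).
have lip (r : R) : exists2 L : R, 0 <= L & forall i t x y, 0 <= t <= T ->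
    norm x <= r -> norm y <= r -> norm (f i t x - f i t y) <= L * norm (x - y).
  have exL i : exists L : R, 0 <= L /\ forall t x y,
      0 <= t <= T -> norm x <= r -> norm y <= r ->
      norm (f i t x - f i t y) <= L * norm (x - y).
    by have [L L0 h] := field_lipschitz T r (Hf i) (HA1 i); exists L.
  have [L hL] := choice exL.
  exists (\sum_i L i); first by apply: sumr_ge0 => i _; case: (hL i).
  move=> i t x y tT xr yr; have [_ h] := hL i.
  rewrite (le_trans (h t x y tT xr yr))// ler_wpM2r ?norm_ge0//.
  by rewrite (bigD1 i)//= lerDl; apply: sumr_ge0 => j _; case: (hL j).
have [theta th0 [Lp_mass Lp_mass1]] := hoelder_controls m Hp.
exists (mild_flow etA f xi0); split.
- move=> u Lu; have [C hC] := Lp_mass1 T u Lu.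
  have mo : modulus (fun h : R => C * h `^ theta) by exact: modulus_powR.
  have solP := mild_solutionP HetA M1 SM fc xi0 hC.
  have flow : mild_solution etA f T xi0 u (mild_flow etA f xi0 u).
    apply/solP; split.
      exact: (mild_flow_continuous HetA HT M1 SM fc al0 be0 growth lip xi0 mo hC).
    move=> t tT.
    exact: (mild_flow_fixed HetA HT M1 SM fc al0 be0 growth lip xi0 mo hC tT).
  split=> // x /solP[xc xE] t; rewrite in_itv => tT.
  have /solP[yc yE] := flow.
  exact: (mild_fixed_unique HetA HT M1 SM fc lip mo hC xc yc xE yE).
- move=> B BLp [C hC]; apply: compact_closure_image => e e0.
  have mo : modulus (fun h : R => C * h `^ theta) by exact: modulus_powR.
  apply: (mild_flow_finitely_covered HetA HT M1 SM fc al0 be0 growth lip xi0 mo _ e0).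
  move=> u Bu i; have mu_ j := Lp_measurable j (BLp _ Bu).
  split=> // a b a0 le_ab bT; apply: (le_trans (Lp_mass T u mu_ i a b a0 le_ab bT)).
  rewrite mulrC EFinM; apply: lee_wpmul2l; last exact: hC.
  by rewrite lee_fin powR_ge0.
- move=> u0 Lu0; have [C hC] := Lp_mass1 T u0 Lu0.
  (* A modulus common to the unit ball around [u0]: the difference [u - u0] has norm less than 1 and
     contributes [h ^ theta], the centre contributes [C h ^ theta]. *)
  pose om h := 1 * h `^ theta + C * h `^ theta.
  have mo : modulus om by apply: modulusD; exact: modulus_powR.
  have [k k0 hk] := mild_flow_lipschitz HetA HT M1 SM fc al0 be0 growth lip xi0 mo.
  (* [T ^ theta] converts the [L^p] distance into an [L^1] distance; adding 1 makes the constant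
     positive, so that an infinite distance gives an infinite right-hand side. *)
  have K0 : 0 < k * T `^ theta + 1 by rewrite ltr_wpDl// mulr_ge0 ?powR_ge0// ltW.
  have ball u : Lp T p u -> (Lp_dist T p u u0 < 1%:E)%E -> controls_mass_le T om u.
    move=> Lu du i; apply: (mass_le_of_sub _ (hC i)).
    have md j : measurable_fun setT (fun s => u j s - u0 j s).
      by apply: measurable_funB; apply: Lp_measurable; eassumption.
    split=> // a b a0 le_ab bT.
    apply: (le_trans (Lp_mass T _ md i a b a0 le_ab bT)).
    rewrite mulrC EFinM; apply: lee_wpmul2l; last exact: ltW.
    by rewrite lee_fin powR_ge0.
  exists 1, (k * T `^ theta + 1); split=> // u v Lu Lv du dv.
  have d0 : (0 <= Lp_dist T p u v)%E by exact: Lnorm_ge0.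
  have md j : measurable_fun setT (fun s => u j s - v j s).
    by apply: measurable_funB; apply: Lp_measurable; eassumption.
  have [->|] := eqVneq (Lp_dist T p u v) +oo%E.
    by rewrite gt0_muley ?lte_fin// leey.
  rewrite -ltey -ge0_fin_numE// => dfin.
  set d := fine (Lp_dist T p u v); have dE : d%:E = Lp_dist T p u v by rewrite fineK.
  have d'0 : 0 <= d by rewrite fine_ge0.
  rewrite -dE -EFinM lee_fin; apply: max_norm_le => // t tT.
  have dT : 0 <= T `^ theta * d by rewrite mulr_ge0// powR_ge0.
  have := hk u v (T `^ theta * d) (ball u Lu du) (ball v Lv dv) dT.
  move=> /(_ _ t tT) /le_trans; apply.
    move=> i; have := Lp_mass T _ md i 0 T (lexx _) HT (lexx _).
    by rewrite subr0 EFinM dE.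
  by rewrite mulrA ler_wpM2r// lerDl.
Qed.
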